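(* Let $\mathcal P$ be a finite poset with order relation $\prec$, let $d=(d_0;d_i)_{i\in\mathcal P}$ be a dimension vector, and let $\chi=(\chi_0;\chi_i)_{i\in\mathcal P}$ be a weight (a tuple of positive integers) such that $\sum_{i\in\mathcal P}\chi_i d_i=\chi_0 d_0$. Let $$A=\Big\{(P_i)_{i\in\mathcal P}\in (M_{d_0}(\mathbb C))^{\mathcal P}\ \Big|\ P_i=P_i^*=P_i^2,\ \operatorname{rank}(P_i)=d_i\ (i\in\mathcal P);\ P_iP_j=P_jP_i=P_i\ \text{whenever } i\prec j;\ \sum_{i\in\mathcal P}\chi_iP_i=\chi_0 I\Big\},$$ on which $U(d_0)$ acts by simultaneous conjugation, and let $$B=\big\{(V_i)_{i\in\mathcal P}\in R_{\mathcal P,d}\ \big|\ (\mathbb C^{d_0};V_i)_{i\in\mathcal P}\ \text{is } \chi\text{-polystable}\big\},$$ on which $GL(d_0)$ acts by $g\cdot(V_i)_{i\in\mathcal P}=(g(V_i))_{i\in\mathcal P}$. Then the map $\Phi:(P_i)_{i\in\mathcal P}\mapsto(\mathbb C^{d_0};\operatorname{Im}P_i)_{i\in\mathcal P}$ induces a homeomorphism, with respect to the usual orbit-space (quotient) topologies, $$A/U(d_0)\ \cong\ B/GL(d_0).$$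
   Context: A (linear) representation of a finite poset $\mathcal P$ is a system $(V;V_i)_{i\in\mathcal P}$ where $V$ is a finite-dimensional complex vector space, each $V_i$ is a linear subspace of $V$, and $V_i\subset V_j$ whenever $i\prec j$. Its dimension vector is the tuple of non-negative integers $(\dim V;\dim V_i)_{i\in\mathcal P}$. Direct sums are the usual ones: $(V;V_i)\oplus(W;W_i)=(V\oplus W;V_i\oplus W_i)$. Two representations $(V;V_i)$ and $(\tilde V;\tilde V_i)$ are isomorphic if there is a linear isomorphism $f:V\to\tilde V$ with $f(V_i)=\tilde V_i$ for all $i$. For a dimension vector $d=(d_0;d_i)_{i\in\mathcal P}$, $$R_{\mathcal P,d}=\Big\{(V_i)_{i\in\mathcal P}\in\prod_{i\in\mathcal P}\mathrm{Gr}(d_i,d_0)\ \Big|\ V_i\subset V_j\ \text{whenever } i\prec j\Big\},$$ where $\mathrm{Gr}(d_i,d_0)$ is the Grassmannian of $d_i$-dimensional linear subspaces of $\mathbb C^{d_0}$. An element $(V_i)_{i\in\mathcal P}$ is identified with the representation $(\mathbb C^{d_0};V_i)_{i\in\mathcal P}$. The spaces $R_{\mathcal P,d}$ and $M_{d_0}(\mathbb C)^{\mathcal P}$ carry their classical (Euclidean/manifold) topologies, and subsets carry the subspace topology. The adjoint $P^*$ is taken with respect to the standard Hermitian inner product on $\mathbb C^{d_0}$. Stability: a representation $(V;V_i)_{i\in\mathcal P}$ with $V\neq 0$ is stable (with respect to $\chi$) if $$\frac{1}{\dim K}\sum_{i\in\mathcal P}\chi_i\dim(V_i\cap K)<\frac{1}{\dim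 V}\sum_{i\in\mathcal P}\chi_i\dim V_i$$ for every proper nonzero subspace $K\subset V$. A representation is $\chi$-polystable if it decomposes into a direct sum of stable representations $(\tilde V;\tilde V_i)_{i\in\mathcal P}$, each of which satisfies $\sum_{i\in\mathcal P}\chi_i\dim\tilde V_i=\chi_0\dim\tilde V$. *)

(* Defs.v *)
(* The complex numbers are R[i] for R : realType. *)
From HB Require Import structures.
From mathcomp Require Import all_boot all_order all_algebra.
From mathcomp Require Import generic_quotient complex.
From mathcomp Require Import all_classical all_reals all_analysis.

Set Implicit Arguments.
Unset Strict Implicit.
Unset Printing Implicit Defensive.

Import Order.TTheory GRing.Theory Num.Theory.
Import numFieldNormedType.Exports.

Local Open Scope classical_set_scope.
Local Open Scope quotient_scope.
Local Open Scope complex_scope.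
Local Open Scope sesquilinear_scope.
Local Open Scope ring_scope.

(* The topology of the norm `|z|; the library attaches it only to the regular
   module R[i]^o. *)
HB.instance Definition _ (R : realType) :=
  PseudoPointedMetric.copy R[i] (R[i] : numClosedFieldType)^o.


Section PosetRepresentations.
Context {C : fieldType} {disp : Order.disp_t} {P : finPOrderType disp}.

Record poset_rep := PosetRep {
  rep_space : vectType C;
  rep_sub : P -> {vspace rep_space};
  rep_subS : forall i j : P, (i < j)%O -> (rep_sub i <= rep_sub j)%VS
}.

Definition rep_dim (M : poset_rep) : nat := \dim {:rep_space M}.

Definition rep_iso (M N : poset_rep) : Prop :=
  exists f : 'Hom(rep_space M, rep_space N),
    bijective f /\ forall i, (f @: rep_sub M i)%VS = rep_sub N i.

Definition rep0 : poset_rep :=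
  @PosetRep 'cV[C]_0 (fun=> 0%VS) (fun i j _ => subvv _).

Lemma rep_dsum_subS (M N : poset_rep) (i j : P) : (i < j)%O ->
  (linfun fst @^-1: rep_sub M i :&: linfun snd @^-1: rep_sub N i
   <= (linfun fst @^-1: rep_sub M j :&: linfun snd @^-1: rep_sub N j
       : {vspace rep_space M * rep_space N}))%VS.
Proof. by move=> ltij; apply: capvS; apply: lpreimS; exact: rep_subS. Qed.

(* The i-th subspace is the set of pairs (v, w) with v \in M_i and w \in N_i. *)
Definition rep_dsum (M N : poset_rep) : poset_rep :=
  @PosetRep (rep_space M * rep_space N)%type
    (fun i => linfun fst @^-1: rep_sub M i :&: linfun snd @^-1: rep_sub N i)%VS
    (@rep_dsum_subS M N).

Definition stable (chi : P -> nat) (M : poset_rep) : Prop :=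
  (0 < rep_dim M)%N /\
  forall K : {vspace rep_space M}, K != 0%VS -> K != fullv ->
    ((\dim K)%:R^-1 * \sum_i (chi i)%:R * (\dim (rep_sub M i :&: K))%:R
     < (rep_dim M)%:R^-1 * \sum_i (chi i)%:R * (\dim (rep_sub M i))%:R :> rat).

(* The empty direct sum (n = 0) is allowed: the zero representation is
   polystable. *)
Definition polystable (chi0 : nat) (chi : P -> nat) (M : poset_rep) : Prop :=
  exists (n : nat) (N : 'I_n -> poset_rep),
    (forall k, stable chi (N k) /\
       (\sum_i chi i * \dim (rep_sub (N k) i) = chi0 * rep_dim (N k))%N) /\
    rep_iso M (\big[rep_dsum/rep0]_(k < n) N k).

End PosetRepresentations.
Arguments poset_rep C {disp} P.

Section Grassmannian.
Context {C : fieldType}.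

Definition mx_act {m n : nat} (M : 'M[C]_(m, n)) : 'Hom('cV[C]_n, 'cV[C]_m) :=
  linfun (mulmx M).

Definition column_space {m n : nat} (M : 'M[C]_(m, n)) : {vspace 'cV[C]_m} :=
  limg (mx_act M).

Lemma mx_actE m n (M : 'M[C]_(m, n)) v : mx_act M v = M *m v.
Proof. by rewrite lfunE. Qed.

Lemma dim_column_space m n (M : 'M[C]_(m, n)) :
  \dim (column_space M) = \rank M.
Proof.
have ME p (v : 'M[C]_(n, p)) : M *m v = col_base M *m (row_base M *m v).
  by rewrite mulmxA mulmx_base.
have -> : column_space M = column_space (col_base M).
  apply/eqP; rewrite eqEsubv; apply/andP; split; apply/subvP => w.
    case/memv_imgP => v _ ->; rewrite mx_actE ME -(mx_actE (col_base M)).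
    by rewrite memv_img ?memvf.
  case/memv_imgP => v _ ->; rewrite mx_actE.
  have -> : col_base M *m v = M *m (pinvmx (row_base M) *m v).
    by rewrite ME (mulmxA (row_base M)) mulmxVp ?mul1mx// row_base_free.
  by rewrite -mx_actE memv_img ?memvf.
rewrite limg_dim_eq ?dimvf /dim /= ?muln1 //.
apply/eqP; rewrite -subv0; apply/subvP => v.
rewrite memv_cap memvf memv_ker mx_actE memv0 => /eqP Mv0.
have free : row_free (col_base M)^T.
  by rewrite /row_free mxrank_tr; exact: col_base_full.
by rewrite -trmx_eq0 -(mulmx_free_eq0 _ free) -trmx_mul Mv0 trmx0.
Qed.

End Grassmannian.

Section GrassmannianTopology.
Context {R : realType}.
Local Notation C := R[i].

(* The Grassmannian of k-dimensional subspaces of C^n is topologized as the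
   quotient of the space of k-frames by the map sending a frame to its span. *)
Definition frame (k n : nat) : set 'M[C]_(n, k) :=
  [set M | \rank M = k].
#[global] Arguments frame k n : clear implicits.

Definition subspace_of_dim (k n : nat) : Type :=
  {W : {vspace 'cV[C]_n} | \dim W == k}.

Lemma frame_span_subproof k n (M : frame k n) :
  \dim (column_space (val M)) == k.
Proof. by rewrite dim_column_space; apply/eqP; exact: set_mem (valP M). Qed.

Definition frame_span k n (M : frame k n) : subspace_of_dim k n :=
  exist _ (column_space (val M)) (frame_span_subproof M).

Lemma frame_span_surj k n (W : subspace_of_dim k n) :
  exists M : frame k n, frame_span M = W.
Proof.
case: W => W dimW; have /eqP eW := dimW.
pose M : 'M[C]_(n, k) := \matrix_(i, j) (vbasis W)`_j i 0.
have MW : column_space M = W.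
  apply/eqP; rewrite eqEsubv; apply/andP; split.
    apply/subvP => w /memv_imgP[v _ ->]; rewrite mx_actE.
    have -> : M *m v = \sum_j v j 0 *: (vbasis W)`_j.
      apply/colP => i; rewrite !mxE summxE; apply: eq_bigr => j _.
      by rewrite !mxE mulrC.
    apply: memv_suml => j _; apply: memvZ; apply: vbasis_mem.
    by rewrite mem_nth// size_tuple eW.
  rewrite -{1}(span_basis (vbasisP W)); apply/span_subvP => w.
  move=> /(nthP 0)[j]; rewrite size_tuple => jW <-.
  have jk : (j < k)%N by rewrite -eW.
  have -> : (vbasis W)`_j = M *m delta_mx (Ordinal jk) 0.
    by rewrite -colE; apply/colP => i; rewrite !mxE.
  by rewrite -mx_actE memv_img ?memvf.
have rkM : M \in frame k n.
  by apply/mem_set; rewrite /frame/= -dim_column_space MW.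
by exists (exist _ M rkM); apply: val_inj.
Qed.

Definition some_frame k n (W : subspace_of_dim k n) : frame k n :=
  sval (cid (frame_span_surj W)).

Lemma some_frameK k n : cancel (@some_frame k n) (@frame_span k n).
Proof. by move=> W; rewrite /some_frame; case: cid. Qed.

HB.instance Definition _ k n :=
  isQuotient.Build (frame k n) (subspace_of_dim k n) (@some_frameK k n).

Definition Gr (k n : nat) : topologicalType :=
  quotient_topology (subspace_of_dim k n).

Definition Gr_space k n (W : Gr k n) : {vspace 'cV[C]_n} :=
  val (W : subspace_of_dim k n).

End GrassmannianTopology.

Section OrbitSpaces.
Context {R : realType} {disp : Order.disp_t} {P : finPOrderType disp}.
Local Notation C := R[i].
Variables (d0 : nat) (d : P -> nat) (chi0 : nat) (chi : P -> nat).

Definition configurations :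
    set (prod_topology (fun i : P => Gr (R := R) (d i) d0)) :=
  [set V | forall i j, (i < j)%O -> (Gr_space (V i) <= Gr_space (V j))%VS].

Definition rep_of (V : configurations) : poset_rep C P :=
  @PosetRep _ _ _ 'cV[C]_d0 (fun i => Gr_space (val V i)) (set_mem (valP V)).

Definition polystable_configurations : set configurations :=
  [set V | polystable chi0 chi (rep_of V)].

Definition projection_systems : set {ptws P -> 'M[C]_d0} :=
  [set p |
    [/\ forall i, [/\ p i = (p i)^t*, p i = p i *m p i & \rank (p i) = d i],
        forall i j, (i < j)%O -> p i *m p j = p i /\ p j *m p i = p i &
        \sum_i (chi i)%:R *: p i = chi0%:R%:M]].

Definition U_orbit (p q : projection_systems) : bool :=
  `[< exists2 u : 'M[C]_d0, u \is unitarymx &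
        forall i, val q i = u *m val p i *m u^t* >].

Definition GL_orbit (V W : polystable_configurations) : bool :=
  `[< exists2 g : 'M[C]_d0, g \in unitmx &
        forall i, Gr_space (val (val W) i) =
                  (mx_act g @: Gr_space (val (val V) i))%VS >].

Lemma U_orbit_refl : reflexive U_orbit.
Proof.
move=> p; apply/asboolP; exists 1%:M.
  by apply/unitarymxP; rewrite trmx1 map_mx1 mulmx1.
by move=> i; rewrite trmx1 map_mx1 mulmx1 mul1mx.
Qed.

Lemma U_orbit_inv p q : U_orbit p q -> U_orbit q p.
Proof.
move=> /asboolP[u uU uE]; apply/asboolP; exists (u^t*).
  by rewrite trmxC_unitary.
have uuC : u^t* *m u = 1%:M by apply: mulmx1C; exact/unitarymxP.
move=> i; rewrite uE trmxCK !mulmxA uuC mul1mx.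
by rewrite -mulmxA uuC mulmx1.
Qed.

Lemma U_orbit_sym : symmetric U_orbit.
Proof. by move=> p q; apply/idP/idP => /U_orbit_inv. Qed.

Lemma U_orbit_trans : transitive U_orbit.
Proof.
move=> q p r /asboolP[u uU uE] /asboolP[v vU vE]; apply/asboolP.
exists (v *m u); first by rewrite mul_unitarymx.
by move=> i; rewrite vE uE trmx_mul map_mxM !mulmxA.
Qed.

Definition U_equiv : equiv_rel projection_systems :=
  EquivRel U_orbit U_orbit_refl U_orbit_sym U_orbit_trans.

Lemma mx_act1 n : mx_act (1%:M : 'M[C]_n) = \1%VF.
Proof. by apply/lfunP => v; rewrite mx_actE mul1mx id_lfunE. Qed.

Lemma mx_actM m n p (g : 'M[C]_(m, n)) (h : 'M[C]_(n, p)) :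
  mx_act (g *m h) = (mx_act g \o mx_act h)%VF.
Proof. by apply/lfunP => v; rewrite comp_lfunE !mx_actE mulmxA. Qed.

Lemma GL_orbit_refl : reflexive GL_orbit.
Proof.
move=> V; apply/asboolP; exists 1%:M; first exact: unitmx1.
by move=> i; rewrite mx_act1 lim1g.
Qed.

Lemma GL_orbit_inv V W : GL_orbit V W -> GL_orbit W V.
Proof.
move=> /asboolP[g gU gE]; apply/asboolP; exists (invmx g).
  by rewrite unitmx_inv.
by move=> i; rewrite gE -limg_comp -mx_actM mulVmx// mx_act1 lim1g.
Qed.

Lemma GL_orbit_sym : symmetric GL_orbit.
Proof. by move=> V W; apply/idP/idP => /GL_orbit_inv. Qed.

Lemma GL_orbit_trans : transitive GL_orbit.
Proof.
move=> W V X /asboolP[g gU gE] /asboolP[h hU hE]; apply/asboolP.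
exists (h *m g); first by rewrite unitmx_mul hU.
by move=> i; rewrite hE gE mx_actM limg_comp.
Qed.

Definition GL_equiv : equiv_rel polystable_configurations :=
  EquivRel GL_orbit GL_orbit_refl GL_orbit_sym GL_orbit_trans.

Definition projection_orbits : topologicalType :=
  quotient_topology {eq_quot U_equiv}.

Definition polystable_orbits : topologicalType :=
  quotient_topology {eq_quot GL_equiv}.

Definition U_class (p : projection_systems) : projection_orbits :=
  \pi_{eq_quot U_equiv} p.

Definition GL_class (V : polystable_configurations) : polystable_orbits :=
  \pi_{eq_quot GL_equiv} V.

End OrbitSpaces.
#[global] Arguments projection_systems R {disp P} d0 d chi0 chi.
#[global] Arguments polystable_configurations R {disp P} d0 d chi0 chi.
#[global] Arguments projection_orbits R {disp P} d0 d chi0 chi.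
#[global] Arguments polystable_orbits R {disp P} d0 d chi0 chi.

Definition homeomorphism (X Y : topologicalType) (f : X -> Y) : Prop :=
  continuous f /\
  exists g : Y -> X, [/\ continuous g, cancel f g & cancel g f].

(* Main.v *)
(** The solutions of the moment equation [sum_i chi_i P_i = chi_0] are matched with the
    polystable configurations in the manner of Kempf and Ness.

    From projections to subspaces: for an orthogonal projection [e] onto [K], taking
    the trace of the moment equation against [e] and [dim (V_i :&: K) <= tr (P_i e)]
    gives the slope inequality, with equality only if [e] commutes with all [P_i];
    a minimal nonzero such [e] splits off a stable summand.

    From subspaces to projections: if [V] is stable and [M_i] is a frame of [V_i], then
    [prod_i det((g M_i)^* (g M_i))^chi_i / |det g|^(2 chi_0)] attains its minimum on GL.
    Writing [g = u t v] with [t] a decreasing positive diagonal, stability and Abel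
    summation bound [t_1 / t_n] on a sublevel set.  Varying a minimizer [g] by
    [1 + s w w^*] yields the moment equation for the projections onto [g V_i].

    Injectivity: if [g P_i = Q_i g P_i], pairing the two moment equations with [g]
    forces [g P_i = Q_i g], and the unitary part of [g] conjugates [P] into [Q].

    The inverse is continuous although [GL] is not compact: let [g(x)] map [Im P_i(x)]
    onto [Im Q_i(x)] along an ultrafilter, with limits [P_i] and [Q_i] again solving the
    moment equation, and [g(x) = u(x) r(x) v(x)].  The singular values group by
    comparable growth; the moment equation forces [Q_i] to commute with the coordinate
    projections onto the groups, and rescaling each group produces in the limit an
    invertible map between the two systems. *)

Require Import Defs.
From HB Require Import structures.
From mathcomp Require Import all_boot all_order all_fingroup all_algebra.
From mathcomp Require Import generic_quotient complex.
From mathcomp Require Import zify ring.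
From mathcomp Require Import all_classical all_reals all_analysis.

Set Implicit Arguments.
Unset Strict Implicit.
Unset Printing Implicit Defensive.

Import Order.TTheory GRing.Theory Num.Theory.
Import numFieldNormedType.Exports.
Import VectorInternalTheory.

Local Open Scope classical_set_scope.
Local Open Scope quotient_scope.
Local Open Scope sesquilinear_scope.
Local Open Scope ring_scope.

(** * Orthogonal projections *)

Section Adjoint.
Context {C : numClosedFieldType}.

(** The inverse map needs, for each polystable configuration, a solution of the moment equation.
    That solution and the matrix carrying the configuration to it are mere choices, with no
    continuity in the configuration; only the unitary class of the solution varies continuously.
    Hence the use of ultrafilters: along one of them every bounded quantity (projections, unitary
    factors, normalized singular values) converges at once, without extraction of subsequences and
    without countability assumptions. In the comparison near [V0], one family consists of
    projections onto the images under the matrix chosen at [V0], kept fixed. These need not solve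
    the moment equation away from [V0], but their limit does; so the degeneration argument may use
    the equation only for the two limits. All rigidity comes from one device: a trace of a product
    of orthogonal projections is a squared norm, so an equality of traces becomes an identity of
    matrices. *)

Lemma adjmxM m n p (A : 'M[C]_(m, n)) (B : 'M[C]_(n, p)) :
  (A *m B)^t* = B^t* *m A^t*.
Proof. by rewrite trmx_mul map_mxM. Qed.

Lemma adjmxB m n (A B : 'M[C]_(m, n)) : (A - B)^t* = A^t* - B^t*.
Proof. by apply/matrixP => i j; rewrite !mxE rmorphB. Qed.

Lemma adjmxD m n (A B : 'M[C]_(m, n)) : (A + B)^t* = A^t* + B^t*.
Proof. by apply/matrixP => i j; rewrite !mxE rmorphD. Qed.

Lemma adjmx_sum m n (I : Type) (r : seq I) (A : I -> 'M[C]_(m, n)) :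
  (\sum_(i <- r) A i)^t* = \sum_(i <- r) (A i)^t*.
Proof.
apply/matrixP => i j; rewrite summxE !mxE summxE rmorph_sum.
by apply: eq_bigr => k _; rewrite !mxE.
Qed.

Lemma adjmxZ m n a (A : 'M[C]_(m, n)) : (a *: A)^t* = a^* *: A^t*.
Proof. by apply/matrixP => i j; rewrite !mxE rmorphM. Qed.

Lemma adjmx_scalar n (a : C) : (a%:M)^t* = (a^*)%:M :> 'M[C]_n.
Proof. by rewrite tr_scalar_mx map_scalar_mx. Qed.

Lemma adjmx1 n : (1%:M)^t* = 1%:M :> 'M[C]_n.
Proof. by rewrite trmx1 map_mx1. Qed.

Lemma adjmx_diag n (v : 'rV[C]_n) : (diag_mx v)^t* = diag_mx (map_mx Num.conj v).
Proof. by rewrite tr_diag_mx map_diag_mx. Qed.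

Lemma mxrank_adj m n (A : 'M[C]_(m, n)) : \rank (A^t*) = \rank A.
Proof. by rewrite mxrank_map mxrank_tr. Qed.

Lemma det_adj n (A : 'M[C]_n) : \det (A^t*) = (\det A)^*.
Proof. by rewrite det_map_mx det_tr. Qed.

Lemma adjmx_inv n (A : 'M[C]_n) : (invmx A)^t* = invmx (A^t*).
Proof. by rewrite trmx_inv map_invmx. Qed.

Lemma mxtrace_mul_adjE m n (A : 'M[C]_(m, n)) :
  \tr (A *m A^t*) = \sum_i \sum_j `|A i j| ^+ 2.
Proof.
apply: eq_bigr => i _; rewrite !mxE; apply: eq_bigr => j _.
by rewrite !mxE normCK.
Qed.

Lemma mxtrace_mul_adj_ge0 m n (A : 'M[C]_(m, n)) : 0 <= \tr (A *m A^t*).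
Proof.
by rewrite mxtrace_mul_adjE; do 2![apply: sumr_ge0 => ? _]; exact: exprn_ge0.
Qed.

Lemma mxtrace_mul_adj_eq0 m n (A : 'M[C]_(m, n)) :
  (\tr (A *m A^t*) == 0) = (A == 0).
Proof.
apply/eqP/eqP => [|->]; last by rewrite mul0mx mxtrace0.
rewrite mxtrace_mul_adjE => A0; apply/matrixP => i j; rewrite mxE.
have ge0 i' : true -> 0 <= \sum_j `|A i' j| ^+ 2.
  by move=> _; apply: sumr_ge0 => ? _; exact: exprn_ge0.
have /(_ i isT) Ai0 := psumr_eq0P ge0 A0.
have ge0' j' : true -> 0 <= `|A i j'| ^+ 2 by move=> _; exact: exprn_ge0.
have /(_ j isT) /eqP := psumr_eq0P ge0' Ai0.
by rewrite expf_eq0 /= normr_eq0 => /eqP.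
Qed.

Lemma mul_adj_eq0 m n (A : 'M[C]_(m, n)) : (A *m A^t* == 0) = (A == 0).
Proof.
apply/eqP/eqP => [A0|->]; last by rewrite mul0mx.
by apply/eqP; rewrite -mxtrace_mul_adj_eq0 A0 mxtrace0.
Qed.

Definition orth_proj n (p : 'M[C]_n) := p^t* = p /\ p *m p = p.

Lemma orth_proj0 n : @orth_proj n 0.
Proof. by split; rewrite ?mul0mx// trmx0 map_mx0. Qed.

Lemma orth_projC n (p : 'M[C]_n) : orth_proj p -> orth_proj (1%:M - p).
Proof.
case=> pH pI; split; first by rewrite adjmxB adjmx1 pH.
by rewrite mulmxBl mul1mx mulmxBr mulmx1 pI subrr subr0.
Qed.

(** Doubling [p] and [q] by idempotence and rotating the trace produces a squared Frobenius norm.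
    Positivity and the equality cases of all later trace estimates come from here. *)
Lemma tr_orth_proj_sandwich m n (p : 'M[C]_m) (q : 'M[C]_n) (A : 'M[C]_(m, n)) :
  orth_proj p -> orth_proj q ->
  \tr (A^t* *m p *m A *m q) = \tr (p *m A *m q *m (p *m A *m q)^t*).
Proof.
move=> [pH pI] [qH qI]; rewrite !adjmxM pH qH.
have -> : p *m A *m q *m (q *m (A^t* *m p)) = (p *m A *m q) *m (A^t* *m p).
  by rewrite mulmxA -(mulmxA _ q q) qI.
by rewrite [RHS]mxtrace_mulC !mulmxA -(mulmxA _ p p) pI.
Qed.

Lemma tr_orth_proj_mul n (p q : 'M[C]_n) : orth_proj p -> orth_proj q ->
  \tr (p *m q) = \tr (p *m q *m (p *m q)^t*).
Proof.
move=> op oq; have := tr_orth_proj_sandwich (1%:M) op oq.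
by rewrite adjmx1 mul1mx !mulmx1.
Qed.

(** In a rank factorization [p = c *m r], idempotence cancels to [r *m c = 1%:M], whose trace is the
    rank. *)
Lemma mxtrace_idem n (p : 'M[C]_n) : p *m p = p -> \tr p = (\rank p)%:R.
Proof.
move=> pI; rewrite -{1}(mulmx_base p) mxtrace_mulC.
suff -> : row_base p *m col_base p = 1%:M by rewrite mxtrace1.
have /row_freeP[X rX] := row_base_free p.
have /row_fullP[Y Yc] := col_base_full p.
have := mulmx_base p.
move: (\rank p) (col_base p) (row_base p) X rX Y Yc => k c r X rX Y Yc e.
move: pI; rewrite -e => /(congr1 (fun Z => Y *m Z *m X)).
by rewrite !mulmxA Yc !mul1mx -(mulmxA _ r X) rX mulmx1.
Qed.

(** A diagonal entry is the squared norm of its row, hence dominates its own square and is at most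
    1. This bound is the source of compactness for families of projections. *)
Lemma orth_proj_entry_le1 n (p : 'M[C]_n) i j : orth_proj p -> `|p i j| <= 1.
Proof.
move=> [pH pI].
have pii : p i i = \sum_k `|p i k| ^+ 2.
  rewrite -{1}pI -{2}pH mxE; apply: eq_bigr => k _.
  by rewrite !mxE -normCK.
have le k : `|p i k| ^+ 2 <= p i i.
  rewrite pii (bigD1 k)//= lerDl; apply: sumr_ge0 => ? _; exact: exprn_ge0.
have pii0 : 0 <= p i i.
  by rewrite pii; apply: sumr_ge0 => ? _; exact: exprn_ge0.
have pii1 : p i i <= 1.
  have := le i; rewrite ger0_norm// expr2.
  have [->//|pn0] := eqVneq (p i i) 0.
  by rewrite -ler_pdivlMl ?mulVf// lt_def pn0.
rewrite -(@ler_pXn2r _ 2) ?nnegrE// expr1n.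
exact: le_trans (le j) pii1.
Qed.

(* [invmx] is the identity on singular matrices, so this is an orthogonal
   projection only for [B] of full column rank. *)
Definition frame_proj n k (B : 'M[C]_(n, k)) :=
  B *m invmx (B^t* *m B) *m B^t*.

Lemma gram_unit n k (B : 'M[C]_(n, k)) :
  \rank B = k -> B^t* *m B \in unitmx.
Proof.
move=> rB; rewrite -row_free_unit -kermx_eq0.
set K := kermx _; have /eqP KG : K *m (B^t* *m B) == 0 by rewrite mulmx_ker.
have : K *m B^t* == 0.
  by rewrite -mul_adj_eq0 adjmxM trmxCK !mulmxA -(mulmxA K) KG mul0mx.
by rewrite mulmx_free_eq0// /row_free mxrank_adj rB.
Qed.

Section FrameProj.
Variables (n k : nat) (B : 'M[C]_(n, k)).
Hypothesis rB : \rank B = k.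

Lemma frame_projK : frame_proj B *m B = B.
Proof. by rewrite /frame_proj -!mulmxA mulVmx ?gram_unit// mulmx1. Qed.

Lemma frame_proj_orth : orth_proj (frame_proj B).
Proof.
split; last by rewrite {2 3}/frame_proj !mulmxA frame_projK.
by rewrite /frame_proj !adjmxM trmxCK adjmx_inv adjmxM trmxCK mulmxA.
Qed.

Lemma tr_frame_proj : \tr (frame_proj B) = k%:R.
Proof. by rewrite /frame_proj mxtrace_mulC mulmxA mulmxV ?gram_unit// mxtrace1. Qed.
End FrameProj.

(** The difference [p - q] is again a projection, and its trace is the difference of the ranks. *)
Lemma orth_proj_rankP n (p q : 'M[C]_n) :
  orth_proj p -> orth_proj q -> p *m q = q -> \rank p = \rank q -> p = q.
Proof.
move=> [pH pI] [qH qI] pq r.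
have qp : q *m p = q by rewrite -[q *m p]trmxCK adjmxM pH qH pq qH.
apply/eqP; rewrite -subr_eq0 -mul_adj_eq0 adjmxB pH qH.
rewrite mulmxBl !mulmxBr pI qI pq qp subrr subr0.
have o : (p - q) *m (p - q) = p - q.
  by rewrite mulmxBl !mulmxBr pI qI pq qp subrr subr0.
rewrite -mxrank_eq0 -(eqr_nat C) -(mxtrace_idem o) raddfB /=.
by rewrite (mxtrace_idem pI) (mxtrace_idem qI) r subrr.
Qed.

(** Since [p *m q - s] equals [(p - s) *m (q - s)], a product of two projections, its trace is a
    squared norm. *)
Lemma tr_mul_orth_proj_ge n (p q s : 'M[C]_n) :
  orth_proj p -> orth_proj q -> orth_proj s -> p *m s = s -> q *m s = s ->
  \tr s <= \tr (p *m q) ?= iff (p *m q == s).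
Proof.
move=> op oq os ps qs.
have adj r : orth_proj r -> r *m s = s -> s *m r = s.
  by move=> [rH _] rs; rewrite -[s *m r]trmxCK adjmxM rH os.1 rs os.1.
have sp := adj _ op ps; have sq := adj _ oq qs.
have sub r : orth_proj r -> r *m s = s -> orth_proj (r - s).
  move=> or_ rs; split; first by rewrite adjmxB or_.1 os.1.
  by rewrite mulmxBl !mulmxBr or_.2 os.2 rs (adj _ or_ rs) subrr subr0.
have e : (p - s) *m (q - s) = p *m q - s.
  by rewrite mulmxBl !mulmxBr ps sq os.2 subrr subr0.
have := tr_orth_proj_mul (sub _ op ps) (sub _ oq qs); rewrite e => tre.
split; first by rewrite -subr_ge0 -raddfB /= tre mxtrace_mul_adj_ge0.
by rewrite eq_sym -subr_eq0 -raddfB /= tre mxtrace_mul_adj_eq0 subr_eq0.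
Qed.

(* Pairing [\sum_i chi i *: (q i *m g - g *m p i) = 0] with [g] gives a
   vanishing sum of squared norms of [q i *m g *m (1%:M - p i)]. *)
Lemma moment_hom_commute (P : finType) (chi0 : nat) (chi : P -> nat) m n
    (p : P -> 'M[C]_n) (q : P -> 'M[C]_m) (g : 'M[C]_(m, n)) :
  (forall i, (0 < chi i)%N) ->
  (forall i, orth_proj (p i)) -> (forall i, orth_proj (q i)) ->
  \sum_i (chi i)%:R *: p i = chi0%:R%:M ->
  \sum_i (chi i)%:R *: q i = chi0%:R%:M ->
  (forall i, q i *m g *m p i = g *m p i) ->
  forall i, q i *m g = g *m p i.
Proof.
move=> chi_gt0 op oq sp sq h i.
have opC j := orth_projC (op j).
pose T j := \tr (g^t* *m q j *m g *m (1%:M - p j)).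
have T_ge0 j : true -> 0 <= (chi j)%:R * T j.
  by move=> _; rewrite mulr_ge0// /T tr_orth_proj_sandwich// mxtrace_mul_adj_ge0.
have T0 : \sum_j (chi j)%:R * T j = 0.
  have TE j : (chi j)%:R * T j =
      \tr (g^t* *m ((chi j)%:R *: q j) *m g)
      - \tr (g^t* *m g *m ((chi j)%:R *: p j)).
    have e : g^t* *m q j *m g *m p j = g^t* *m g *m p j.
      by rewrite -[RHS]mulmxA -(h j) !mulmxA.
    rewrite /T mulmxBr mulmx1 e raddfB /= mulrBr.
    by rewrite -!scalemxAr -!scalemxAl !mxtraceZ.
  rewrite (eq_bigr _ (fun j _ => TE j)) sumrB -!raddf_sum /=.
  rewrite -mulmx_suml -!mulmx_sumr sp sq -mulmxA mul_scalar_mx mul_mx_scalar.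
  by rewrite -scalemxAr subrr.
have := psumr_eq0P T_ge0 T0 => /(_ i isT) /eqP.
rewrite mulf_eq0 pnatr_eq0 eqn0Ngt chi_gt0 /= /T tr_orth_proj_sandwich//.
rewrite mxtrace_mul_adj_eq0 mulmxBr mulmx1 subr_eq0 => /eqP ->.
exact: h.
Qed.

End Adjoint.

(** * Singular values *)

Section SVD.
Context {C : numClosedFieldType}.

Lemma sorting_perm n (r : 'I_n -> C) : (forall k, 0 < r k) ->
  exists s : 'S_n, forall i j : 'I_n, (i <= j)%N -> r (s j) <= r (s i).
Proof.
move=> r_gt0; pose le i j := r j <= r i.
pose e := sort le (enum 'I_n).
have se : size e = n by rewrite size_sort size_enum_ord.
have ue : uniq e by rewrite sort_uniq enum_uniq.
have inj : injective (fun i : 'I_n => nth i e i).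
  move=> i j /= /eqP; rewrite (set_nth_default j) ?se// nth_uniq ?se//.
  by move/eqP/val_inj.
exists (perm inj) => i j ij; rewrite !permE.
have le_tr : transitive le by move=> x y z /= h1 h2; exact: le_trans h2 h1.
have sorted_e : sorted le e.
  by apply: sort_sorted => x y; apply: real_leVge; exact: gtr0_real.
rewrite (set_nth_default j) ?se//.
move: ij; rewrite leq_eqVlt => /orP[/eqP/val_inj ->//|ij].
by apply: (sorted_ltn_nth le_tr j sorted_e) => //; rewrite inE se.
Qed.

Definition realdiag n (r : 'I_n -> C) : 'M[C]_n := diag_mx (\row_k r k).

Lemma realdiagM n (r s : 'I_n -> C) :
  realdiag r *m realdiag s = realdiag (fun k => r k * s k).
Proof.
by rewrite /realdiag mulmx_diag; congr diag_mx; apply/rowP => k; rewrite !mxE.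
Qed.

Lemma realdiag_adj n (r : 'I_n -> C) : (forall k, 0 < r k) ->
  (realdiag r)^t* = realdiag r.
Proof.
move=> r_gt0; rewrite adjmx_diag; congr diag_mx; apply/rowP => k; rewrite !mxE.
exact/CrealP/gtr0_real.
Qed.

Lemma realdiag1 n : realdiag (fun _ : 'I_n => 1) = 1%:M.
Proof. by apply/matrixP => i j; rewrite !mxE. Qed.

Lemma realdiagV n (r : 'I_n -> C) : (forall k, 0 < r k) ->
  realdiag r *m realdiag (fun k => (r k)^-1) = 1%:M.
Proof.
move=> r0; rewrite realdiagM -realdiag1; congr (diag_mx _).
by apply/rowP => k; rewrite !mxE mulfV// gt_eqF.
Qed.

Lemma unitarymx_adj n (u : 'M[C]_n) : u \is unitarymx -> u^t* *m u = 1%:M.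
Proof. by move=> uU; apply: mulmx1C; exact/unitarymxP. Qed.

(** The spectral theorem diagonalizes [g^t* *m g]; the [r k] are the square roots of its
    eigenvalues, a permutation matrix absorbed into [v] sorts them, and [u] is then forced. *)
Lemma singular_value_decomposition n (g : 'M[C]_n) : g \in unitmx ->
  exists (u v : 'M[C]_n) (r : 'I_n -> C),
    [/\ u \is unitarymx, v \is unitarymx, forall k, 0 < r k,
        forall i j : 'I_n, (i <= j)%N -> r j <= r i & g = u *m realdiag r *m v].
Proof.
move=> gU; pose h := g^t* *m g.
have hN : h \is normalmx by apply/normalmxP; rewrite /h adjmxM trmxCK.
have /orthomx_spectralP := hN.
move: (spectralmx h) (spectral_unitarymx h) (spectral_diag h) => w wU d.
rewrite invmx_unitary// => hE.
have wwC : w *m w^t* = 1%:M by exact/unitarymxP.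
have dE : diag_mx d = (g *m w^t*)^t* *m (g *m w^t*).
  rewrite adjmxM trmxCK -!mulmxA (mulmxA (g^t*)) -/h hE.
  by rewrite !mulmxA wwC mul1mx -mulmxA wwC mulmx1.
have gwU : g *m w^t* \in unitmx.
  by rewrite unitmx_mul gU unitarymx_unit// trmxC_unitary.
(* The eigenvalue is the squared norm of a column of an invertible matrix. *)
have d_gt0 k : 0 < d 0 k.
  have -> : d 0 k = \sum_j `|(g *m w^t*) j k| ^+ 2.
    have /matrixP/(_ k k) := dE; rewrite !mxE eqxx mulr1n => ->.
    by apply: eq_bigr => j _; rewrite !mxE normCKC.
  rewrite lt_def sumr_ge0 ?andbT; last by move=> j _; exact: exprn_ge0.
  apply/negP => /eqP /psumr_eq0P z.
  have : g *m w^t* *m delta_mx k 0 = 0 :> 'cV_n.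
    apply/colP => j; rewrite -colE [RHS]mxE mxE; apply/eqP.
    have /eqP := z (fun j _ => exprn_ge0 2 (normr_ge0 _)) j isT.
    by rewrite expf_eq0 /= normr_eq0.
  move/(congr1 (mulmx (invmx (g *m w^t*)))); rewrite mulmxA mulVmx// mul1mx mulmx0.
  by move/colP/(_ k)/eqP; rewrite !mxE !eqxx oner_eq0.
pose r k := sqrtC (d 0 k).
have dr k : d 0 k = r k * r k by rewrite -expr2 sqrtCK.
have r_gt0 k : 0 < r k by rewrite sqrtC_gt0.
have [s sorted_r] := sorting_perm r_gt0.
pose v := perm_mx s *m w.
have sP : (perm_mx s)^t* *m perm_mx s = 1%:M :> 'M[C]_n.
  by rewrite tr_perm_mx map_perm_mx -perm_mxM mulVg perm_mx1.
have vU : v \is unitarymx.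
  apply/unitarymxP; rewrite adjmxM -mulmxA (mulmxA w) wwC mul1mx.
  exact: mulmx1C.
pose t := realdiag (fun k => r (s k)).
pose t' := realdiag (fun k => (r (s k))^-1).
have tt' : t *m t' = 1%:M by exact: realdiagV.
have t't : t' *m t = 1%:M by exact: mulmx1C.
have hv : v *m h *m v^t* = t *m t.
  rewrite hE /v adjmxM !mulmxA -(mulmxA _ w) wwC mulmx1.
  rewrite -(mulmxA _ w (w^t*)) wwC mulmx1.
  rewrite /t realdiagM tr_perm_mx map_perm_mx.
  rewrite -col_permE -row_permE.
  apply/matrixP => i j; rewrite !mxE (inj_eq perm_inj).
  by case: eqVneq => [->|//]; rewrite !mulr1n dr.
clearbody v.
exists (g *m v^t* *m t'), v, (fun k => r (s k)); split => //.
  apply/unitarymxP/mulmx1C; rewrite !adjmxM trmxCK (_ : t'^t* = t'); last first.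
    by apply: realdiag_adj => k; rewrite invr_gt0.
  transitivity (t' *m (v *m h *m v^t*) *m t'); first by rewrite /h !mulmxA.
  by rewrite hv !mulmxA t't mul1mx tt'.
by rewrite -/t -(mulmxA _ t') t't mulmx1 -mulmxA unitarymx_adj// mulmx1.
Qed.

(** The rows of [U] come from Gram-Schmidt on a row basis of [p]. They serve as orthonormal
    coordinates on the range of [p], in which systems are compressed. *)
Lemma orth_proj_factor n (p : 'M[C]_n) : orth_proj p ->
  exists U : 'M[C]_(\rank p, n), U *m U^t* = 1%:M /\ U^t* *m U = p.
Proof.
move=> [pH pI]; pose U := schmidt (row_base p).
have UU : U *m U^t* = 1%:M.
  by apply/unitarymxP/schmidt_unitarymx; exact: rank_leq_col.
exists U; split => //; apply: esym.
have /eqmxP/andP[UpS pUS] : (U :=: p)%MS.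
  by apply: eqmx_trans (eq_row_base p); apply: eqmx_schmidt_free; exact: row_base_free.
have [X XU] := submxP UpS; have [Y Yp] := submxP pUS.
have Up : U *m p = U by rewrite XU -mulmxA pI.
have pU : p *m U^t* = U^t* by rewrite -[LHS]trmxCK adjmxM trmxCK pH Up.
rewrite -{1}pU; transitivity (Y *m U *m U^t* *m U).
  by rewrite -(mulmxA Y) UU mulmx1.
by congr (_ *m U^t* *m U).
Qed.

(** If [g = u *m realdiag r *m v], then [u *m v] is the unitary part of the polar decomposition. In
    singular coordinates the two Hermitian matrices satisfy [a r = r b] and, by adjunction,
    [r a = b r]. So [a] commutes with the square of [r]: its entries vanish except between equal
    singular values, where [r] cancels and [a = b]. *)
Lemma unitary_equiv_of_commute (P : finType) n (p q : P -> 'M[C]_n) (g : 'M[C]_n) :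
  g \in unitmx -> (forall i, orth_proj (p i)) -> (forall i, orth_proj (q i)) ->
  (forall i, q i *m g = g *m p i) ->
  exists2 u : 'M[C]_n, u \is unitarymx & forall i, q i = u *m p i *m u^t*.
Proof.
move=> gU op oq qg.
have [u [v [r [uU vU r_gt0 _ gE]]]] := singular_value_decomposition gU.
have uuC : u *m u^t* = 1%:M by exact/unitarymxP.
have vvC : v *m v^t* = 1%:M by exact/unitarymxP.
have uCu := unitarymx_adj uU; have vCv := unitarymx_adj vU.
exists (u *m v) => [|i]; first by rewrite mul_unitarymx.
have [a aE] : exists a, a = u^t* *m q i *m u by eexists.
have [b bE] : exists b, b = v *m p i *m v^t* by eexists.
have ab : a *m realdiag r = realdiag r *m b.
  have := qg i; rewrite gE => /(congr1 (fun X => u^t* *m X *m v^t*)).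
  rewrite !mulmxA uCu mul1mx -[LHS]mulmxA vvC mulmx1.
  by rewrite aE bE !mulmxA.
have aH : a^t* = a by rewrite aE !adjmxM trmxCK (oq i).1 mulmxA.
have bH : b^t* = b by rewrite bE !adjmxM trmxCK (op i).1 mulmxA.
have ba : realdiag r *m a = b *m realdiag r.
  by have /(congr1 (fun X => X^t*)) := ab; rewrite !adjmxM (realdiag_adj r_gt0) aH bH.
suff ab_eq : a = b.
  rewrite adjmxM !mulmxA -(mulmxA _ v) -(mulmxA u) -(mulmxA u) -bE -ab_eq aE.
  by rewrite !mulmxA uuC mul1mx -mulmxA uuC mulmx1.
apply/matrixP => k l.
have /matrixP/(_ k l) := ab; have /matrixP/(_ k l) := ba.
rewrite /realdiag !mul_diag_mx !mul_mx_diag !mxE => e1 e2.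
have rr0 x : r x != 0 by rewrite gt_eqF.
have rr : r k ^+ 2 * a k l = r l ^+ 2 * a k l.
  by rewrite expr2 -mulrA e1 mulrA -e2 -mulrA mulrC expr2.
have [a0|a0] := eqVneq (a k l) 0.
  by move: e2; rewrite a0 mul0r => /esym/eqP; rewrite mulf_eq0 (negPf (rr0 _)) => /eqP.
move/(mulIf a0): rr => /eqP.
rewrite eqrXn2// ?ltW// => /eqP rkl.
by move: e2; rewrite rkl mulrC => /(mulfI (rr0 _)).
Qed.

End SVD.

(** * Column spaces and isomorphisms of representations *)

Section ColumnSpace.
Context {F : fieldType}.

Lemma mem_column_space m n (M : 'M[F]_(m, n)) (w : 'cV[F]_m) :
  reflect (exists v, w = M *m v) (w \in column_space M).
Proof.
apply: (iffP memv_imgP) => [[v _ ->]|[v ->]]; first by exists v; rewrite mx_actE.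
by exists v; rewrite ?memvf ?mx_actE.
Qed.

Lemma column_space_idemP n (p : 'M[F]_n) (w : 'cV[F]_n) : p *m p = p ->
  (w \in column_space p) = (p *m w == w).
Proof.
move=> pp; apply/mem_column_space/eqP => [[v ->]|<-]; last by exists w.
by rewrite mulmxA pp.
Qed.

Lemma column_space_subP m n k (M : 'M[F]_(m, n)) (N : 'M[F]_(m, k)) :
  reflect (exists X, M = N *m X) (column_space M <= column_space N)%VS.
Proof.
apply: (iffP subvP) => [MN|[X ->] w /mem_column_space[v ->]]; last first.
  by apply/mem_column_space; exists (X *m v); rewrite mulmxA.
have /all_sig[x xE] j : {v | col j M = N *m v}.
  apply/sig_eqW; apply/mem_column_space/MN/mem_column_space.
  by exists (delta_mx j 0); rewrite colE.
exists (\matrix_(i, j) x j i 0); apply/matrixP => i j.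
have /colP/(_ i) := xE j; rewrite !mxE => ->.
by apply: eq_bigr => l _; rewrite !mxE.
Qed.

Lemma column_space_sub_idem m n (M : 'M[F]_(n, m)) (q : 'M[F]_n) : q *m q = q ->
  (column_space M <= column_space q)%VS = (q *m M == M).
Proof.
move=> qq; apply/column_space_subP/eqP => [[X ->]|<-]; last by exists M.
by rewrite mulmxA qq.
Qed.

Lemma limg_mx_act m n k (g : 'M[F]_(m, n)) (M : 'M[F]_(n, k)) :
  (mx_act g @: column_space M)%VS = column_space (g *m M).
Proof.
rewrite /column_space -limg_comp; congr (limg _).
by apply/lfunP => v; rewrite comp_lfunE !mx_actE mulmxA.
Qed.

Lemma column_space_base m n (M : 'M[F]_(m, n)) :
  column_space (col_base M) = column_space M.
Proof.
apply/eqP; rewrite eqEsubv; apply/andP; split; apply/column_space_subP.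
  exists (pinvmx (row_base M)).
  transitivity (col_base M *m row_base M *m pinvmx (row_base M)).
    by rewrite -mulmxA mulmxVp ?mulmx1// row_base_free.
  by congr (_ *m pinvmx _); exact: mulmx_base.
by exists (row_base M); rewrite mulmx_base.
Qed.

Lemma lfun_mx m n (f : 'Hom('cV[F]_n, 'cV[F]_m)) : exists g, f = mx_act g.
Proof.
exists (\matrix_(i, j) f (delta_mx j 0) i 0); apply/lfunP => v.
have vE : v = \sum_j v j 0 *: delta_mx j 0.
  by rewrite {1}[v]matrix_sum_delta; apply: eq_bigr => j _; rewrite big_ord1.
rewrite mx_actE {1}vE linear_sum; apply/colP => i; rewrite mxE summxE.
by apply: eq_bigr => j _; rewrite linearZ !mxE mulrC.
Qed.

Lemma column_space_exists n (K : {vspace 'cV[F]_n}) :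
  exists M : 'M[F]_n, column_space M = K.
Proof.
have [M eM] := lfun_mx (projv K).
by exists M; rewrite /column_space -eM limg_proj.
Qed.

End ColumnSpace.

(** * Subspaces as ranges of orthogonal projections *)

Section OrthProjSpace.
Context {C : numClosedFieldType}.

Lemma column_space_frame_proj n k (B : 'M[C]_(n, k)) :
  \rank B = k -> column_space (frame_proj B) = column_space B.
Proof.
move=> rB; apply/eqP; rewrite eqEsubv; apply/andP; split.
  by apply/column_space_subP; eexists; rewrite /frame_proj -mulmxA.
by rewrite column_space_sub_idem ?frame_projK//; case: (frame_proj_orth rB).
Qed.

Lemma orth_proj_exists n (K : {vspace 'cV[C]_n}) :
  exists2 p : 'M[C]_n, orth_proj p & column_space p = K.
Proof.
have [M <-] := column_space_exists K.
have rB : \rank (col_base M) = \rank M by apply/eqP; exact: col_base_full.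
exists (frame_proj (col_base M)); first exact: frame_proj_orth.
by rewrite column_space_frame_proj//; exact: column_space_base.
Qed.

Lemma orth_proj_inj n (p q : 'M[C]_n) : orth_proj p -> orth_proj q ->
  column_space p = column_space q -> p = q.
Proof.
move=> op oq pq; apply: orth_proj_rankP => //; last by rewrite -!dim_column_space pq.
by apply/eqP; rewrite -column_space_sub_idem ?op.2// pq subvv.
Qed.

(** The left side is the trace of the projection [s] onto the intersection, which both [p] and [q]
    fix. Equality means [p *m q = s], which is self-adjoint; conversely a product of commuting
    projections is the projection onto the intersection. *)
Lemma dim_cap_column_space n (p q : 'M[C]_n) : orth_proj p -> orth_proj q ->
  (\dim (column_space p :&: column_space q))%:R <= \tr (p *m q)
    ?= iff (p *m q == q *m p).
Proof.
move=> op oq.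
have [s os sE] := orth_proj_exists (column_space p :&: column_space q).
have ps : p *m s = s.
  by apply/eqP; rewrite -column_space_sub_idem ?op.2// sE capvSl.
have qs : q *m s = s.
  by apply/eqP; rewrite -column_space_sub_idem ?oq.2// sE capvSr.
have -> : (\dim (column_space p :&: column_space q))%:R = \tr s.
  by rewrite -sE dim_column_space mxtrace_idem ?os.2.
have [le_tr eq_tr] := tr_mul_orth_proj_ge op oq os ps qs.
split => //; rewrite eq_tr; apply/eqP/eqP => [pqs|pq].
  by rewrite pqs -os.1 -pqs adjmxM op.1 oq.1.
have pqI : p *m q *m (p *m q) = p *m q.
  by rewrite {2}pq mulmxA -(mulmxA p) oq.2 -mulmxA -pq mulmxA op.2.
apply: orth_proj_inj => //; first by split; rewrite // adjmxM op.1 oq.1 pq.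
rewrite sE; apply/vspaceP => w; rewrite memv_cap !column_space_idemP ?op.2 ?oq.2//.
apply/eqP/andP => [<-|[/eqP pw /eqP qw]]; last by rewrite -mulmxA qw pw.
have qpq : q *m (p *m q) = p *m q by rewrite pq mulmxA oq.2.
by rewrite !(mulmxA _ (p *m q)) qpq mulmxA op.2 !eqxx.
Qed.

Lemma orth_proj_absorbC n (p q : 'M[C]_n) : orth_proj p -> orth_proj q ->
  q *m p = p -> p *m q = p.
Proof. by move=> op oq qp; rewrite -[LHS]trmxCK adjmxM op.1 oq.1 qp op.1. Qed.

Lemma column_space_unitary_conj n (u p : 'M[C]_n) : u \is unitarymx ->
  p *m p = p -> column_space (u *m p *m u^t*) = (mx_act u @: column_space p)%VS.
Proof.
move=> uU pp; rewrite limg_mx_act; apply/eqP; rewrite eqEsubv; apply/andP; split.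
  by apply/column_space_subP; eexists.
apply/column_space_subP; exists (u *m p).
by rewrite !mulmxA -(mulmxA _ (u^t*) u) unitarymx_adj// mulmx1 -(mulmxA u) pp.
Qed.

End OrthProjSpace.

(** * Isomorphisms and direct sums of representations *)

Section RepIso.
Context {F : fieldType} {disp : Order.disp_t} {P : finPOrderType disp}.
Implicit Types M N L : poset_rep F P.

Lemma rep_isoP M N (f : {linear rep_space M -> rep_space N}) : bijective f ->
  (forall i v, (f v \in rep_sub N i) = (v \in rep_sub M i)) -> rep_iso M N.
Proof.
move=> [g fK gK] fE; exists (linfun f); split.
  by exists g => v; rewrite lfunE.
move=> i; apply/vspaceP => w; apply/memv_imgP/idP => [[v vM ->]|wN].
  by rewrite lfunE fE.
by exists (g w); rewrite ?lfunE ?gK// -fE gK.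
Qed.

Lemma rep_iso_trans N M L : rep_iso M N -> rep_iso N L -> rep_iso M L.
Proof.
move=> [f [bf fE]] [g [bg gE]]; exists (g \o f)%VF; split => [|i].
  apply: (eq_bij (bij_comp bg bf)) => v; by rewrite comp_lfunE.
by rewrite limg_comp fE gE.
Qed.

Lemma rep_iso_mem M N (f : 'Hom(rep_space M, rep_space N)) : bijective f ->
  (forall i, (f @: rep_sub M i)%VS = rep_sub N i) ->
  forall i v, (f v \in rep_sub N i) = (v \in rep_sub M i).
Proof.
move=> bf fE i v; rewrite -fE; apply/memv_imgP/idP => [[w wM]|vM].
  by move/(bij_inj bf) => ->.
by exists v.
Qed.

Lemma mem_rep_dsum M N i (x : rep_space (rep_dsum M N)) :
  (x \in rep_sub (rep_dsum M N) i) =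
  (x.1 \in rep_sub M i) && (x.2 \in rep_sub N i).
Proof. by rewrite /= memv_cap -!memv_preim !lfunE. Qed.

Definition dsum_map M N N' (f : {linear rep_space N -> rep_space N'})
    (x : rep_space (rep_dsum M N)) : rep_space (rep_dsum M N') := (x.1, f x.2).

Lemma dsum_map_linear M N N' f : linear (@dsum_map M N N' f).
Proof. by move=> a x y; rewrite /dsum_map /= linearP. Qed.

HB.instance Definition _ M N N' f := GRing.isLinear.Build F
  (rep_space (rep_dsum M N)) (rep_space (rep_dsum M N')) _ (@dsum_map M N N' f)
  (@dsum_map_linear M N N' f).

Lemma rep_iso_dsumr M N N' :
  rep_iso N N' -> rep_iso (rep_dsum M N) (rep_dsum M N').
Proof.
move=> [f [bf fE]]; apply: (@rep_isoP _ _ (@dsum_map M N N' f)).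
  case: bf => g fK gK; exists (fun x => (x.1, g x.2)) => -[x y];
  by congr pair; rewrite /= (fK, gK).
by move=> i v; rewrite !mem_rep_dsum /= (rep_iso_mem bf fE).
Qed.

Lemma polystable_iso chi0 (chi : P -> nat) M N :
  rep_iso M N -> polystable chi0 chi N -> polystable chi0 chi M.
Proof.
move=> MN [n [S [SP NS]]]; exists n, S; split => //.
exact: rep_iso_trans NS.
Qed.

Lemma polystable_dsum chi0 (chi : P -> nat) M N : stable chi M ->
  (\sum_i chi i * \dim (rep_sub M i) = chi0 * rep_dim M)%N ->
  polystable chi0 chi N -> polystable chi0 chi (rep_dsum M N).
Proof.
move=> sM eM [n [S [SP NS]]].
(* [unlift ord0] puts [M] in front of the family, matching the way [big_ord_recl] peels off the
   first summand. *)
exists n.+1, (fun k => if unlift ord0 k is Some j then S j else M).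
split=> [k|]; first by case: unliftP => [j|] _.
rewrite big_ord_recl unlift_none; under eq_bigr do rewrite liftK.
exact: rep_iso_dsumr.
Qed.

End RepIso.

(** * Solutions of the moment equation are polystable *)

Section UnitaryPolystable.
Context {C : numClosedFieldType} {disp : Order.disp_t} {P : finPOrderType disp}.
Variables (chi0 : nat) (chi : P -> nat).
Hypothesis chi_gt0 : forall i, (0 < chi i)%N.

Definition moment_system n (p : P -> 'M[C]_n) :=
  (forall i, orth_proj (p i)) /\ \sum_i (chi i)%:R *: p i = chi0%:R%:M.

Definition column_increasing n (p : P -> 'M[C]_n) :=
  forall i j, (i < j)%O -> (column_space (p i) <= column_space (p j))%VS.

Definition proj_rep n (p : P -> 'M[C]_n) (sub : column_increasing p) :
  poset_rep C P := @PosetRep _ _ _ 'cV_n (fun i => column_space (p i)) sub.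

Lemma dim_cV n : \dim (fullv : {vspace 'cV[C]_n}) = n.
Proof. by rewrite dimvf /dim /= muln1. Qed.

Lemma moment_tr n (p : P -> 'M[C]_n) e : moment_system p ->
  \sum_i (chi i)%:R * \tr (p i *m e) = chi0%:R * \tr e.
Proof.
move=> [_ sp]; rewrite -mxtraceZ -mul_scalar_mx -sp mulmx_suml raddf_sum /=.
by apply: eq_bigr => i _; rewrite -scalemxAl mxtraceZ.
Qed.

Lemma moment_slope n (p : P -> 'M[C]_n) : moment_system p ->
  (\sum_i chi i * \dim (column_space (p i)) = chi0 * n)%N.
Proof.
move=> mp; apply/eqP; rewrite -(eqr_nat C) natrM -(mxtrace1 C n).
rewrite -(moment_tr 1%:M mp) natr_sum; apply/eqP/eq_bigr => i _.
by rewrite mulmx1 natrM dim_column_space mxtrace_idem ?(mp.1 i).2.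
Qed.

Definition reducing n (p : P -> 'M[C]_n) (e : 'M[C]_n) :=
  orth_proj e /\ forall i, p i *m e = e *m p i.

Lemma stable_irreducible n (p : P -> 'M[C]_n) (sub : column_increasing p) :
  moment_system p -> (0 < n)%N ->
  (forall e, reducing p e -> e = 0 \/ e = 1%:M) -> stable chi (proj_rep sub).
Proof.
move=> mp n_gt0 irr; split=> [|K K0 K1]; first by rewrite /rep_dim dim_cV.
have [e oe eK] := orth_proj_exists K.
have dK : (0 < \dim K)%N by rewrite lt0n dimv_eq0.
have slope := moment_slope mp.
have ltK : (\sum_i chi i * \dim (column_space (p i) :&: K) < chi0 * \dim K)%N.
  have le i : (chi i)%:R * (\dim (column_space (p i) :&: K))%:R <=
              (chi i)%:R * \tr (p i *m e).
    by apply: ler_wpM2l; rewrite // -eK (dim_cap_column_space (mp.1 i) oe).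
  have trK : \sum_i (chi i)%:R * \tr (p i *m e) = (chi0 * \dim K)%:R.
    by rewrite (moment_tr e mp) natrM -eK dim_column_space mxtrace_idem ?oe.2.
  have sE : (\sum_i chi i * \dim (column_space (p i) :&: K))%:R =
            \sum_i (chi i)%:R * (\dim (column_space (p i) :&: K))%:R :> C.
    by rewrite natr_sum; apply: eq_bigr => i _; rewrite natrM.
  rewrite -(ltr_nat C) -trK sE lt_def ler_sum// andbT.
  apply/negP => /eqP eqs.
  (* Equality of the weighted sums forces equality term by term because every weight is positive;
     the equality case of [dim_cap_column_space] then makes [e] reducing, so [K] is zero or
     everything. *)
  have red i : p i *m e = e *m p i.
    apply/eqP; rewrite -(dim_cap_column_space (mp.1 i) oe) eK.
    have /psumr_eq0P/(_ i isT)/eqP : \sum_i ((chi i)%:R * \tr (p i *m e) -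
      (chi i)%:R * (\dim (column_space (p i) :&: K))%:R) = 0.
      by rewrite sumrB eqs subrr.
    rewrite -mulrBr mulf_eq0 pnatr_eq0 eqn0Ngt chi_gt0 /= subr_eq0 eq_sym.
    by apply=> j _; rewrite subr_ge0.
  have [e0|e1] := irr e (conj oe red).
    by move: K0; rewrite -eK -dimv_eq0 dim_column_space e0 mxrank0.
  move: K1; rewrite -eK e1 => /negP; apply; rewrite eqEsubv subvf /=.
  by apply/subvP => w _; apply/mem_column_space; exists w; rewrite mul1mx.
(* The slope of the whole representation is [chi0], so after clearing denominators the stability
   inequality is [ltK]. *)
have -> : \sum_i (chi i)%:R * (\dim (rep_sub (proj_rep sub) i))%:R =
          n%:R * chi0%:R :> rat.
  rewrite mulrC -natrM -slope natr_sum; apply: eq_bigr => i _.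
  by rewrite natrM.
rewrite /rep_dim dim_cV mulKf ?pnatr_eq0 -?lt0n// ltr_pdivrMl ?ltr0n// mulrC.
rewrite -natrM (_ : \sum_i _ = \sum_i (chi i * \dim (column_space (p i) :&: K))%:R).
  by rewrite -natr_sum ltr_nat.
by apply: eq_bigr => i _; rewrite natrM.
Qed.

Section Compression.
Variables (n k : nat) (p : P -> 'M[C]_n) (U : 'M[C]_(k, n)).
Hypotheses (UU : U *m U^t* = 1%:M) (redU : reducing p (U^t* *m U)).

(** The restriction of [p i] to the range of [U^t* *m U], in the orthonormal coordinates given by
    [U]. It is a projection because that range reduces the system. *)
Definition compress i := U *m p i *m U^t*.

Lemma compress_mulr i : U *m p i = compress i *m U.
Proof.
by rewrite /compress -!mulmxA redU.2 !mulmxA UU mul1mx.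
Qed.

Lemma compress_mull i : p i *m U^t* = U^t* *m compress i.
Proof.
by rewrite /compress !mulmxA -redU.2 -!mulmxA UU mulmx1.
Qed.

Lemma compress_moment : moment_system p -> moment_system compress.
Proof.
move=> [op sp]; split=> [i|].
  split; first by rewrite !adjmxM trmxCK (op i).1 mulmxA.
  by rewrite {2}/compress !mulmxA -compress_mulr -(mulmxA U) (op i).2.
transitivity (U *m (\sum_i (chi i)%:R *: p i) *m U^t*).
  rewrite mulmx_sumr mulmx_suml; apply: eq_bigr => i _.
  by rewrite -scalemxAr -scalemxAl.
by rewrite sp mul_mx_scalar -scalemxAl UU scalemx1.
Qed.

Lemma compress_idem i : orth_proj (p i) -> compress i *m compress i = compress i.
Proof.
by move=> op; rewrite {2}/compress !mulmxA -compress_mulr -(mulmxA U) op.2.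
Qed.

Lemma compress_increasing : (forall i, orth_proj (p i)) ->
  column_increasing p -> column_increasing compress.
Proof.
move=> op sub i j /sub; rewrite !column_space_sub_idem ?compress_idem ?(op j).2//.
move=> /eqP pij; rewrite {2}/compress !mulmxA -compress_mulr -(mulmxA U).
by rewrite pij.
Qed.

Lemma compress_mem i (v : 'cV[C]_n) : orth_proj (p i) -> p i *m v = v ->
  U *m v \in column_space (compress i).
Proof.
move=> op pv; rewrite column_space_idemP ?compress_idem//.
by rewrite mulmxA -compress_mulr -mulmxA pv.
Qed.

End Compression.

Definition split_map n k l (U : 'M[C]_(k, n)) (V : 'M[C]_(l, n)) (v : 'cV[C]_n)
  : 'cV[C]_k * 'cV[C]_l := (U *m v, V *m v).

Lemma split_map_linear n k l (U : 'M[C]_(k, n)) (V : 'M[C]_(l, n)) :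
  linear (split_map U V).
Proof. by move=> a x y; rewrite /split_map !linearP. Qed.

HB.instance Definition _ n k l (U : 'M[C]_(k, n)) (V : 'M[C]_(l, n)) :=
  GRing.isLinear.Build C _ _ _ (split_map U V) (split_map_linear U V).

(** [U] and [V] are coordinates on two complementary orthogonal subspaces. As each [p i] commutes
    with both projections, a vector is fixed by [p i] exactly when its two components are fixed by
    the compressions. *)
Lemma rep_iso_split n k l (p : P -> 'M[C]_n) (sub : column_increasing p)
    (U : 'M[C]_(k, n)) (V : 'M[C]_(l, n))
    (subU : column_increasing (compress p U))
    (subV : column_increasing (compress p V)) :
  (forall i, orth_proj (p i)) ->
  U *m U^t* = 1%:M -> V *m V^t* = 1%:M -> reducing p (U^t* *m U) ->
  V^t* *m V = 1%:M - U^t* *m U ->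
  rep_iso (proj_rep sub) (rep_dsum (proj_rep subU) (proj_rep subV)).
Proof.
move=> op UU VV redU eV.
have redV : reducing p (V^t* *m V).
  split=> [|i]; first by rewrite eV; exact/orth_projC/redU.1.
  by rewrite eV mulmxBr mulmxBl mulmx1 mul1mx redU.2.
have UV : U *m V^t* = 0.
  transitivity (U *m (V^t* *m V) *m V^t*); first by rewrite !mulmxA -mulmxA VV mulmx1.
  by rewrite eV mulmxBr mulmx1 mulmxA UU mul1mx subrr mul0mx.
have VU : V *m U^t* = 0 by rewrite -[LHS]trmxCK adjmxM trmxCK UV trmx0 map_mx0.
have joinK v : U^t* *m (U *m v) + V^t* *m (V *m v) = v :> 'cV_n.
  by rewrite !mulmxA -mulmxDl eV addrCA subrr addr0 mul1mx.
apply: (@rep_isoP _ _ _ (proj_rep sub) (rep_dsum (proj_rep subU) (proj_rep subV))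
  (split_map U V)).
  exists (fun x => U^t* *m x.1 + V^t* *m x.2) => [v|[x y]]; first exact: joinK.
  by congr pair; rewrite /= mulmxDr !mulmxA (UU, VU) (UV, VV)
    !mul1mx !mul0mx (addr0, add0r).
move=> i v; rewrite mem_rep_dsum [RHS]column_space_idemP ?(op i).2//=.
apply/andP/eqP => [[]|pv]; last by split; apply: compress_mem.
rewrite !column_space_idemP ?compress_idem// => /eqP hU /eqP hV.
rewrite -{1}(joinK v) mulmxDr !(mulmxA (p i)) !compress_mull//.
by rewrite -!(mulmxA _ (compress _ _ _)) hU hV joinK.
Qed.

Lemma moment_polystable n (p : P -> 'M[C]_n) (sub : column_increasing p) :
  moment_system p -> polystable chi0 chi (proj_rep sub).
Proof.
elim/ltn_ind: n p sub => -[_ p sub mp|n IH p sub mp].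
  exists 0, (fun=> rep0); split=> [[]//|]; rewrite big_ord0.
  apply: (@rep_isoP _ _ _ (proj_rep sub) rep0 idfun); first by exists id.
  by move=> i v; have -> : v = 0 by [exact: (flatmx0 (v : 'cV_0))]; rewrite !mem0v.
(* The identity is reducing, so a nonzero reducing projection of least rank exists. *)
pose Q r := `[< exists2 e, reducing p e & e != 0 /\ \rank e = r >].
have exQ : exists r, Q r.
  exists n.+1; apply/asboolP; exists 1%:M.
    split=> [|i]; last by rewrite mulmx1 mul1mx.
    by split; rewrite ?adjmx1 ?mulmx1.
  by rewrite mxrank1 -mxrank_eq0 mxrank1.
case: (ex_minnP exQ) => r /asboolP[e rede [e0 rke]] rmin.
have [U [UU UE]] := orth_proj_factor rede.1.
have oC := orth_projC rede.1.
have [V [VV VE]] := orth_proj_factor oC.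
have op := mp.1.
have redU : reducing p (U^t* *m U) by rewrite UE.
have redV : reducing p (V^t* *m V).
  by rewrite VE; split=> // i; rewrite mulmxBr mulmxBl mulmx1 mul1mx rede.2.
have subU := compress_increasing UU redU op sub.
have subV := compress_increasing VV redV op sub.
have split_iso : rep_iso (proj_rep sub) (rep_dsum (proj_rep subU) (proj_rep subV)).
  by apply: rep_iso_split => //; rewrite UE VE.
apply: polystable_iso split_iso _; apply: polystable_dsum.
- apply: stable_irreducible; first exact: compress_moment.
    by rewrite lt0n mxrank_eq0.
  move=> f [of_ redf]; have [->|f0] := eqVneq f 0; [by left|right].
  (* A nonzero reducing projection [f] of the compression pulls back to one of the original system.
     Minimality bounds its rank below by that of [e], which is the full size of the compression, so
     [f] is the identity. *)
  have oUf : orth_proj (U^t* *m f *m U).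
    split; first by rewrite !adjmxM trmxCK of_.1 mulmxA.
    by rewrite !mulmxA -(mulmxA _ U (U^t*)) UU mulmx1 -(mulmxA _ f f) of_.2.
  have fE : U *m (U^t* *m f *m U) *m U^t* = f.
    by rewrite !mulmxA UU mul1mx -mulmxA UU mulmx1.
  have redUf : reducing p (U^t* *m f *m U).
    split=> // i; rewrite !mulmxA compress_mull//.
    rewrite -(mulmxA _ U (p i)) (compress_mulr UU redU).
    by rewrite -(mulmxA _ (compress p U i) f) redf !mulmxA.
  have rkf : (\rank e <= \rank (U^t* *m f *m U))%N.
    apply: (@leq_trans r); first by rewrite rke.
    apply: rmin; apply/asboolP; exists (U^t* *m f *m U) => //.
    split => //; apply: contra_neq f0 => f0.
    by rewrite -fE f0 mulmx0 mul0mx.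
  have rkf' : \rank f = \rank e.
    apply/eqP; rewrite eqn_leq rank_leq_row /=; apply: leq_trans rkf _.
    exact: leq_trans (mxrankM_maxl _ _) (mxrankM_maxr _ _).
  apply/esym/orth_proj_rankP => //; rewrite ?mul1mx ?mxrank1//.
  by split; rewrite ?adjmx1 ?mulmx1.
- by rewrite /rep_dim dim_cV; apply: moment_slope; exact: compress_moment.
- apply: IH; last exact: compress_moment.
  have : \tr (1%:M - e) = (n.+1)%:R - (\rank e)%:R.
    by rewrite raddfB /= mxtrace1 (mxtrace_idem rede.1.2).
  rewrite (mxtrace_idem oC.2) => /eqP; rewrite eq_sym subr_eq -natrD eqr_nat.
  have : (0 < \rank e)%N by rewrite lt0n mxrank_eq0.
  move=> e_gt0 /eqP rk; apply: (@leq_trans (\rank (1%:M - e) + \rank e)).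
    by rewrite -[ltnLHS]addn0 ltn_add2l.
  by rewrite -rk.
Qed.

End UnitaryPolystable.

(** * Greedy rows and Abel summation *)

Section GreedyRows.
Context {F : fieldType}.
Variables (n d : nat) (B : 'M[F]_(n, d)).

(** The remaining rows are zeroed instead of removed, so that all these matrices share one type. *)
Definition top_rows k : 'M[F]_(n, d) := pid_mx k *m B.

Lemma row_top_rows k i : row i (top_rows k) = if (i < k)%N then row i B else 0.
Proof.
apply/rowP => j; rewrite !mxE (bigD1 i)//= big1 => [|l li]; last first.
  by rewrite !mxE eq_sym (inj_eq val_inj) (negPf li) mul0r.
rewrite !mxE eqxx addr0 /=; case: (ltnP i k) => ik; rewrite ?mxE.
  by rewrite mul1r.
by rewrite mul0r.
Qed.

Lemma top_rowsS k : (top_rows k <= top_rows k.+1)%MS.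
Proof.
apply/row_subP => i; rewrite row_top_rows; case: ifP => [ik|_]; last exact: sub0mx.
have -> : row i B = row i (top_rows k.+1) by rewrite row_top_rows ltnS ltnW.
exact: row_sub.
Qed.

Lemma top_rowsS_sub (k : 'I_n) : (top_rows k.+1 <= top_rows k + row k B)%MS.
Proof.
apply/row_subP => i; rewrite row_top_rows ltnS leq_eqVlt.
case: eqVneq => [/val_inj ->|_] /=; first exact: addsmxSr.
case: ifP => [ik|_]; last exact: sub0mx.
apply: submx_trans (addsmxSl _ _).
have -> : row i B = row i (top_rows k) by rewrite row_top_rows ik.
exact: row_sub.
Qed.

(** The indices where the row rank jumps: the basis of rows selected greedily from the top, which is
    lexicographically first. *)
Definition greedy_rows : {set 'I_n} :=
  [set k : 'I_n | (\rank (top_rows k) < \rank (top_rows k.+1))%N].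

(** One more row raises the rank by 0 or 1, so counting the jumps recovers the rank. *)
Lemma card_greedy_rows k : (k <= n)%N ->
  #|[set i in greedy_rows | (i < k)%N]| = \rank (top_rows k).
Proof.
elim: k => [_|k IH kn].
  rewrite (_ : top_rows 0 = 0) ?mxrank0; last first.
    by apply/row_matrixP => i; rewrite row_top_rows row0.
  by apply/eqP; rewrite cards_eq0; apply/eqP/setP => i; rewrite !inE andbF.
pose k' := Ordinal kn.
have le1 : (\rank (top_rows k) <= \rank (top_rows k.+1))%N by exact/mxrankS/top_rowsS.
have le2 : (\rank (top_rows k.+1) <= (\rank (top_rows k)).+1)%N.
  apply: leq_trans (mxrankS (top_rowsS_sub k')) _.
  apply: leq_trans (mxrank_adds_leqif _ _) _; rewrite /= -[leqRHS]addn1 leq_add2l.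
  exact: rank_leq_row.
rewrite (cardsD1 k') !inE /= ltnSn andbT.
have -> : [set i in greedy_rows | (i < k.+1)%N] :\ k' =
          [set i in greedy_rows | (i < k)%N].
  apply/setP => i; rewrite !inE ltnS (ltn_neqAle i k) -(inj_eq val_inj) /=.
  by rewrite andbCA.
rewrite (IH (ltnW kn)); case: ltnP => h /=.
  by rewrite add1n; apply/eqP; rewrite eqn_leq h.
by rewrite add0n; apply/eqP; rewrite eqn_leq h le1.
Qed.

Lemma top_rows_greedy k : (k <= n)%N ->
  (top_rows k <= \matrix_(i, j) if (i \in greedy_rows) then B i j else 0)%MS.
Proof.
set G := (X in (_ <= X)%MS).
have rowG (i : 'I_n) : i \in greedy_rows -> (row i B <= G)%MS.
  move=> ig; have -> : row i B = row i G.
    by apply/rowP => j; rewrite !mxE ig.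
  exact: row_sub.
elim: k => [_|k IH kn].
  apply/row_subP => i; rewrite row_top_rows; exact: sub0mx.
have [kg|kg] := boolP (Ordinal kn \in greedy_rows).
  apply: submx_trans (top_rowsS_sub (Ordinal kn)) _.
  by rewrite addsmx_sub rowG// andbT IH// ltnW.
apply: submx_trans (IH (ltnW kn)).
rewrite -(mxrank_leqif_sup (top_rowsS k)).
move: kg; rewrite inE /= -leqNgt => le; rewrite eqn_leq le.
by rewrite mxrankS// top_rowsS.
Qed.

(** Supplies an invertible maximal minor whose rows are concentrated at the top as much as the ranks
    allow; the counts of its rows feed the Abel summation. The enumeration [s] of [S] is recorded
    through products, the only form in which it is used. *)
Lemma greedy_rowsP : \rank B = d ->
  exists (S : {set 'I_n}) (s : 'I_d -> 'I_n),
  [/\ rowsub s B \in unitmx,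
      forall (h : 'I_n -> F), \prod_j h (s j) = \prod_(k in S) h k &
      forall k, (k <= n)%N -> #|[set i in S | (i < k)%N]| = \rank (top_rows k)].
Proof.
move=> rB.
have topn : top_rows n = B.
  by apply/row_matrixP => i; rewrite row_top_rows ltn_ord.
have cS : #|greedy_rows| = d.
  rewrite -rB -topn -card_greedy_rows//; apply: eq_card => i.
  by rewrite inE ltn_ord andbT.
pose s (j : 'I_d) : 'I_n := enum_val (cast_ord (esym cS) j).
exists greedy_rows, s; split; last by move=> k; exact: card_greedy_rows.
  rewrite -row_free_unit /row_free eqn_leq rank_leq_row /= -{1}rB mxrankS//.
  rewrite -{1}topn; apply: submx_trans (top_rows_greedy (leqnn n)) _.
  apply/row_subP => i; have [ig|ig] := boolP (i \in greedy_rows); last first.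
    rewrite (_ : row i _ = 0) ?sub0mx//; apply/rowP => j.
    by rewrite !mxE (negPf ig).
  rewrite (_ : row i _ = row (cast_ord cS (enum_rank_in ig i)) (rowsub s B)).
    exact: row_sub.
  by apply/rowP => j; rewrite !mxE ig /s cast_ordK enum_rankK_in.
move=> h; rewrite [RHS]big_enum_val /= /s.
rewrite (reindex (cast_ord (esym cS)))//.
by exists (cast_ord cS) => x _; rewrite ?cast_ordK ?cast_ordKV.
Qed.

End GreedyRows.

(* Abel summation, in multiplicative form. *)
Lemma prod_decreasing_ge (K : numFieldType) (l : nat -> K) (e : nat -> nat) c N :
  (forall k, 0 < l k) -> (forall k, (k < N)%N -> l k.+1 <= l k) ->
  (forall k, (0 < k <= N)%N -> (c * k < \sum_(j < k) e j)%N) ->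
  (\sum_(j < N.+1) e j)%N = (c * N.+1)%N ->
  l 0 * \prod_(k < N.+1) l k ^+ c <= l N * \prod_(k < N.+1) l k ^+ e k.
Proof.
move=> l0 ldec He eN.
(* As [He] is strict, the surplus of the partial sum over [c * k.+1] is at least one. One unit pays
   for the factor [l 0]; the rest is kept as a power of [l k] and can only shrink when handed on to
   [l k.+1]. *)
have key k : (k < N)%N ->
  l 0 * \prod_(j < k.+1) l j ^+ c * l k ^+ (\sum_(j < k.+1) e j - (c * k.+1).+1)
  <= \prod_(j < k.+1) l j ^+ e j.
  elim: k => [N0|k IH kN].
    rewrite !big_ord1 -exprS -exprD muln1 subnKC ?lexx//.
    by have := He 1; rewrite big_ord1 muln1; apply.
  have Ek := He k.+1 (ltnW kN); have Ek1 := He k.+2 kN.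
  rewrite big_ord_recr [X in _ <= X]big_ord_recr /=.
  apply: le_trans (ler_wpM2r _ (IH (ltnW kN))); last exact/exprn_ge0/ltW.
  have -> : l 0 * (\prod_(i < k.+1) l i ^+ c * l k.+1 ^+ c) *
      l k.+1 ^+ (\sum_(j < k.+2) e j - (c * k.+2).+1) =
    l 0 * \prod_(i < k.+1) l i ^+ c *
      l k.+1 ^+ (\sum_(j < k.+1) e j - (c * k.+1).+1) * l k.+1 ^+ e k.+1.
    rewrite -!mulrA -!exprD; congr (_ * (_ * _ ^+ _)).
    rewrite big_ord_recr /= in Ek1 *.
    move: Ek Ek1; set E := (\sum_(_ < _) _)%N.
    by clear; rewrite !mulnS; lia.
  apply: ler_wpM2r; first exact/exprn_ge0/ltW.
  apply: ler_wpM2l.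
    by rewrite mulr_ge0 ?ltW// prodr_gt0// => j _; exact: exprn_gt0.
  apply: lerXn2r; rewrite ?nnegrE; [exact: ltW|exact: ltW|].
  exact/ldec/ltnW.
case: N ldec He eN key => [|N] ldec He eN key.
  move: eN; rewrite !big_ord1 muln1 => ->; exact: lexx.
(* By [eN] the surplus is exhausted at the last index, so the unit spent on [l 0] is repaid there;
   hence the factor [l N] on the right. *)
have EN := He N.+1 (ltnSn _).
rewrite big_ord_recr [X in _ <= _ * X]big_ord_recr /=.
have -> : l 0 * (\prod_(i < N.+1) l i ^+ c * l N.+1 ^+ c) =
    l 0 * \prod_(i < N.+1) l i ^+ c *
    l N.+1 ^+ (\sum_(j < N.+1) e j - (c * N.+1).+1) * l N.+1 ^+ (e N.+1).+1.
  rewrite -!mulrA -!exprD; congr (_ * (_ * _ ^+ _)).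
  rewrite big_ord_recr /= in eN.
  move: EN eN; set E := (\sum_(_ < _) _)%N.
  by clear; rewrite !mulnS; lia.
rewrite mulrCA -exprS; apply: ler_wpM2r; first exact/exprn_ge0/ltW.
apply: le_trans (key N (ltnSn _)); apply: ler_wpM2l.
  by rewrite mulr_ge0 ?ltW// prodr_gt0// => j _; exact: exprn_gt0.
by apply: lerXn2r; rewrite ?nnegrE; [exact: ltW|exact: ltW|exact: ldec].
Qed.

(** * Gram determinants and their first variation *)

(** Sylvester's determinant identity, from two block triangular factorizations of one matrix. It
    reduces the determinant of a rank one perturbation to a scalar. *)
Lemma det_addmx1C (K : comUnitRingType) m n (A : 'M[K]_(m, n)) (B : 'M[K]_(n, m)) :
  \det (1%:M + A *m B) = \det (1%:M + B *m A).
Proof.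
have h1 : block_mx 1%:M (- B) A 1%:M =
    block_mx 1%:M 0 A 1%:M *m block_mx 1%:M (- B) 0 (1%:M + A *m B).
  rewrite mulmx_block !mul1mx !mul0mx !mulmx1 !addr0.
  by rewrite mulmxN addrCA addNr addr0.
have h2 : block_mx 1%:M (- B) A 1%:M =
    block_mx (1%:M + B *m A) (- B) 0 1%:M *m block_mx 1%:M 0 A 1%:M.
  by rewrite mulmx_block !mul1mx !mul0mx !mulmx1 !mulmx0 !add0r mulNmx addrK.
have := congr1 determinant h1; rewrite {1}h2 !det_mulmx !det_lblock !det_ublock.
by rewrite !det1 !mulr1 !mul1r => ->.
Qed.

Section Gram.
Context {C : numClosedFieldType}.

(** The Leibniz expansion has [n!] terms of norm at most 1; the factorials in the energy estimate
    originate here. *)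
Lemma det_norm_le n (A : 'M[C]_n) :
  (forall i j, `|A i j| <= 1) -> `|\det A| <= (n`!)%:R.
Proof.
move=> A1; apply: le_trans (ler_norm_sum _ _ _) _.
rewrite -card_Sn -sum1_card natr_sum.
apply: ler_sum => s _; rewrite normrM normr_sign mul1r normr_prod.
by apply: prodr_ile1 => i _; rewrite normr_ge0 A1.
Qed.

(* The minor of the orthogonal projection onto the column space of [B] with rows
   and columns [s] is [|det (rowsub s B)| ^ 2 / det (B^t* *m B)]. *)
Lemma gram_minor_le n d (B : 'M[C]_(n, d)) (s : 'I_d -> 'I_n) : \rank B = d ->
  `|\det (rowsub s B)| ^+ 2 <= (d`!)%:R * `|\det (B^t* *m B)|.
Proof.
move=> rB; have oP := frame_proj_orth rB.
pose H := rowsub s B *m invmx (B^t* *m B) *m (rowsub s B)^t*.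
have HE i j : H i j = frame_proj B (s i) (s j).
  have rs (k : nat) (X : 'M[C]_(d, k)) : rowsub s B *m X = rowsub s (B *m X).
    by apply/matrixP => a b; rewrite !mxE; apply: eq_bigr => l _; rewrite !mxE.
  rewrite /H rs /frame_proj !mxE; apply: eq_bigr => k _; rewrite !mxE.
  by congr (_ * _).
have H1 : `|\det H| <= (d`!)%:R.
  by apply: det_norm_le => i j; rewrite HE; exact: orth_proj_entry_le1.
have dG : \det (B^t* *m B) != 0 by rewrite -unitfE -unitmxE gram_unit.
have dH : `|\det (rowsub s B)| ^+ 2 = `|\det H| * `|\det (B^t* *m B)|.
  rewrite -normrM /H !det_mulmx det_inv det_adj mulrAC -(mulrA (\det _)).
  by rewrite mulVf// mulr1 -normCK normrX normr_id.
by rewrite dH; exact: ler_wpM2r.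
Qed.

End Gram.

(** * First-order comparison of polynomials at 0 *)

Section UnitDerivative.
Context {K : numFieldType}.

(** For polynomials with value 1 at 0 the derivative is the logarithmic derivative, so products add
    up and no logarithm of the energy is required. *)
Definition unit_jet (p : {poly K}) (c : K) := p.[0] = 1 /\ p^`().[0] = c.

Lemma unit_jetM p q a b : unit_jet p a -> unit_jet q b -> unit_jet (p * q) (a + b).
Proof.
move=> [p0 p1] [q0 q1]; split; first by rewrite hornerM p0 q0 mulr1.
by rewrite derivM !hornerE p0 q0 p1 q1 mulr1 mul1r.
Qed.

Lemma unit_jet1 : unit_jet 1 0.
Proof. by split; rewrite ?derivC !hornerE. Qed.

Lemma unit_jetX p a n : unit_jet p a -> unit_jet (p ^+ n) (a *+ n).
Proof.
move=> pa; elim: n => [|n IH]; first exact: unit_jet1.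
by rewrite exprS mulrS; exact: unit_jetM.
Qed.

Lemma unit_jet_prod (I : Type) (r : seq I) (p : I -> {poly K}) a :
  (forall i, unit_jet (p i) (a i)) ->
  unit_jet (\prod_(i <- r) p i) (\sum_(i <- r) a i).
Proof.
by move=> pa; apply: big_ind2 => *; [exact: unit_jet1|exact: unit_jetM|exact: pa].
Qed.

(** A nonzero linear term [s * (a - b)] of [p - q] would win over the quadratic remainder for small
    real [s] of the sign opposite to [a - b], making the difference negative. *)
Lemma unit_jet_le p q a b : unit_jet p a -> unit_jet q b -> a - b \is Num.real ->
  (forall s, s \is Num.real -> `|s| <= 1 -> q.[s] <= p.[s]) -> a = b.
Proof.
move=> [p0 p1] [q0 q1] abR pq; apply/eqP; rewrite -subr_eq0; apply: contraT => ab0.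
have [M tM] := poly_disk_bound (drop_poly 2 (p - q)) 1.
have rE s : (p - q).[s] = s * (a - b) + s ^+ 2 * (drop_poly 2 (p - q)).[s].
  rewrite -{1}(poly_take_drop 2 (p - q)) hornerD hornerM hornerXn mulrC.
  rewrite [s ^+ 2 * _]mulrC mulrC; congr (_ + _).
  rewrite /take_poly horner_poly !big_ord_recl big_ord0 /= addr0 expr0 mulr1.
  rewrite expr1 -[(p - q)`_0]horner_coef0 hornerD hornerN p0 q0 subrr add0r.
  have -> : (p - q)`_1 = (p - q)^`()`_0 by rewrite coef_deriv mulr1n.
  by rewrite -horner_coef0 derivB hornerD hornerN p1 q1 mulrC.
(* With [M] bounding the remainder on the unit disk, this [N] gives [|s| <= 1] for [s = - (c / N)],
   and [|M| < N] makes the quadratic term smaller than the linear one. *)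
pose c := a - b; pose N := `|c| + `|M| + 1.
have N0 : 0 < N by rewrite ltr_wpDl// addr_ge0.
pose s := - (c / N).
have sR : s \is Num.real by rewrite rpredN rpredM// realV gtr0_real.
have s1 : `|s| <= 1.
  rewrite normrN normrM normfV (gtr0_norm N0) ler_pdivrMr// mul1r.
  by rewrite /N -addrA lerDl addr_ge0.
have cR : c \is Num.real by [].
have := pq s sR s1; rewrite -subr_ge0 -hornerN -hornerD rE -/c.
have -> : s * c = - (`|c| ^+ 2 / N).
  by rewrite /s mulNr mulrAC -expr2 real_normK.
set X := s ^+ 2 * _ => X_ge.
have XR : X \is Num.real.
  rewrite -[X](addKr (- (`|c| ^+ 2 / N))) opprK rpredD ?ger0_real//.
  by rewrite divr_ge0// ?exprn_ge0// ltW.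
have XM : X <= `|c| ^+ 2 / N ^+ 2 * `|M|.
  apply: le_trans (real_ler_norm XR) _; rewrite /X normrM normrX normrN normrM.
  rewrite normfV (gtr0_norm N0) expr_div_n; apply: ler_wpM2l.
    by rewrite divr_ge0// exprn_ge0// ltW.
  apply: le_trans (tM s s1) (real_ler_norm _).
  by apply: ger0_real; apply: le_trans (tM s s1).
have := le_trans X_ge (lerD (lexx _) XM); rewrite addrC subr_ge0.
have -> : `|c| ^+ 2 / N ^+ 2 * `|M| = `|c| ^+ 2 / N * (`|M| / N).
  by rewrite (expr2 N) invfM !mulrA mulrAC.
rewrite -[leLHS]mulr1 ler_pM2l; last by rewrite divr_gt0// exprn_gt0// normr_gt0.
rewrite ler_pdivlMr// mul1r => NM.
have : `|M| < N by rewrite /N -addrA addrCA ltrDl ltr_wpDl.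
by move/(le_lt_trans NM); rewrite ltxx.
Qed.
End UnitDerivative.

Section Minimizer.
Context {C : numClosedFieldType}.

(** Testing on the columns of [1%:M + H] and of [1%:M - H] and subtracting the traces leaves four
    times the trace of [H *m H], a squared norm. *)
Lemma quad_form_eq0 n (H : 'M[C]_n) : H^t* = H ->
  (forall w : 'cV[C]_n, w^t* *m H *m w = 0) -> H = 0.
Proof.
move=> HH H0.
have tr0 (X : 'M[C]_n) : \tr (X^t* *m H *m X) = 0.
  apply: big1 => j _.
  have /matrixP/(_ 0 0) := H0 (col j X); rewrite [RHS]mxE => <-.
  rewrite !mxE; apply: eq_bigr => k _; rewrite !mxE; congr (_ * _).
  by apply: eq_bigr => l _; rewrite !mxE.
have := tr0 (1%:M - H); have := tr0 (1%:M + H).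
rewrite adjmxB adjmxD adjmx1 HH !mulmxDl !mulmxDr !mulNmx !mulmxN.
rewrite !mul1mx !mulmx1.
have trN (A : 'M[C]_n) : \tr (- A) = - \tr A by exact: raddfN.
rewrite !mxtraceD !trN; move=> e1 e2.
apply/eqP; rewrite -mxtrace_mul_adj_eq0 HH.
have : \tr (H *m H) *+ 4 = 0.
  by rewrite -[RHS](subrr 0) -[in X in X - _]e1 -e2; ring.
by move/eqP; rewrite mulrn_eq0 /=.
Qed.

Lemma form_real n (H : 'M[C]_n) (w : 'cV[C]_n) : H^t* = H ->
  (w^t* *m H *m w) 0 0 \is Num.real.
Proof.
move=> HH; apply/CrealP.
have {2}<- : (w^t* *m H *m w)^t* = w^t* *m H *m w.
  by rewrite !adjmxM trmxCK HH mulmxA.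
by rewrite !mxE.
Qed.

(** For real [s] the matrix [k] is Hermitian and its square is again the identity plus a multiple of
    [w *m w^t*], with coefficient [s *+ 2 + s ^+ 2 * b]. Sylvester's identity then evaluates both
    determinants. *)
Lemma det_gram_rank1 n d (N : 'M[C]_(n, d)) (w : 'cV[C]_n) (s : C) :
  \rank N = d -> s \is Num.real ->
  let k := 1%:M + s *: (w *m w^t*) in
  let b := (w^t* *m w) 0 0 in
  \det k = 1 + s * b /\
  \det ((k *m N)^t* *m (k *m N)) =
  \det (N^t* *m N) * (1 + (s *+ 2 + s ^+ 2 * b) * (w^t* *m frame_proj N *m w) 0 0).
Proof.
move=> rN sR k b.
have wwb : w^t* *m w = b%:M by rewrite [LHS]mx11_scalar.
have kH : k^t* = k.
  by rewrite /k adjmxD adjmx1 adjmxZ adjmxM trmxCK (CrealP sR).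
pose c := s *+ 2 + s ^+ 2 * b.
have kk : k *m k = 1%:M + c *: (w *m w^t*).
  have ww2 : w *m w^t* *m (w *m w^t*) = b *: (w *m w^t*).
    by rewrite mulmxA -(mulmxA w) wwb mul_mx_scalar -scalemxAl.
  rewrite /k mulmxDl mul1mx mulmxDr mulmx1 -scalemxAl -scalemxAr ww2 -addrA.
  by congr (_ + _); rewrite !scalerA -!scalerDl /c mulr2n addrA.
have det1w (t : C) m (u : 'cV[C]_m) (v : 'rV[C]_m) :
    \det (1%:M + t *: (u *m v)) = 1 + t * (v *m u) 0 0.
  by rewrite scalemxAl det_addmx1C -scalemxAr det_mx11 !mxE.
split; first by rewrite /k det1w.
rewrite adjmxM kH -mulmxA (mulmxA k) kk mulmxDl mul1mx mulmxDr.
set G := N^t* *m N; have Gu : G \in unitmx by exact: gram_unit.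
have -> : G + N^t* *m (c *: (w *m w^t*) *m N) =
    G *m (1%:M + c *: ((invmx G *m N^t* *m w) *m (w^t* *m N))).
  rewrite mulmxDr mulmx1 -scalemxAl -!scalemxAr; congr (_ + _ *: _).
  by rewrite !mulmxA mulmxV// mul1mx.
rewrite det_mulmx det1w; congr (_ * (1 + _ * _)).
by rewrite /frame_proj -/G !mulmxA.
Qed.

Lemma minimal_moment (P : finType) (chi0 : nat) (chi : P -> nat) n (d : P -> nat)
    (N : forall i, 'M[C]_(n, d i)) :
  (0 < chi0)%N -> (forall i, \rank (N i) = d i) ->
  (forall k : 'M[C]_n, k \in unitmx ->
    \prod_i `|\det ((N i)^t* *m N i)| ^+ chi i * `|\det k| ^+ (2 * chi0) <=
    \prod_i `|\det ((k *m N i)^t* *m (k *m N i))| ^+ chi i) ->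
  \sum_i (chi i)%:R *: frame_proj (N i) = chi0%:R%:M.
Proof.
move=> chi0_gt0 rN kmin; apply/eqP; rewrite -subr_eq0; apply/eqP.
have pH i := (frame_proj_orth (rN i)).1.
apply: quad_form_eq0 => [|w].
  rewrite adjmxB adjmx_scalar conjC_nat; congr (_ - _).
  by rewrite adjmx_sum; apply: eq_bigr => i _; rewrite adjmxZ conjC_nat pH.
pose b := (w^t* *m w) 0 0; pose a i := (w^t* *m frame_proj (N i) *m w) 0 0.
have aR i : a i \is Num.real by exact: form_real.
have bR : b \is Num.real.
  by have := @form_real _ 1%:M w (adjmx1 _); rewrite mulmx1.
suff ab : \sum_i (chi i)%:R * a i = chi0%:R * b.
  apply/matrixP => x y; rewrite !ord1 [RHS]mxE mulmxBr mulmxBl.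
  rewrite mul_mx_scalar -scalemxAl mulmx_sumr mulmx_suml.
  rewrite mxE summxE [X in _ + X]mxE [X in _ - X]mxE -/b -ab; apply/eqP.
  rewrite subr_eq0; apply/eqP/eq_bigr => i _.
  by rewrite -scalemxAr -scalemxAl mxE.
(* The inequality [kmin] is squared so that, for real [s], absolute values disappear and both sides
   become polynomials in [s]; this doubles the exponents. *)
pose p i : {poly C} := (1 + (a i)%:P * ('X *+ 2 + b%:P * 'X^2)) ^+ (2 * chi i).
pose q : {poly C} := (1 + b%:P * 'X) ^+ (4 * chi0).
have jp i : unit_jet (p i) ((a i *+ 2) *+ (2 * chi i)).
  apply: unit_jetX; split; first by rewrite !hornerE /=; ring.
  by rewrite !poly.derivE !hornerE /=; ring.
have jq : unit_jet q (b *+ (4 * chi0)).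
  apply: unit_jetX; split; first by rewrite !hornerE /=; ring.
  by rewrite !poly.derivE !hornerE /=; ring.
have sumR : \sum_i (a i *+ 2) *+ (2 * chi i) - b *+ (4 * chi0) \is Num.real.
  by rewrite rpredB ?rpredMn// rpred_sum// => i _; rewrite !rpredMn.
have e : \sum_i (a i *+ 2) *+ (2 * chi i) = b *+ (4 * chi0).
  apply: unit_jet_le (unit_jet_prod (index_enum P) jp) jq sumR _ => s sR _.
  pose c := s *+ 2 + s ^+ 2 * b.
  have cR : c \is Num.real by rewrite rpredD ?rpredMn// rpredM// rpredX.
  pose A := \prod_i `|1 + c * a i| ^+ chi i.
  have -> : (\prod_i p i).[s] = A ^+ 2.
    rewrite horner_prod -prodrXl; apply: eq_bigr => i _.
    rewrite -exprM mulnC exprM real_normK; last by rewrite rpredD ?rpredM ?rpred1.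
    rewrite -exprM /p horner_exp; congr (_ ^+ _).
    by rewrite !hornerE /c /=; ring.
  have -> : q.[s] = (`|1 + s * b| ^+ (2 * chi0)) ^+ 2.
    rewrite exprM real_normK; last by rewrite rpredD ?rpredM ?rpred1.
    rewrite -!exprM /q horner_exp !hornerE /= (mulrC b); congr (_ ^+ _).
    by rewrite mulnAC.
  have A0 : 0 <= A by apply: prodr_ge0 => i _; exact: exprn_ge0.
  apply: lerXn2r; [by rewrite nnegrE exprn_ge0|by rewrite nnegrE|].
  (* Here the perturbation is singular and minimality says nothing, but the side to be bounded is 0
     because [chi0] is positive. *)
  have [b0|b0] := eqVneq (1 + s * b) 0.
    rewrite b0 normr0 expr0n muln_eq0 /= eqn0Ngt chi0_gt0 /=.
    by apply: prodr_ge0 => i _; exact: exprn_ge0.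
  pose k := 1%:M + s *: (w *m w^t*).
  have kD i := (det_gram_rank1 w (rN i) sR).2.
  have dk : \det k = 1 + s * b.
    have rE : \rank (1%:M : 'M[C]_n) = n by rewrite mxrank1.
    exact: (det_gram_rank1 w rE sR).1.
  have := kmin k; rewrite unitmxE unitfE dk => /(_ b0).
  have -> : \prod_i `|\det ((k *m N i)^t* *m (k *m N i))| ^+ chi i =
            \prod_i `|\det ((N i)^t* *m N i)| ^+ chi i * A.
    rewrite -big_split; apply: eq_bigr => i _ /=.
    by rewrite -/k kD normrM exprMn.
  rewrite ler_pM2l// prodr_gt0// => i _; rewrite exprn_gt0// normr_gt0.
  by rewrite -unitfE -unitmxE gram_unit.
have n2 : (4%:R : C) != 0 by rewrite pnatr_eq0.
apply: (mulfI n2); rewrite mulr_sumr mulrA -natrM mulr_natl -e.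
apply: eq_bigr => i _; rewrite mulrA -natrM mulr_natl -mulrnA.
by rewrite mulnA.
Qed.

End Minimizer.

(** * The energy of a frame system *)

Lemma mxrank_mul_unitl (F : fieldType) n m (A : 'M[F]_n) (X : 'M[F]_(n, m)) :
  A \in unitmx -> \rank (A *m X) = \rank X.
Proof. by move=> AU; rewrite (eqmxMfull X) // row_full_unit. Qed.

Section Energy.
Context {C : numClosedFieldType} {P : finType}.
Variables (chi0 : nat) (chi : P -> nat) (N : nat) (d : P -> nat).
Variable M : forall i, 'M[C]_(N.+1, d i).
Hypothesis rM : forall i, \rank (M i) = d i.
Hypothesis chi_d : (\sum_i chi i * d i = chi0 * N.+1)%N.

(* The exponential of the Kempf-Ness function, up to a constant factor. *)
Definition energy (g : 'M[C]_N.+1) :=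
  \prod_i `|\det ((g *m M i)^t* *m (g *m M i))| ^+ chi i
  / `|\det g| ^+ (2 * chi0).

Lemma energy_unitary u g : u \is unitarymx -> energy (u *m g) = energy g.
Proof.
move=> uU; have uCu := unitarymx_adj uU.
have du : `|\det u| = 1.
  have /(congr1 determinant) := uCu.
  rewrite det_mulmx det_adj det1 mulrC -normCK => /eqP.
  by rewrite sqrp_eq1 ?normr_ge0// => /eqP.
rewrite /energy det_mulmx normrM du mul1r; congr (_ / _).
apply: eq_bigr => i _; rewrite !adjmxM -!mulmxA (mulmxA (u^t*)) uCu mul1mx.
by [].
Qed.

(** The identity [chi_d] makes numerator and denominator homogeneous of the same degree. This
    permits normalizing the largest singular value to 1. *)
Lemma energyZ c g : c != 0 -> energy (c *: g) = energy g.
Proof.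
move=> c0; rewrite /energy detZ normrM normrX exprMn -exprM.
have -> : \prod_i `|\det ((c *: g *m M i)^t* *m (c *: g *m M i))| ^+ chi i =
  `|c| ^+ (N.+1 * (2 * chi0)) *
  \prod_i `|\det ((g *m M i)^t* *m (g *m M i))| ^+ chi i.
  have -> : (N.+1 * (2 * chi0) = \sum_i 2 * d i * chi i)%N.
    rewrite mulnCA (mulnC N.+1) -chi_d big_distrr /=.
    by apply: eq_bigr => i _; rewrite -mulnA (mulnC (d i)).
  rewrite -prodrXr -big_split; apply: eq_bigr => i _ /=.
  rewrite exprM -exprMn; congr (_ ^+ _).
  rewrite -!scalemxAl adjmxZ -scalemxAl -scalemxAr scalerA detZ normrM.
  by rewrite normrX normrM norm_conjC -expr2 -exprM.
by rewrite -mulf_div mulfV ?mul1r// expf_neq0// normr_eq0.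
Qed.

(** Abel summation with [e k] the weighted number of sets [S i] containing [k]. *)
Lemma decreasing_prod_sets (r : 'I_N.+1 -> C) (S : P -> {set 'I_N.+1}) :
  (forall k, 0 < r k) -> (forall k l : 'I_N.+1, (k <= l)%N -> r l <= r k) ->
  (forall k, (0 < k <= N)%N ->
     (chi0 * k < \sum_i chi i * #|[set m in S i | (m < k)%N]|)%N) ->
  (\sum_i chi i * #|S i| = chi0 * N.+1)%N ->
  r ord0 * \prod_k r k ^+ chi0 <=
  r ord_max * \prod_i (\prod_(k in S i) r k) ^+ chi i.
Proof.
move=> r0 rdec Hk HN.
pose l k := r (inord k); pose e k := (\sum_i chi i * (inord k \in S i))%N.
have eE k : (k <= N.+1)%N ->
    (\sum_(j < k) e j = \sum_i chi i * #|[set m in S i | (m < k)%N]|)%N.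
  move=> kN; rewrite exchange_big /=; apply: eq_bigr => i _.
  rewrite -big_distrr /=; congr (_ * _)%N.
  rewrite -sum1_card (big_ord_widen_cond N.+1 xpredT (fun j => nat_of_bool (inord j \in S i)))//.
  rewrite [RHS]big_mkcond [LHS]big_mkcond /=; apply: eq_bigr => j _.
  by rewrite inord_val inE andbC; case: (j \in S i); case: ltnP.
have := @prod_decreasing_ge _ l e chi0 N.
have lo (k : 'I_N.+1) : l k = r k by rewrite /l inord_val.
have -> : \prod_(k < N.+1) l k ^+ chi0 = \prod_k r k ^+ chi0.
  by apply: eq_bigr => k _; rewrite lo.
have -> : \prod_(k < N.+1) l k ^+ e k = \prod_i (\prod_(k in S i) r k) ^+ chi i.
  under [RHS]eq_bigr do rewrite -prodrXl.
  under [RHS]eq_bigr do rewrite big_mkcond /=.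
  rewrite exchange_big; apply: eq_bigr => k _ /=.
  rewrite lo /e inord_val -prodrXr; apply: eq_bigr => i _.
  by case: (k \in S i); rewrite ?muln1 ?muln0.
rewrite (lo ord0) (_ : l N = r ord_max); last by rewrite -(lo ord_max).
apply=> [k|k kN|k /andP[k0 kN]|]; first exact: r0.
- by apply: rdec; rewrite !inordK ?ltnS// ltnW.
- by rewrite eE ?Hk ?k0// ltnW.
- rewrite eE// -HN; apply: eq_bigr => i _; congr (_ * _)%N.
  by apply: eq_card => m; rewrite inE ltn_ord andbT.
Qed.

(** Each Gram determinant is bounded below by a squared minor through [gram_minor_le]. The minor on
    [s i] splits as the product of [r] over [S i] times a minor of [v *m M i], and Abel summation
    compares these products with the determinant of [g]. *)
Lemma energy_lower_bound (u v : 'M[C]_N.+1) (r : 'I_N.+1 -> C)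
    (S : P -> {set 'I_N.+1}) (s : forall i, 'I_(d i) -> 'I_N.+1) :
  u \is unitarymx -> v \is unitarymx ->
  (forall k, 0 < r k) -> (forall k l : 'I_N.+1, (k <= l)%N -> r l <= r k) ->
  (forall k, (0 < k <= N)%N ->
     (chi0 * k < \sum_i chi i * #|[set m in S i | (m < k)%N]|)%N) ->
  (forall i, #|S i| = d i) ->
  (forall i (h : 'I_N.+1 -> C), \prod_j h (s i j) = \prod_(k in S i) h k) ->
  (r ord0 / r ord_max) ^+ 2 *
    \prod_i (`|\det (rowsub (s i) (v *m M i))| ^+ 2) ^+ chi i <=
  (\prod_i (d i)`!%:R ^+ chi i) * energy (u *m realdiag r *m v).
Proof.
move=> uU vU r0 rdec Hk cS sS.
have tU : realdiag r \in unitmx.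
  by have /mulmx1_unit[] := realdiagV r0.
rewrite -mulmxA energy_unitary// /energy mulrA.
set num := \prod_i `|\det (_^t* *m _)| ^+ _.
have dv : `|\det v| = 1.
  have /(congr1 determinant) := unitarymx_adj vU.
  rewrite det_mulmx det_adj det1 mulrC -normCK => /eqP.
  by rewrite sqrp_eq1 ?normr_ge0// => /eqP.
have dg : `|\det (realdiag r *m v)| = \prod_k r k.
  rewrite det_mulmx normrM dv mulr1 det_diag normr_prod.
  by apply: eq_bigr => k _; rewrite mxE gtr0_norm.
have pr0 : 0 < \prod_k r k by apply: prodr_gt0 => k _; exact: r0.
rewrite dg ler_pdivlMr ?exprn_gt0//.
have HN : (\sum_i chi i * #|S i| = chi0 * N.+1)%N.
  by rewrite -chi_d; apply: eq_bigr => i _; rewrite cS.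
have := decreasing_prod_sets r0 rdec Hk HN.
set A := (X in _ <= _ * X) => hA.
have A0 : 0 < A.
  by apply: prodr_gt0 => i _; apply/exprn_gt0/prodr_gt0 => k _; exact: r0.
have hA2 : (r ord0 / r ord_max) ^+ 2 * (\prod_k r k) ^+ (2 * chi0) <= A ^+ 2.
  rewrite mulnC exprM -exprMn; apply: lerXn2r; rewrite ?nnegrE; [|exact: ltW|].
    by rewrite ltW// mulr_gt0 ?exprn_gt0// divr_gt0.
  by rewrite mulrAC ler_pdivrMr// [leRHS]mulrC -prodrXl.
have rs i : rowsub (s i) (realdiag r *m v *m M i) =
    diag_mx (\row_j r (s i j)) *m rowsub (s i) (v *m M i).
  by rewrite /realdiag -mulmxA; apply/matrixP => a b; rewrite !mul_diag_mx !mxE.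
have hnum : A ^+ 2 * \prod_i (`|\det (rowsub (s i) (v *m M i))| ^+ 2) ^+ chi i <=
    (\prod_i (d i)`!%:R ^+ chi i) * num.
  rewrite /A -prodrXl -!big_split /=; apply: ler_prod => i _.
  rewrite exprAC -!exprMn exprAC; apply/andP; split.
    by rewrite !exprn_ge0// mulr_ge0// prodr_ge0// => k _; rewrite ltW.
  apply: lerXn2r.
  - by rewrite nnegrE exprn_ge0// mulr_ge0// prodr_ge0// => k _; rewrite ltW.
  - by rewrite nnegrE mulr_ge0.
  have rk : \rank (realdiag r *m v *m M i) = d i.
    by rewrite -mulmxA !mxrank_mul_unitl// unitarymx_unit.
  have := gram_minor_le (s i) rk; rewrite rs det_mulmx normrM det_diag.
  rewrite normr_prod; under eq_bigr do rewrite mxE gtr0_norm//.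
  by rewrite (sS i r).
apply: le_trans hnum.
rewrite mulrAC ler_wpM2r//.
by apply: prodr_ge0 => i _; rewrite !exprn_ge0.
Qed.

End Energy.

(** * Limits of complex matrices *)

Section MatrixLimits.
Context {C : numClosedFieldType} {T : Type} {F : set_system T} {FF : ProperFilter F}.

Definition ccvg (f : T -> C) (l : C) := f x @[x --> F] --> l.

Lemma ccvgP (f : T -> C) l :
  ccvg f l <-> forall e, 0 < e -> \forall x \near F, `|l - f x| < e.
Proof. exact: cvgrPdist_lt. Qed.

Lemma ccvg_cst c : ccvg (fun=> c) c.
Proof. exact: cvg_cst. Qed.

Lemma ccvgD f g a b : ccvg f a -> ccvg g b -> ccvg (fun x => f x + g x) (a + b).
Proof. exact: cvgD. Qed.

Lemma ccvgB f g a b : ccvg f a -> ccvg g b -> ccvg (fun x => f x - g x) (a - b).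
Proof. exact: cvgB. Qed.

Lemma ccvgM f g a b : ccvg f a -> ccvg g b -> ccvg (fun x => f x * g x) (a * b).
Proof. exact: cvgM. Qed.

Lemma ccvgV f a : a != 0 -> ccvg f a -> ccvg (fun x => (f x)^-1) a^-1.
Proof. exact: cvgV. Qed.

Lemma ccvg_unique f a b : ccvg f a -> ccvg f b -> a = b.
Proof. exact: (@cvg_unique _ (@norm_hausdorff _ _)). Qed.

Lemma ccvg_near_eq f g a : (\forall x \near F, f x = g x) -> ccvg f a -> ccvg g a.
Proof.
move=> fg fa; apply: cvg_trans fa; apply: near_eq_cvg.
by apply: filterS fg => x ->.
Qed.

(** Entrywise convergence makes the algebra of limits available over any [numClosedFieldType];
    [cvg_mcvgE] identifies it with the matrix topology over [R[i]]. *)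
Definition mcvg m n (f : T -> 'M[C]_(m, n)) (L : 'M[C]_(m, n)) :=
  forall i j, ccvg (fun x => f x i j) (L i j).

Lemma ccvg_sum (I : Type) (r : seq I) (f : I -> T -> C) (l : I -> C) :
  (forall i, ccvg (f i) (l i)) ->
  ccvg (fun x => \sum_(i <- r) f i x) (\sum_(i <- r) l i).
Proof.
rewrite /ccvg => fl; elim: r => [|i r IH].
  by rewrite big_nil; under eq_fun do rewrite big_nil; exact: cvg_cst.
by rewrite big_cons; under eq_fun do rewrite big_cons; exact: cvgD.
Qed.

Lemma ccvg_prod (I : Type) (r : seq I) (f : I -> T -> C) (l : I -> C) :
  (forall i, ccvg (f i) (l i)) ->
  ccvg (fun x => \prod_(i <- r) f i x) (\prod_(i <- r) l i).
Proof.
rewrite /ccvg => fl; elim: r => [|i r IH].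
  by rewrite big_nil; under eq_fun do rewrite big_nil; exact: cvg_cst.
by rewrite big_cons; under eq_fun do rewrite big_cons; exact: cvgM.
Qed.

Lemma ccvg_conj f l : ccvg f l -> ccvg (fun x => (f x)^*) l^*.
Proof.
move/ccvgP => fl; apply/ccvgP => e e0.
by apply: filterS (fl e e0) => x; rewrite -rmorphB norm_conjC.
Qed.

Lemma mcvg_cst m n (A : 'M[C]_(m, n)) : mcvg (fun=> A) A.
Proof. by move=> i j; exact: cvg_cst. Qed.

Lemma mcvgZ m n (c : T -> C) (g : T -> 'M[C]_(m, n)) (a : C) B :
  ccvg c a -> mcvg g B -> mcvg (fun x => c x *: g x) (a *: B).
Proof.
by move=> fA gB i j; rewrite !mxE; under eq_fun do rewrite !mxE; exact: ccvgM.
Qed.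

Lemma mcvgM m n p (f : T -> 'M[C]_(m, n)) (g : T -> 'M[C]_(n, p)) A B :
  mcvg f A -> mcvg g B -> mcvg (fun x => f x *m g x) (A *m B).
Proof.
move=> fA gB i j; rewrite !mxE; under eq_fun do rewrite !mxE.
by apply: ccvg_sum => k; exact: ccvgM.
Qed.

Lemma mcvg_sum m n (I : Type) (r : seq I) (f : I -> T -> 'M[C]_(m, n)) A :
  (forall i, mcvg (f i) (A i)) ->
  mcvg (fun x => \sum_(i <- r) f i x) (\sum_(i <- r) A i).
Proof.
move=> fA i j; rewrite summxE; under eq_fun do rewrite summxE.
by apply: ccvg_sum => k; exact: fA.
Qed.

Lemma mcvg_adj m n (f : T -> 'M[C]_(m, n)) A :
  mcvg f A -> mcvg (fun x => (f x)^t*) (A^t*).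
Proof.
by move=> fA i j; rewrite !mxE; under eq_fun do rewrite !mxE; exact: ccvg_conj.
Qed.

Lemma ccvg_det n (f : T -> 'M[C]_n) A :
  mcvg f A -> ccvg (fun x => \det (f x)) (\det A).
Proof.
move=> fA; apply: ccvg_sum => s; apply: ccvgM; first exact: ccvg_cst.
by apply: ccvg_prod => i; exact: fA.
Qed.

Lemma ccvg_mxtrace n (f : T -> 'M[C]_n) A :
  mcvg f A -> ccvg (fun x => \tr (f x)) (\tr A).
Proof. by move=> fA; apply: ccvg_sum => s; exact: fA. Qed.

Lemma mcvg_invmx n (f : T -> 'M[C]_n) A : A \in unitmx ->
  mcvg f A -> mcvg (fun x => invmx (f x)) (invmx A) /\
  \forall x \near F, f x \in unitmx.
Proof.
move=> Au fA.
have dA : \det A != 0 by rewrite -unitfE -unitmxE.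
have nf : \forall x \near F, f x \in unitmx.
  have := ccvg_det fA; move/ccvgP/(_ `|\det A|).
  rewrite normr_gt0 => /(_ dA); apply: filterS => x.
  rewrite unitmxE unitfE; apply: contraTneq => ->.
  by rewrite subr0 ltxx.
split=> // i j; rewrite /invmx Au !mxE.
(* The cofactor formula describes [invmx] only on invertible matrices, hence only eventually along
   [F]. *)
apply: (@ccvg_near_eq (fun x => (\det (f x))^-1 * cofactor (f x) j i)).
  apply: filterS nf => x fu.
  by rewrite fu !mxE.
apply: ccvgM; first by apply: ccvgV => //; exact: ccvg_det.
rewrite /cofactor; apply: ccvgM; first exact: ccvg_cst.
by apply: ccvg_det => k l; rewrite !mxE; under eq_fun do rewrite !mxE; exact: fA.
Qed.

Lemma mcvg_unique m n (f : T -> 'M[C]_(m, n)) A B :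
  mcvg f A -> mcvg f B -> A = B.
Proof.
move=> fA fB; apply/matrixP => i j.
exact: ccvg_unique (fA i j) (fB i j).
Qed.

Lemma mcvg_near_eq m n (f g : T -> 'M[C]_(m, n)) A :
  (\forall x \near F, f x = g x) -> mcvg f A -> mcvg g A.
Proof.
move=> fg fA i j; apply: ccvg_near_eq (fA i j).
by apply: filterS fg => x ->.
Qed.

(** The first hypothesis is a Bolzano-Weierstrass property of the filter, supplied by ultrafilters
    on [R[i]]. Keeping it abstract leaves the degeneration argument purely algebraic. *)
Lemma bounded_mcvg m n (f : T -> 'M[C]_(m, n)) :
  (forall g, (\forall x \near F, `|g x| <= 1) -> exists l, ccvg g l) ->
  (\forall x \near F, forall i j, `|f x i j| <= 1) -> exists L, mcvg f L.
Proof.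
move=> bounded_cvg f1.
have /choice[L fL] (ij : 'I_m * 'I_n) :
    exists l, ccvg (fun x => f x ij.1 ij.2) l.
  by apply: bounded_cvg; apply: filterS f1 => x; exact.
by exists (\matrix_(i, j) L (i, j)) => i j; rewrite mxE; exact: fL (i, j).
Qed.

End MatrixLimits.

Section ComplexLimits.
Context {R : realType}.
Local Notation C := R[i].

Lemma cvg_mcvgE T (F : set_system T) {FF : ProperFilter F} m n (f : T -> 'M[C]_(m, n)) L :
  (f @ F --> L) <-> mcvg (F := F) f L.
Proof.
split=> [fL i j A nA|fL A [P nP sPA]].
  rewrite nbhs_filterE /=.
  apply: (fL [set M | A (M i j)]).
  exists (fun k l => if (k == i) && (l == j) then A else setT).
    move=> k l; case: ifP => [/andP[/eqP -> /eqP ->]//|_].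
    exact: filterT.
  by move=> M /(_ i j); rewrite !eqxx.
have FP i : \forall x \near F, forall j, P i j (f x i j).
  by apply: filter_forall => j; exact: (fL i j _ (nP i j)).
suff : \forall x \near F, A (f x) by [].
have := @filter_forall _ _ _ F FF FP; apply: filterS => x Px; exact: sPA.
Qed.

(** Compactness gives a cluster point; for an ultrafilter a cluster point is a limit, since a set or
    its complement belongs to it. *)
Lemma ultra_image_cvg T (F : set_system T) (U : topologicalType) (K : set U) (f : T -> U) :
  UltraFilter F -> compact K -> (\forall x \near F, K (f x)) ->
  exists2 l, K l & f @ F --> l.
Proof.
move=> UF cK FK.
have [l [Kl cl]] := cK _ (fmap_proper_filter f ultra_proper) FK.
exists l => // A nA.
have [//|nFA] := in_ultra_setVsetC (f @^-1` A) UF.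
by have [y []] := cl (~` A) A nFA nA.
Qed.

Lemma real_complex_cvg T (F : set_system T) {FF : ProperFilter F} (f : T -> R) (a : R) :
  f @ F --> a -> ccvg (F := F) (fun x => (f x)%:C%C) a%:C%C.
Proof.
move/cvgrPdist_lt => fa; apply/ccvgP => e e0.
have eE : e = (complex.Re e)%:C%C by rewrite RRe_real// gtr0_real.
move: e0; rewrite eE (ltcR 0) => /fa; apply: filterS => x.
by rewrite -rmorphB /= normc_def /= expr0n addr0 sqrtr_sqr ltcR.
Qed.

Lemma ultra_cvg_complex T (F : set_system T) (f : T -> C) : UltraFilter F ->
  (\forall x \near F, `|f x| <= 1) ->
  exists l : C, ccvg (F := F) f l.
Proof.
move=> UF f1.
have bd (h : T -> R) : (\forall x \near F, `|h x| <= 1) -> exists a : R, h @ F --> a.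
  move=> h1; have hK : \forall x \near F, `[-1, 1]%classic (h x).
    by apply: filterS h1 => x; rewrite /= in_itv /= ler_norml.
  have [a _ ha] := ultra_image_cvg UF (@segment_compact R (-1) 1) hK.
  by exists a.
have [a fa] : exists a : R, (fun x => complex.Re (f x)) @ F --> a.
  apply: bd; apply: filterS f1 => x fx; rewrite -lecR.
  exact: le_trans (normc_ge_Re _) fx.
have [b fb] : exists b : R, (fun x => complex.Im (f x)) @ F --> b.
  apply: bd; apply: filterS f1 => x fx; rewrite -lecR -normrN -ReiNIm.
  apply: le_trans (normc_ge_Re _) _; rewrite normrM (_ : `|'i%C| = 1) ?mulr1//.
  by rewrite normc_def /= expr0n expr1n add0r sqrtr1.
exists (a%:C + 'i * b%:C)%C.
have -> : f = fun x => ((complex.Re (f x))%:C + 'i * (complex.Im (f x))%:C)%C.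
  by apply/funext => x; exact: complexE.
apply: ccvgD; first exact: real_complex_cvg.
by apply: ccvgM; [exact: ccvg_cst|exact: real_complex_cvg].
Qed.

Lemma ultra_mcvg T (F : set_system T) m n (f : T -> 'M[C]_(m, n)) : UltraFilter F ->
  (\forall x \near F, forall i j, `|f x i j| <= 1) ->
  exists L, mcvg (F := F) f L.
Proof.
move=> UF; apply: bounded_mcvg => g; exact: ultra_cvg_complex.
Qed.

End ComplexLimits.

(** * Existence of energy minimizers *)

Section MoreLimits.
Context {C : numClosedFieldType} {T : Type} {F : set_system T} {FF : ProperFilter F}.
Implicit Types (f g : T -> C).

Lemma ccvg_norm f a : ccvg (F := F) f a -> ccvg (F := F) (fun x => `|f x|) `|a|.
Proof.
move/ccvgP => fa; apply/ccvgP => e /fa; apply: filterS => x.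
exact/le_lt_trans/ler_dist_dist.
Qed.

Lemma ccvgX f a n : ccvg (F := F) f a -> ccvg (F := F) (fun x => f x ^+ n) (a ^+ n).
Proof.
move=> fa; elim: n => [|n IH]; first exact: ccvg_cst.
by rewrite exprS; under eq_fun do rewrite exprS; exact: ccvgM.
Qed.

Lemma ccvg_le f a c : ccvg (F := F) f a -> a \is Num.real -> c \is Num.real ->
  (\forall x \near F, f x <= c) -> a <= c.
Proof.
move=> fa aR cR fc; rewrite real_leNgt//; apply/negP => ca.
have /ccvgP/(_ (a - c)) := fa; rewrite subr_gt0 => /(_ ca) ha.
have [x [xc]] := filter_ex (filterI fc ha).
rewrite ger0_norm ?subr_ge0 ?(le_trans xc) ?ltW//.
by rewrite ltrD2l ltrN2 => /(le_lt_trans xc); rewrite ltxx.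
Qed.

Lemma ccvg_neq0 f a c : ccvg (F := F) f a -> 0 < c ->
  (\forall x \near F, c <= `|f x|) -> a != 0.
Proof.
move=> fa c0 fc; apply/eqP => a0.
have /ccvgP/(_ c c0) := fa; rewrite a0 => ha.
have [x [xc]] := filter_ex (filterI fc ha).
by rewrite sub0r normrN => /(le_lt_trans xc); rewrite ltxx.
Qed.

Lemma ccvg_gt_half f a : ccvg (F := F) f a -> 0 < a ->
  (forall x, f x \is Num.real) -> \forall x \near F, a / 2%:R <= f x.
Proof.
move=> fa a0 fR; have /ccvgP/(_ (a / 2%:R)) := fa.
rewrite divr_gt0// => /(_ isT); apply: filterS => x.
rewrite real_ltr_norml ?rpredB// ?gtr0_real// => /andP[_].
rewrite ltrBlDr -ltrBlDl => h; apply: ltW; apply: le_lt_trans h.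
by rewrite {2}(splitr a) addrK.
Qed.

Lemma mcvg_unitary n (u : T -> 'M[C]_n) u0 : mcvg (F := F) u u0 ->
  (forall x, u x \is unitarymx) -> u0 \is unitarymx.
Proof.
move=> uu uU; apply/unitarymxP.
apply: mcvg_unique (mcvgM uu (mcvg_adj uu)) _.
apply: (@mcvg_near_eq _ _ F _ _ _ (fun=> 1%:M)); last exact: mcvg_cst.
by apply: nearW => x; apply/esym/unitarymxP.
Qed.

Lemma mcvg_realdiag n (r : T -> 'I_n -> C) r0 :
  (forall k, ccvg (F := F) (fun x => r x k) (r0 k)) ->
  mcvg (F := F) (fun x => realdiag (r x)) (realdiag r0).
Proof.
move=> rr i j; rewrite !mxE; under eq_fun do rewrite !mxE.
by case: eqP => _; rewrite ?mulr1n ?mulr0n; [exact: rr|exact: ccvg_cst].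
Qed.

End MoreLimits.

Lemma unitary_entry_le1 (C : numClosedFieldType) n (u : 'M[C]_n) i j :
  u \is unitarymx -> `|u i j| <= 1.
Proof.
move=> /unitarymxP/matrixP/(_ i i); rewrite !mxE eqxx => e.
have : `|u i j| ^+ 2 <= 1.
  rewrite -[leRHS]e (bigD1 j)//= !mxE -normCK lerDl sumr_ge0// => k _.
  by rewrite !mxE -normCK exprn_ge0.
by rewrite expr_le1.
Qed.

Section StableRank.
Context {F : fieldType} {P : finType}.
Variables (chi0 : nat) (chi : P -> nat) (N : nat) (d : P -> nat).
Variable M : forall i, 'M[F]_(N.+1, d i).
Hypothesis rM : forall i, \rank (M i) = d i.
Hypothesis chi_d : (\sum_i chi i * d i = chi0 * N.+1)%N.

Definition stable_frames :=
  forall K : {vspace 'cV[F]_N.+1}, K != 0%VS -> K != fullv ->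
  (\sum_i chi i * \dim (column_space (M i) :&: K) < chi0 * \dim K)%N.

(** Stability is applied to the common kernel of the first [k] rows of [v], of dimension [N.+1 - k].
    Rank-nullity on each column space turns dimensions of intersections into ranks and reverses the
    inequality. *)
Lemma stable_top_rows (v : 'M[F]_N.+1) k : stable_frames -> v \in unitmx ->
  (0 < k <= N)%N -> (chi0 * k < \sum_i chi i * \rank (top_rows (v *m M i) k))%N.
Proof.
move=> st vU /andP[k0 kN].
pose f := mx_act (pid_mx k *m v : 'M[F]_N.+1).
have rf : \rank (pid_mx k *m v : 'M[F]_N.+1) = k.
  by rewrite mxrankMfree ?row_free_unit// rank_pid_mx// ltnW.
have dK : (\dim (lker f) + k = N.+1)%N.
  have := limg_ker_dim f fullv; rewrite capfv -/(column_space _) dim_column_space rf.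
  by rewrite dimvf /dim /= muln1.
have dM i : (\dim (column_space (M i) :&: lker f) + \rank (top_rows (v *m M i) k) = d i)%N.
  have := limg_ker_dim f (column_space (M i)).
  by rewrite limg_mx_act !dim_column_space rM /top_rows mulmxA.
have := st (lker f); rewrite -!dimv_eq0 -lt0n.
have -> : (0 < \dim (lker f))%N by move: dK kN; clear; lia.
move=> /(_ isT); have -> : lker f != fullv.
  apply/eqP => e; move: dK; rewrite e dimvf /dim /= muln1.
  by move: k0; clear; lia.
move=> /(_ isT).
have : (\sum_i chi i * \dim (column_space (M i) :&: lker f) +
        \sum_i chi i * \rank (top_rows (v *m M i) k) = chi0 * N.+1)%N.
  rewrite -chi_d -big_split; apply: eq_bigr => i _ /=.
  by rewrite -mulnDr dM.
move: dK; set a := \dim _; set b := (\sum_i _)%N; set c := (\sum_i _)%N.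
by clear => <-; rewrite mulnDr; lia.
Qed.

End StableRank.

Section Minimum.
Context {R : realType} {P : finType}.
Local Notation C := R[i].
Variables (chi0 : nat) (chi : P -> nat) (N : nat) (d : P -> nat).
Variable M : forall i, 'M[C]_(N.+1, d i).
Hypothesis rM : forall i, \rank (M i) = d i.
Hypothesis chi_d : (\sum_i chi i * d i = chi0 * N.+1)%N.

Lemma energy_ge0 g : 0 <= energy chi0 chi M g.
Proof.
by rewrite /energy divr_ge0 ?exprn_ge0// prodr_ge0// => i _; rewrite exprn_ge0.
Qed.

Lemma energy_cvg T (F : set_system T) {FF : ProperFilter F} (g : T -> 'M[C]_N.+1) G :
  G \in unitmx -> mcvg (F := F) g G ->
  ccvg (F := F) (fun x => energy chi0 chi M (g x)) (energy chi0 chi M G).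
Proof.
move=> GU gG; apply: ccvgM.
  apply: ccvg_prod => i; apply/ccvgX/ccvg_norm/ccvg_det.
  by apply: mcvgM; [apply: mcvg_adj|]; apply: mcvgM => //; exact: mcvg_cst.
apply: ccvgV; last exact/ccvgX/ccvg_norm/ccvg_det.
by rewrite expf_neq0// normr_eq0 -unitfE -unitmxE.
Qed.

End Minimum.

Section BoundedRatio.
Context {C : numClosedFieldType} {P : finType}.
Variables (chi0 : nat) (chi : P -> nat) (N : nat) (d : P -> nat).
Variable M : forall i, 'M[C]_(N.+1, d i).
Hypothesis rM : forall i, \rank (M i) = d i.
Hypothesis chi_d : (\sum_i chi i * d i = chi0 * N.+1)%N.
Hypothesis st : stable_frames chi0 chi M.

(* The minors of [v x *m M i] on the greedy rows of [v0 *m M i] stay away from 0,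
   so [energy_lower_bound] controls the ratio of the extreme singular values. *)
Lemma energy_coercive T (F : set_system T) {FF : ProperFilter F}
    (u v : T -> 'M[C]_N.+1) (r : T -> 'I_N.+1 -> C) v0 B :
  (forall x, u x \is unitarymx) -> (forall x, v x \is unitarymx) ->
  (forall x k, 0 < r x k) ->
  (forall x (k l : 'I_N.+1), (k <= l)%N -> r x l <= r x k) ->
  mcvg (F := F) v v0 -> 0 <= B ->
  (\forall x \near F, energy chi0 chi M (u x *m realdiag (r x) *m v x) <= B) ->
  exists2 c : C, 0 < c & \forall x \near F, forall k, c <= `|r x k / r x ord0| ^+ 2.
Proof.
move=> uU vU r0 rdec vv0 B0 leB.
have v0U : v0 \in unitmx by apply/unitarymx_unit/(mcvg_unitary vv0 vU).
have rk i : \rank (v0 *m M i) = d i by rewrite mxrank_mul_unitl.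
have gr i : {Ss : {set 'I_N.+1} * ('I_(d i) -> 'I_N.+1) |
    [/\ rowsub Ss.2 (v0 *m M i) \in unitmx,
      forall (h : 'I_N.+1 -> C), \prod_j h (Ss.2 j) = \prod_(k in Ss.1) h k &
      forall k, (k <= N.+1)%N ->
        #|[set m in Ss.1 | (m < k)%N]| = \rank (top_rows (v0 *m M i) k)]}.
  by apply: cid; have [S [s Ss]] := greedy_rowsP (rk i); exists (S, s).
pose S i := (sval (gr i)).1; pose s i := (sval (gr i)).2.
have sU i : rowsub (s i) (v0 *m M i) \in unitmx by rewrite /s; case: (gr i) => ? [].
have sS i (h : 'I_N.+1 -> C) : \prod_j h (s i j) = \prod_(k in S i) h k.
  by rewrite /s /S; case: (gr i) => ? [].
have cS i k : (k <= N.+1)%N ->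
    #|[set m in S i | (m < k)%N]| = \rank (top_rows (v0 *m M i) k).
  by rewrite /S; case: (gr i) => ? [_ _ h] /=; exact: h.
have Hk k : (0 < k <= N)%N ->
    (chi0 * k < \sum_i chi i * #|[set m in S i | (m < k)%N]|)%N.
  move=> kN; under eq_bigr => i _.
    rewrite cS; last by case/andP: kN => _ /leq_trans; apply.
    over.
  exact: stable_top_rows.
have dS i : #|S i| = d i.
  have topn : top_rows (v0 *m M i) N.+1 = v0 *m M i.
    by apply/row_matrixP => k; rewrite row_top_rows ltn_ord.
  rewrite -[RHS](rk i) -topn -cS//; apply: eq_card => k.
  by rewrite inE ltn_ord andbT.
pose D w := \prod_i (`|\det (rowsub (s i) (w *m M i))| ^+ 2) ^+ chi i.
have D0 : 0 < D v0.
  apply: prodr_gt0 => i _; rewrite !exprn_gt0// normr_gt0.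
  by rewrite -unitfE -unitmxE.
have DD : ccvg (F := F) (fun x => D (v x)) (D v0).
  apply: ccvg_prod => i; apply/ccvgX/ccvgX/ccvg_norm/ccvg_det => a b.
  rewrite mxE; under eq_fun do rewrite mxE.
  by apply: mcvgM => //; exact: mcvg_cst.
have D_ge : \forall x \near F, D v0 / 2%:R <= D (v x).
  apply: ccvg_gt_half => // x; apply: ger0_real.
  by apply: prodr_ge0 => i _; rewrite !exprn_ge0.
pose K : C := \prod_i (d i)`!%:R ^+ chi i.
have K0 : 0 < K by apply: prodr_gt0 => i _; rewrite exprn_gt0// ltr0n fact_gt0.
(* [B + 1] replaces [B] so that the denominator of the bound is positive even when [B] is 0. *)
have B1 : 0 < K * (B + 1) by rewrite mulr_gt0// ltr_wpDl.
exists (D v0 / 2%:R / (K * (B + 1))); first by rewrite !divr_gt0.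
apply: filterS2 leB D_ge => x leB D_ge k.
have := energy_lower_bound rM chi_d (uU x) (vU x) (r0 x) (rdec x) Hk dS sS.
rewrite -/K -/(D _) => lb.
have le1 : (r x ord0 / r x ord_max) ^+ 2 * (D v0 / 2%:R) <= K * (B + 1).
  apply: le_trans (_ : (r x ord0 / r x ord_max) ^+ 2 * D (v x) <= _).
    by apply: ler_wpM2l => //; rewrite exprn_ge0// ltW// divr_gt0.
  apply: le_trans lb _; apply: ler_wpM2l; first exact: ltW.
  by apply: le_trans leB _; rewrite lerDl.
have kmax : r x ord_max / r x ord0 <= `|r x k / r x ord0|.
  rewrite gtr0_norm ?divr_gt0//; apply: ler_wpM2r; first by rewrite ltW ?invr_gt0.
  by apply: rdec; rewrite -ltnS ltn_ord.
apply: le_trans (_ : (r x ord_max / r x ord0) ^+ 2 <= _); last first.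
  by apply: lerXn2r; rewrite ?nnegrE// ltW// divr_gt0.
rewrite ler_pdivrMr// -ler_pdivrMl ?exprn_gt0 ?divr_gt0//.
by rewrite -exprVn invf_div.
Qed.
End BoundedRatio.

Section SVDFamily.
Context {C : numClosedFieldType} {T : Type} {F : set_system T} {FF : ProperFilter F}.

Lemma svd_family n (g : T -> 'M[C]_n) : (forall x, g x \in unitmx) ->
  exists (u v : T -> 'M[C]_n) (r : T -> 'I_n -> C),
    [/\ forall x, u x \is unitarymx, forall x, v x \is unitarymx,
        forall x j, 0 < r x j,
        forall x (i j : 'I_n), (i <= j)%N -> r x j <= r x i &
        forall x, g x = u x *m realdiag (r x) *m v x].
Proof.
move=> gU.
have /choice[w wP] x : exists w : 'M[C]_n * 'M[C]_n * ('I_n -> C),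
    [/\ w.1.1 \is unitarymx, w.1.2 \is unitarymx, forall j, 0 < w.2 j,
        forall i j : 'I_n, (i <= j)%N -> w.2 j <= w.2 i &
        g x = w.1.1 *m realdiag w.2 *m w.1.2].
  have [u [v [r h]]] := singular_value_decomposition (gU x).
  by exists (u, v, r).
exists (fun x => (w x).1.1), (fun x => (w x).1.2), (fun x => (w x).2).
by split=> x; have [] := wP x.
Qed.

Lemma realdiag_scale n (c : C) (r : 'I_n -> C) :
  realdiag (fun j => r j / c) = c^-1 *: realdiag r.
Proof. by apply/matrixP => i j; rewrite !mxE mulrnAr mulrC. Qed.

Lemma mcvg_svd n (u v : T -> 'M[C]_n) (t : T -> 'I_n -> C) u0 v0 t0 :
  mcvg (F := F) u u0 -> mcvg (F := F) v v0 ->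
  (forall j, ccvg (F := F) (fun x => t x j) (t0 j)) ->
  mcvg (F := F) (fun x => u x *m realdiag (t x) *m v x) (u0 *m realdiag t0 *m v0).
Proof. by move=> uu vv tt; apply: mcvgM => //; apply: mcvgM => //; exact: mcvg_realdiag. Qed.

Lemma realdiag_unit n (r : 'I_n -> C) :
  (forall j, r j != 0) -> realdiag r \in unitmx.
Proof.
move=> r0; rewrite unitmxE det_diag unitfE prodf_seq_neq0.
by apply/allP => j _; rewrite mxE r0.
Qed.

End SVDFamily.

Section Minimum.
Context {R : realType} {P : finType}.
Local Notation C := R[i].
Variables (chi0 : nat) (chi : P -> nat) (N : nat) (d : P -> nat).
Variable M : forall i, 'M[C]_(N.+1, d i).
Hypothesis rM : forall i, \rank (M i) = d i.
Hypothesis chi_d : (\sum_i chi i * d i = chi0 * N.+1)%N.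
Hypothesis st : stable_frames chi0 chi M.
Local Notation E := (energy chi0 chi M).

Lemma energy_minimum : exists2 g : 'M[C]_N.+1, g \in unitmx &
  forall k, k \in unitmx -> E g <= E k.
Proof.
have E_real g : E g = (complex.Re (E g))%:C%C.
  by rewrite RRe_real// ger0_real// energy_ge0.
(* Energies are real numbers inside [R[i]]; the infimum exists in [R], so it is taken over real
   parts. *)
pose A : set R := [set complex.Re (E g) | g in [set g | g \in unitmx]].
have hA : has_inf A.
  split; first by exists (complex.Re (E 1%:M)), 1%:M => //=; exact: unitmx1.
  exists 0 => _ [g _ <-].
  by have := energy_ge0 chi0 chi M g; rewrite E_real (lecR 0).
pose m := inf A.
have /choice[g gP] (k : nat) : exists g : 'M[C]_N.+1,
    g \in unitmx /\ complex.Re (E g) < m + k.+1%:R^-1.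
  have k0 : 0 < k.+1%:R^-1 :> R by rewrite invr_gt0 ltr0n.
  by have [_ [g gU <-] lt] := inf_adherent k0 hA; exists g.
have [u [v [r [uU vU r0 rdec gE]]]] := svd_family (fun k => (gP k).1).
have [F [UF oF]] := @ultraFilterLemma _ (\oo : set_system nat) _.
have FF : ProperFilter F by exact: ultra_proper.
have [u0 uu0] : exists u0, mcvg (F := F) u u0.
  by apply: ultra_mcvg; apply: nearW => k i j; exact: unitary_entry_le1.
have [v0 vv0] : exists v0, mcvg (F := F) v v0.
  by apply: ultra_mcvg; apply: nearW => k i j; exact: unitary_entry_le1.
have nearE (e : R) : 0 < e -> \forall k \near F, E (g k) <= (m + e)%:C%C.
  move=> e0; apply: oF.
  have : \forall k \near \oo, k.+1%:R^-1 < e.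
    exact: near_infty_natSinv_lt (PosNum e0).
  apply: filterS => k ke; rewrite E_real lecR ltW//.
  by apply: lt_trans (gP k).2 _; rewrite ltrD2l.
have m0 : 0 <= m.
  apply: lb_le_inf; first by case: hA.
  move=> _ [h _ <-].
  by have := energy_ge0 chi0 chi M h; rewrite E_real (lecR 0).
have m1 : 0 <= (m + 1)%:C%C :> C by rewrite (lecR 0) addr_ge0.
have bE : \forall k \near F, E (u k *m realdiag (r k) *m v k) <= (m + 1)%:C%C.
  by apply: filterS (nearE 1 ltr01) => k; rewrite gE.
have [c c0 cr] := energy_coercive rM chi_d st uU vU r0 rdec vv0 m1 bE.
(* Dividing by the largest singular value leaves the energy unchanged and brings all ratios into the
   unit interval; coercivity keeps their limits away from 0, so the limit matrix is invertible. *)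
pose t k j := r k j / r k ord0.
have [t0 tt0] : exists t0, forall j, ccvg (F := F) (fun k => t k j) (t0 j).
  have /choice[t0 tt0] j : exists l, ccvg (F := F) (fun k => t k j) l.
    apply: ultra_cvg_complex; apply: nearW => k.
    rewrite gtr0_norm ?divr_gt0// ler_pdivrMr// mul1r.
    exact: rdec.
  by exists t0.
have t00 j : t0 j != 0.
  have : t0 j ^+ 2 != 0.
    have h : ccvg (F := F) (fun k => t k j ^+ 2) (t0 j ^+ 2) by exact: ccvgX.
    apply: (ccvg_neq0 h c0).
    by apply: filterS cr => k /(_ j); rewrite normrX.
  by rewrite expf_eq0.
pose G := u0 *m realdiag t0 *m v0.
have GU : G \in unitmx.
  have tU := realdiag_unit t00.
  have u0U := unitarymx_unit (mcvg_unitary uu0 uU).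
  have v0U := unitarymx_unit (mcvg_unitary vv0 vU).
  by rewrite !unitmx_mul u0U tU v0U.
have gG : mcvg (F := F) (fun k => u k *m realdiag (t k) *m v k) G.
  exact: mcvg_svd uu0 vv0 tt0.
have EtE k : E (u k *m realdiag (t k) *m v k) = E (g k).
  have -> : u k *m realdiag (t k) *m v k = (r k ord0)^-1 *: g k.
    by rewrite gE realdiag_scale -scalemxAr -scalemxAl.
  by rewrite energyZ// invr_eq0 gt_eqF.
have EG : ccvg (F := F) (fun k => E (g k)) (E G).
  apply: (ccvg_near_eq _ (@energy_cvg _ _ chi0 chi _ _ M _ F _ _ _ GU gG)).
  by apply: nearW => k; exact: EtE.
exists G; first exact: GU.
move=> k kU.
suff leRe : complex.Re (E G) <= complex.Re (E k).
  by rewrite (E_real G) (E_real k) lecR.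
apply: (@le_trans _ _ m); last by apply: ge_inf; [case: hA|exists k].
apply/ler_addgt0Pr => e e0.
suff : E G <= (m + e)%:C%C by rewrite (E_real G) lecR.
apply: ccvg_le EG _ _ (nearE e e0); first by rewrite ger0_real// energy_ge0.
by apply: ger0_real; rewrite (lecR 0) addr_ge0// ltW.
Qed.

End Minimum.

(** * Polystable representations are unitarizable *)

Section BijectiveLfun.
Context {F : fieldType} {V W : vectType F} {f : 'Hom(V, W)}.
Hypothesis bf : bijective f.

Lemma bij_lker0 : lker f = 0%VS.
Proof.
apply/eqP; rewrite -subv0; apply/subvP => v; rewrite memv_ker memv0 => /eqP fv.
by apply/eqP/(bij_inj bf); rewrite fv linear0.
Qed.

Lemma bij_mem_img (U : {vspace V}) v : (f v \in (f @: U)%VS) = (v \in U).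
Proof.
apply/memv_imgP/idP => [[w wU /(bij_inj bf) ->//]|vU]; by exists v.
Qed.

Lemma bij_dim_img (U : {vspace V}) : \dim (f @: U) = \dim U.
Proof. by rewrite limg_dim_eq// bij_lker0 capv0. Qed.

Lemma bij_limg : limg f = fullv.
Proof.
have [g fK gK] := bf; apply/eqP; rewrite eqEsubv subvf; apply/subvP => w _.
by apply/memv_imgP; exists (g w); rewrite ?memvf ?gK.
Qed.

Lemma bij_img_cap (U U' : {vspace V}) : (f @: (U :&: U') = f @: U :&: f @: U')%VS.
Proof.
have [g fK gK] := bf; apply/vspaceP => w.
by rewrite -(gK w) memv_cap !bij_mem_img memv_cap.
Qed.

End BijectiveLfun.

Definition coord_col (F : fieldType) (V : vectType F) (v : V) : 'cV[F]_(dim V) :=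
  (v2r v)^T.

Lemma coord_col_linear (F : fieldType) (V : vectType F) : linear (@coord_col F V).
Proof. by move=> a x y; rewrite /coord_col linearP /= linearD linearZ. Qed.

HB.instance Definition _ (F : fieldType) (V : vectType F) :=
  GRing.isLinear.Build F V 'cV[F]_(dim V) _ (@coord_col F V) (@coord_col_linear F V).

Lemma cV_iso (F : fieldType) (V : vectType F) :
  exists f : 'Hom(V, 'cV[F]_(\dim {:V})), bijective f.
Proof.
rewrite dimvf; exists (linfun (@coord_col F V)).
exists (fun w => r2v w^T) => v.
  by rewrite lfunE /= /coord_col trmxK v2rK.
by rewrite lfunE /= /coord_col r2vK trmxK.
Qed.

Section BlockModel.
Context {C : numClosedFieldType} {P : finType}.
Variables (chi0 : nat) (chi : P -> nat).

Lemma block_orth_proj m n (p : 'M[C]_m) (q : 'M[C]_n) :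
  orth_proj p -> orth_proj q -> orth_proj (block_mx p 0 0 q).
Proof.
move=> [pH pI] [qH qI]; split.
  by rewrite tr_block_mx map_block_mx pH qH !trmx0 !map_mx0.
by rewrite mulmx_block !mulmx0 !mul0mx !addr0 !add0r pI qI.
Qed.

Lemma block_moment_sum m n (p : P -> 'M[C]_m) (q : P -> 'M[C]_n) :
  \sum_i (chi i)%:R *: p i = chi0%:R%:M -> \sum_i (chi i)%:R *: q i = chi0%:R%:M ->
  \sum_i (chi i)%:R *: block_mx (p i) 0 0 (q i) = chi0%:R%:M.
Proof.
move=> sp sq; rewrite scalar_mx_block -sp -sq.
under eq_bigr do rewrite scale_block_mx !scaler0.
apply: (big_rec3 (fun x y z => z = block_mx x 0 0 y)) => [|i x y z _ ->].
  by rewrite block_mx_const.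
by rewrite add_block_mx !addr0.
Qed.

Lemma mem_block_column_space m n (p : 'M[C]_m) (q : 'M[C]_n)
    (a : 'cV[C]_m) (b : 'cV[C]_n) : orth_proj p -> orth_proj q ->
  (col_mx a b \in column_space (block_mx p 0 0 q)) =
  (a \in column_space p) && (b \in column_space q).
Proof.
move=> op oq; have ob := block_orth_proj op oq.
rewrite !column_space_idemP ?op.2 ?oq.2 ?ob.2// mul_block_col !mul0mx addr0 add0r.
apply/eqP/andP => [/eq_col_mx[-> ->]|[/eqP -> /eqP ->]//].
by rewrite !eqxx.
Qed.

End BlockModel.

Section Unitarizable.
Context {C : numClosedFieldType} {disp : Order.disp_t} {P : finPOrderType disp}.
Variables (chi0 : nat) (chi : P -> nat).
Implicit Types M N : poset_rep C P.

(** The size [n] is left free, so that direct sums act on [m + n] coordinates without casts. *)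
Definition unitarizable M :=
  exists n (f : 'Hom(rep_space M, 'cV[C]_n)) (p : P -> 'M[C]_n),
  [/\ bijective f, moment_system chi0 chi p &
      forall i, (f @: rep_sub M i)%VS = column_space (p i)].

Lemma unitarizable_iso M N : rep_iso M N -> unitarizable N -> unitarizable M.
Proof.
move=> [h [bh hE]] [n [f [p [bf mp fE]]]].
exists n, (f \o h)%VF, p; split=> //.
  by apply: (eq_bij (bij_comp bf bh)) => v; rewrite comp_lfunE.
by move=> i; rewrite limg_comp hE fE.
Qed.

Lemma unitarizable_rep0 : unitarizable (rep0 : poset_rep C P).
Proof.
exists 0, \1%VF, (fun=> 0); split.
- by exists id => v; rewrite id_lfunE.
- by split=> [i|]; [exact: orth_proj0|by apply/matrixP => -[]].
- move=> i; apply/vspaceP => v.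
  by have -> : v = 0 by [exact: (flatmx0 (v : 'cV_0))]; rewrite !mem0v.
Qed.

Definition col_pair M N m n (f : 'Hom(rep_space M, 'cV[C]_m))
    (g : 'Hom(rep_space N, 'cV[C]_n)) (x : rep_space (rep_dsum M N)) :
  'cV[C]_(m + n) := col_mx (f x.1) (g x.2).

Lemma col_pair_linear M N m n f g : linear (@col_pair M N m n f g).
Proof.
by move=> a x y; rewrite /col_pair /= !linearP /= scale_col_mx add_col_mx.
Qed.

HB.instance Definition _ M N m n f g := GRing.isLinear.Build C
  (rep_space (rep_dsum M N)) 'cV[C]_(m + n) _ (@col_pair M N m n f g)
  (@col_pair_linear M N m n f g).

Lemma unitarizable_dsum M N :
  unitarizable M -> unitarizable N -> unitarizable (rep_dsum M N).
Proof.
move=> [m [f [p [bf mp fE]]]] [n [g [q [bg mq gE]]]].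
have bfg : bijective (linfun (@col_pair M N m n f g)).
  have [f' fK fK'] := bf; have [g' gK gK'] := bg.
  exists (fun v : 'cV[C]_(m + n) => (f' (usubmx v), g' (dsubmx v))).
    by move=> [x y]; rewrite lfunE /= /col_pair col_mxKu col_mxKd fK gK.
  by move=> v; rewrite lfunE /= /col_pair /= fK' gK' vsubmxK.
exists (m + n)%N, (linfun (@col_pair M N m n f g)),
  (fun i => block_mx (p i) 0 0 (q i)); split=> //.
  split=> [i|]; first exact: block_orth_proj (mp.1 i) (mq.1 i).
  exact: block_moment_sum mp.2 mq.2.
move=> i; apply/vspaceP => w; have [h _ hK] := bfg; rewrite -(hK w).
rewrite (bij_mem_img bfg) lfunE mem_rep_dsum.
rewrite (mem_block_column_space _ _ (mp.1 i) (mq.1 i)) -fE -gE.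
by rewrite (bij_mem_img bf) (bij_mem_img bg).
Qed.

End Unitarizable.

Section EnergyMinimizer.
Context {C : numClosedFieldType} {P : finType}.
Variables (chi0 : nat) (chi : P -> nat) (N : nat) (d : P -> nat).
Variable M : forall i, 'M[C]_(N.+1, d i).
Hypothesis rM : forall i, \rank (M i) = d i.
Hypothesis chi0_gt0 : (0 < chi0)%N.

Lemma energy_minimizer_moment g : g \in unitmx ->
  (forall k, k \in unitmx -> energy chi0 chi M g <= energy chi0 chi M k) ->
  \sum_i (chi i)%:R *: frame_proj (g *m M i) = chi0%:R%:M.
Proof.
move=> gU gmin.
have rgM i : \rank (g *m M i) = d i by rewrite mxrank_mul_unitl.
apply: minimal_moment => // k kU.
have := gmin (k *m g); rewrite unitmx_mul kU gU => /(_ isT).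
have dg : 0 < `|\det g| by rewrite normr_gt0 -unitfE -unitmxE.
have dk : 0 < `|\det k| by rewrite normr_gt0 -unitfE -unitmxE.
rewrite /energy det_mulmx normrM exprMn.
under [X in _ <= X / _ -> _]eq_bigr do rewrite -mulmxA.
rewrite invfM mulrA ler_pM2r ?invr_gt0 ?exprn_gt0//.
by rewrite ler_pdivlMr ?exprn_gt0//.
Qed.

End EnergyMinimizer.

Section StableUnitarizable.
Context {R : realType} {disp : Order.disp_t} {P : finPOrderType disp}.
Local Notation C := R[i].
Variables (chi0 : nat) (chi : P -> nat).
Hypothesis chi0_gt0 : (0 < chi0)%N.

Lemma stable_frames_unitary N (d : P -> nat) (M : forall i, 'M[C]_(N.+1, d i)) :
  (forall i, \rank (M i) = d i) -> (\sum_i chi i * d i = chi0 * N.+1)%N ->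
  stable_frames chi0 chi M ->
  exists2 g : 'M[C]_N.+1, g \in unitmx &
    moment_system chi0 chi (fun i => frame_proj (g *m M i)).
Proof.
move=> rM chi_d st; have [g gU gmin] := energy_minimum rM chi_d st.
have rgM i : \rank (g *m M i) = d i by rewrite mxrank_mul_unitl.
exists g; first exact: gU.
split=> [i|]; first exact: frame_proj_orth.
exact: energy_minimizer_moment.
Qed.

Lemma stable_unitarizable (M : poset_rep C P) : stable chi M ->
  (\sum_i chi i * \dim (rep_sub M i) = chi0 * rep_dim M)%N ->
  unitarizable chi0 chi M.
Proof.
move=> [dM st] slope.
have [f bf] := cV_iso (rep_space M).
move: dM st slope f bf; rewrite /rep_dim; case: (\dim {: _}) => [//|N] _ st slope f bf.
have dimf U : \dim (f @: U) = \dim U := bij_dim_img bf U.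
have /all_sig[A AE] i : {A : 'M[C]_N.+1 | column_space A = (f @: rep_sub M i)%VS}.
  exact/cid/column_space_exists.
(* The square spanning matrix is replaced by a frame of full column rank, which [frame_proj]
   requires. *)
have rA i : \rank (col_base (A i)) = \rank (A i) by apply/eqP; exact: col_base_full.
have AE' i : column_space (col_base (A i)) = (f @: rep_sub M i)%VS.
  by rewrite -AE; exact: column_space_base.
have dA i : \rank (A i) = \dim (rep_sub M i) by rewrite -dim_column_space AE dimf.
have chi_d : (\sum_i chi i * \rank (A i) = chi0 * N.+1)%N.
  by rewrite -slope; apply: eq_bigr => i _; rewrite dA.
have stA : stable_frames chi0 chi (fun i => col_base (A i)).
  move=> K K0 K1.
  pose L := (f @^-1: K)%VS.
  have fL : (f @: L)%VS = K by rewrite lpreimK// bij_limg// subvf.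
  have L0 : L != 0%VS by apply: contraNneq K0 => L0; rewrite -fL L0 limg0.
  have L1 : L != fullv.
    by apply: contraNneq K1 => L1; rewrite -fL L1 -(bij_limg bf).
  have := st L L0 L1; rewrite -(dimf L) fL.
  have -> : \sum_i (chi i)%:R * (\dim (rep_sub M i))%:R = (chi0 * N.+1)%:R :> rat.
    by rewrite -slope natr_sum; apply: eq_bigr => i _; rewrite natrM.
  have -> : \sum_i (chi i)%:R * (\dim (rep_sub M i :&: L))%:R =
      (\sum_i chi i * \dim (column_space (col_base (A i)) :&: K))%:R :> rat.
    rewrite natr_sum; apply: eq_bigr => i _; rewrite natrM AE' -fL.
    by rewrite -bij_img_cap// dimf.
  rewrite natrM mulrCA mulVf ?pnatr_eq0// mulr1 mulrC ltr_pdivrMr; last first.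
    by rewrite ltr0n lt0n dimv_eq0.
  by rewrite -natrM ltr_nat.
have [g gU mg] := stable_frames_unitary rA chi_d stA.
have bg : bijective (mx_act g).
  exists (mx_act (invmx g)) => v; rewrite !mx_actE mulmxA.
    by rewrite mulVmx ?mul1mx.
  by rewrite mulmxV ?mul1mx.
exists N.+1, (mx_act g \o f)%VF, (fun i => frame_proj (g *m col_base (A i))); split.
- by apply: (eq_bij (bij_comp bg bf)) => v; rewrite comp_lfunE.
- exact: mg.
- move=> i; rewrite limg_comp -AE' limg_mx_act column_space_frame_proj//.
  by rewrite mxrank_mul_unitl.
Qed.

Lemma polystable_unitarizable (M : poset_rep C P) :
  polystable chi0 chi M -> unitarizable chi0 chi M.
Proof.
move=> [n [N [NP MN]]]; apply: unitarizable_iso MN _.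
elim: n N NP => [|n IH] N NP.
  by rewrite big_ord0; exact: unitarizable_rep0.
rewrite big_ord_recl; apply: unitarizable_dsum; last by apply: IH => k; exact: NP.
by apply: stable_unitarizable; have [] := NP ord0.
Qed.

End StableUnitarizable.

(** * Limits of degenerating isomorphisms *)

Section Dominance.
Context {C : numClosedFieldType} {T : Type} {F : set_system T} {FF : ProperFilter F}.
Hypothesis bounded_cvg : forall f : T -> C,
  (\forall x \near F, `|f x| <= 1) -> exists l, ccvg (F := F) f l.

Lemma mcvg_orth_proj n (p : T -> 'M[C]_n) p0 : mcvg (F := F) p p0 ->
  (\forall x \near F, orth_proj (p x)) -> orth_proj p0.
Proof.
move=> pp op; split.
  apply: mcvg_unique (mcvg_adj pp) _; apply: mcvg_near_eq pp.
  by apply: filterS op => x [].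
apply: mcvg_unique (mcvgM pp pp) _; apply: mcvg_near_eq pp.
by apply: filterS op => x [].
Qed.

Lemma rank_gram m n (A : 'M[C]_(m, n)) : \rank (A^t* *m A) = \rank A.
Proof.
apply/eqP; rewrite eqn_leq mxrankM_maxr /=.
have rB : \rank (col_base A) = \rank A by apply/eqP; exact: col_base_full.
have := mulmx_base A; have := row_base_free A; move: rB.
move: (\rank A) (col_base A) (row_base A) => k c w rc fw cw.
have e : w^t* *m (c^t* *m c) *m w = A^t* *m A.
  by rewrite -cw adjmxM !mulmxA.
rewrite -e mxrankMfree// mxrankMfree ?row_free_unit ?gram_unit//.
by rewrite mxrank_adj (eqP fw).
Qed.

(** The number of columns is a variable equal to the rank, so that rewriting the rank does not touch
    the type of [Y]. *)
Lemma rank_factorization m n (A : 'M[C]_(m, n)) :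
  exists k (Y : 'M[C]_(m, k)) Z Z',
  [/\ k = \rank A, \rank Y = k, Y = A *m Z & A = Y *m Z'].
Proof.
have [Z YZ] : exists Z, col_base A = A *m Z.
  by apply/column_space_subP; rewrite column_space_base; exact: subvv.
exists (\rank A), (col_base A), Z, (row_base A); split; rewrite ?mulmx_base//.
by apply/eqP; exact: col_base_full.
Qed.

Section Key.
Variables (n : nat) (r : T -> 'I_n -> C) (p q : T -> 'M[C]_n) (p0 q0 : 'M[C]_n).
Hypothesis r_gt0 : forall x k, 0 < r x k.
Hypothesis op : forall x, orth_proj (p x).
Hypothesis oq : forall x, orth_proj (q x).
Hypothesis qtp : forall x, q x *m realdiag (r x) *m p x = realdiag (r x) *m p x.
Hypothesis pp0 : mcvg (F := F) p p0.
Hypothesis qq0 : mcvg (F := F) q q0.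

Definition coord_proj (E : pred 'I_n) : 'M[C]_n := diag_mx (\row_k (E k)%:R).

Lemma coord_proj_orth E : orth_proj (coord_proj E).
Proof.
split; rewrite /coord_proj.
  rewrite adjmx_diag; congr diag_mx; apply/rowP => k; rewrite !mxE.
  by rewrite conjC_nat.
rewrite mulmx_diag; congr diag_mx; apply/rowP => k; rewrite !mxE.
by case: (E k); rewrite ?mulr1 ?mulr0.
Qed.

Definition negligible k l := ccvg (F := F) (fun x => r x k / r x l) 0.

Variable E : pred 'I_n.
Hypothesis dom : forall k l, ~~ E l -> E k -> negligible l k.
Local Notation e := (coord_proj E).

(* The part of [Im (p x)] on which the coordinates in [E] are visible is mapped by
   [realdiag (r x)] onto a subspace of [Im (q x)], with orthogonal projection [Pi x],
   which concentrates on the coordinates in [E]. *)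
Lemma dominance : exists (W Pi H : T -> 'M[C]_n) (Pi0 H0 : 'M[C]_n),
  [/\ mcvg (F := F) H H0, mcvg (F := F) Pi Pi0,
    (\forall x \near F, [/\ realdiag (r x) *m W x = Pi x, p x *m W x = W x &
       (1%:M - e) *m W x = H x *m e *m W x]),
    (p0 *m e = e *m p0 -> H0 = 0) &
    [/\ orth_proj Pi0, e *m Pi0 = Pi0, q0 *m Pi0 = Pi0 &
       \tr Pi0 = (\rank (p0 *m e))%:R]].
Proof.
have op0 : orth_proj p0 by apply: mcvg_orth_proj pp0 _; exact: nearW.
have oe := coord_proj_orth E.
have [rho [Y [Z [Z' [rhoE rY YZ peY]]]]] := rank_factorization (p0 *m e).
have pY : p0 *m Y = Y by rewrite YZ !mulmxA op0.2.
(* No vector spanned by [Y] is invisible in the coordinates of [E]: the Gram matrix of [p0 *m e]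
   factors through [e *m Y]. *)
have reY : \rank (e *m Y) = rho.
  apply/eqP; rewrite eqn_leq rank_leq_col /= {1}rhoE -rank_gram.
  rewrite adjmxM op0.1 oe.1 mulmxA -(mulmxA e) op0.2 -mulmxA peY mulmxA.
  exact: mxrankM_maxl.
have [L0 L0Y] : exists L0, L0 *m (e *m Y) = 1%:M.
  by apply/row_fullP; rewrite /row_full reY.
(* As [J x] tends to the identity, correcting [L0] by its inverse gives an exact left inverse of
   [e *m p x *m Y] for [x] near the limit. *)
pose J x := L0 *m e *m p x *m Y.
have JJ : mcvg (F := F) J 1%:M.
  have -> : 1%:M = L0 *m e *m p0 *m Y by rewrite -!mulmxA pY L0Y.
  apply: mcvgM; last exact: mcvg_cst.
  by apply: mcvgM => //; exact: mcvg_cst.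
have [JV JU] := mcvg_invmx (unitmx1 _ _) JJ.
rewrite invmx1 in JV.
pose L x := invmx (J x) *m L0.
have LL : mcvg (F := F) L L0.
  by rewrite -(mul1mx L0); apply: mcvgM => //; exact: mcvg_cst.
pose t x := realdiag (r x); pose t' x := realdiag (fun k => (r x k)^-1).
have tt' x : t x *m t' x = 1%:M by exact: realdiagV.
have t't x : t' x *m t x = 1%:M by exact: mulmx1C.
pose B x := t x *m (p x *m Y).
(* On full column rank [X x] is the Moore-Penrose inverse of [B x], and [realdiag (r x) *m W x] is
   the projection onto the range of [B x]. *)
pose X x := invmx ((B x)^t* *m B x) *m (B x)^t*.
pose W x := p x *m Y *m X x.
(* Recovers the coordinates outside [E] of a vector in the span of [p x *m Y] from those inside
   [E]. *)
pose H x := (1%:M - e) *m p x *m Y *m L x.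
have LpY : \forall x \near F, L x *m e *m (p x *m Y) = 1%:M.
  apply: filterS JU => x JU; transitivity (invmx (J x) *m J x).
    by rewrite /L /J !mulmxA.
  by rewrite mulVmx.
have rB : \forall x \near F, \rank (B x) = rho.
  apply: filterS LpY => x LpY; apply/eqP; rewrite eqn_leq rank_leq_col /=.
  have e1 : 1%:M = (L x *m e *m t' x) *m B x.
    by rewrite /B (mulmxA _ (t x)) -(mulmxA _ (t' x)) t't mulmx1 LpY.
  by rewrite -[leqLHS](mxrank1 C rho) e1 mxrankM_maxr.
have oPi : \forall x \near F, orth_proj (frame_proj (B x)).
  by apply: filterS rB => x; exact: frame_proj_orth.
have [Pi0 PiPi] : exists Pi0, mcvg (F := F) (fun x => frame_proj (B x)) Pi0.
  by apply: (bounded_mcvg bounded_cvg); apply: filterS oPi => x oP i j; exact: orth_proj_entry_le1.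
have tW x : t x *m W x = frame_proj (B x).
  by rewrite /W /frame_proj /X /B !mulmxA.
have HW : \forall x \near F, (1%:M - e) *m W x = H x *m e *m W x.
  apply: filterS LpY => x LpY.
  transitivity ((1%:M - e) *m p x *m Y *m (L x *m e *m (p x *m Y)) *m X x).
    by rewrite LpY mulmx1 /W !mulmxA.
  by rewrite /H /W !mulmxA.
have HH : mcvg (F := F) H ((1%:M - e) *m p0 *m Y *m L0).
  by do ![apply: mcvgM => //; try exact: mcvg_cst].
exists W, (fun x => frame_proj (B x)), H, Pi0, ((1%:M - e) *m p0 *m Y *m L0).
split=> //.
- apply: filterS HW => x HW; split; [exact: tW| |exact: HW].
  by rewrite /W !mulmxA (op x).2.
- move=> pe; rewrite -(mulmxA _ p0) pY YZ pe !mulmxA mulmxBl mul1mx oe.2 subrr.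
  by rewrite !mul0mx.
have eK x : e *m t' x = t' x *m e by rewrite /coord_proj /t' /realdiag diag_mxC.
split.
- exact: mcvg_orth_proj PiPi oPi.
- apply/eqP; rewrite eq_sym -subr_eq0 -{1}(mul1mx Pi0) -mulmxBl; apply/eqP.
  (* Conjugation by [realdiag (r x)] multiplies entry [(l, k)] by [r x l / r x k]. This ratio is
     negligible for [l] outside and [k] inside [E]; the other entries vanish. *)
  pose D x := t x *m (H x *m e) *m t' x.
  have D0 : mcvg (F := F) D 0.
    have ent x (A : 'M[C]_n) l k : (t x *m (A *m e) *m t' x) l k =
        A l k * (E k)%:R * (r x l / r x k).
      rewrite /t /t' /realdiag /coord_proj !mul_mx_diag mul_diag_mx !mxE.
      by ring.
    have Hout x l k : E l -> H x l k = 0.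
      move=> El; rewrite /H -!mulmxA mxE big1// => j _.
      rewrite !mxE; case: eqP => [<-|_]; first by rewrite El subrr mul0r.
      by rewrite !mulr0n subrr mul0r.
    move=> l k; rewrite mxE.
    apply: (@ccvg_near_eq _ _ F _ (fun x => H x l k * (E k)%:R * (r x l / r x k))).
      by apply: nearW => x; rewrite /D ent.
    have [Ek|Ek] := boolP (E k); last first.
      by under eq_fun do rewrite mulr0 mul0r; exact: ccvg_cst.
    have [El|El] := boolP (E l).
      by under eq_fun do rewrite Hout// !mul0r; exact: ccvg_cst.
    under eq_fun do rewrite mulr1.
    have := ccvgM (HH l k) (dom El Ek); rewrite mulr0; exact.
  have h1 : mcvg (F := F) (fun x => (1%:M - e) *m frame_proj (B x))
      ((1%:M - e) *m Pi0).
    by apply: mcvgM => //; exact: mcvg_cst.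
  have h2 : mcvg (F := F) (fun x => D x *m frame_proj (B x)) 0.
    by rewrite -(mul0mx _ Pi0); exact: mcvgM.
  apply: mcvg_unique h1 _.
  apply: mcvg_near_eq h2; apply: filterS HW => x HW.
  have tE : (1%:M - e) *m t x = t x *m (1%:M - e).
    by rewrite mulmxBl mulmxBr mul1mx mulmx1 /coord_proj /t /realdiag diag_mxC.
  transitivity (t x *m ((1%:M - e) *m W x)).
    rewrite HW -tW /D -(mulmxA _ (t' x)) (mulmxA (t' x)) t't mul1mx.
    by rewrite -!mulmxA.
  by rewrite mulmxA -tE -mulmxA tW.
- apply: mcvg_unique (mcvgM qq0 PiPi) _.
  apply: mcvg_near_eq PiPi; apply: nearW => x.
  by rewrite -tW /W !mulmxA qtp.
- apply: ccvg_unique (ccvg_mxtrace PiPi) _.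
  apply: (@ccvg_near_eq _ _ F _ (fun=> (\rank (p0 *m e))%:R)); last exact: ccvg_cst.
  apply: filterS rB => x rB.
  by rewrite tr_frame_proj// -rhoE.
Qed.
End Key.

End Dominance.

(** This is [dim_cap_column_space] for [p] and [1%:M - e]: the kernel of [e] on the range of [p] is
    the intersection of the two ranges. *)
Lemma tr_le_rank_mul (C : numClosedFieldType) n (p e : 'M[C]_n) :
  orth_proj p -> orth_proj e ->
  \tr (p *m e) <= (\rank (p *m e))%:R ?= iff (p *m e == e *m p).
Proof.
move=> op oe; have oC := orth_projC oe.
have [le eq] := dim_cap_column_space op oC.
have rk : (\dim (column_space p :&: column_space (1%:M - e)) + \rank (p *m e) = \rank p)%N.
  have -> : \rank (p *m e) = \rank (e *m p).
    by rewrite -mxrank_adj adjmxM op.1 oe.1.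
  have := limg_ker_dim (mx_act e) (column_space p).
  rewrite limg_mx_act !dim_column_space => <-; congr (\dim (_ :&: _) + _)%N.
  apply/vspaceP => w; rewrite column_space_idemP ?oC.2// memv_ker mx_actE.
  by rewrite mulmxBl mul1mx subr_eq addrC -subr_eq subrr eq_sym.
have trE : \tr (p *m (1%:M - e)) = (\rank p)%:R - \tr (p *m e).
  by rewrite mulmxBr mulmx1 raddfB /= mxtrace_idem ?op.2.
have rkE : (\dim (column_space p :&: column_space (1%:M - e)))%:R =
    (\rank p)%:R - (\rank (p *m e))%:R :> C by rewrite -rk natrD addrK.
move: le eq; rewrite trE rkE mulmxBr mulmxBl mulmx1 mul1mx => le eq; split.
  by move: le; rewrite lerD2l lerN2.
move: eq; rewrite (inj_eq (addrI _)) eqr_opp eq_sym => ->.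
by rewrite (inj_eq (addrI _)) eqr_opp.
Qed.

Lemma mulmx_coord_projE (C : numClosedFieldType) m n (A : 'M[C]_(m, n)) (E : pred 'I_n) j k :
  (A *m coord_proj E) j k = A j k * (E k)%:R.
Proof. by rewrite /coord_proj mul_mx_diag !mxE. Qed.

Section Separation.
Context {C : numClosedFieldType} {T : Type} {F : set_system T} {FF : ProperFilter F}.
Hypothesis bounded_cvg : forall f : T -> C,
  (\forall x \near F, `|f x| <= 1) -> exists l, ccvg (F := F) f l.
Context {disp : Order.disp_t} {P : finPOrderType disp}.
Variables (chi0 : nat) (chi : P -> nat).
Hypothesis chi_gt0 : forall i, (0 < chi i)%N.

(** * Grouping of singular values by growth rate *)

Section Diagonal.
Variables (n : nat) (r : T -> 'I_n -> C) (p q : T -> P -> 'M[C]_n).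
Variables (p0 q0 : P -> 'M[C]_n).
Hypothesis r_gt0 : forall x k, 0 < r x k.
Hypothesis op : forall x i, orth_proj (p x i).
Hypothesis oq : forall x i, orth_proj (q x i).
Hypothesis qtp : forall x i, q x i *m realdiag (r x) *m p x i = realdiag (r x) *m p x i.
Hypothesis pp0 : forall i, mcvg (F := F) (fun x => p x i) (p0 i).
Hypothesis qq0 : forall i, mcvg (F := F) (fun x => q x i) (q0 i).
Hypothesis mp : moment_system chi0 chi p0.
Hypothesis mq : moment_system chi0 chi q0.
Local Notation negl := (negligible (F := F) r).

(* The chain [chi0 tr e = sum chi tr (p0 e) <= sum chi rank (p0 e) = sum chi tr Pi0
   <= sum chi tr (q0 e) = chi0 tr e] is an equality throughout. *)
Lemma dominance_split (E : pred 'I_n) :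
  (forall k l, ~~ E l -> E k -> negl l k) -> forall i,
  q0 i *m coord_proj E = coord_proj E *m q0 i /\
  exists (W Pi H : T -> 'M[C]_n),
  [/\ mcvg (F := F) H 0, mcvg (F := F) Pi (q0 i *m coord_proj E) &
    \forall x \near F, [/\ realdiag (r x) *m W x = Pi x, p x i *m W x = W x &
      (1%:M - coord_proj E) *m W x = H x *m coord_proj E *m W x]].
Proof.
move=> dom; set e := coord_proj E.
have oe : orth_proj e by exact: coord_proj_orth.
have D i := @dominance _ _ _ FF bounded_cvg _ _ _ _ _ _ r_gt0
  (fun x => op x i) (fun x => qtp x i) (@pp0 i) (@qq0 i) _ dom.
have le i : \tr (p0 i *m e) <= \tr (q0 i *m e).
  have [W [Pi [H [Pi0 [H0 [_ _ _ _ [oPi ePi qPi trPi]]]]]]] := D i.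
  have [le1 _] := tr_le_rank_mul (mp.1 i) oe; apply: le_trans le1 _.
  by rewrite -trPi; have [] := tr_mul_orth_proj_ge (mq.1 i) oe oPi qPi ePi.
have eq i : \tr (q0 i *m e) = \tr (p0 i *m e).
  have S0 : \sum_j (chi j)%:R * (\tr (q0 j *m e) - \tr (p0 j *m e)) = 0.
    under eq_bigr do rewrite mulrBr.
    by rewrite sumrB (moment_tr e mq) (moment_tr e mp) subrr.
  have ge0 j : true -> 0 <= (chi j)%:R * (\tr (q0 j *m e) - \tr (p0 j *m e)).
    by move=> _; rewrite mulr_ge0// subr_ge0.
  have /(_ i isT)/eqP := psumr_eq0P ge0 S0.
  by rewrite mulf_eq0 pnatr_eq0 eqn0Ngt chi_gt0 /= subr_eq0 => /eqP.
move=> i; have [W [Pi [H [Pi0 [H0 [HH PiPi WPi H00 [oPi ePi qPi trPi]]]]]]] := D i.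
have [le1 eq1] := tr_le_rank_mul (mp.1 i) oe.
have [le2 eq2] := tr_mul_orth_proj_ge (mq.1 i) oe oPi qPi ePi.
have pe : p0 i *m e = e *m p0 i.
  by apply/eqP; rewrite -eq1 eq_le le1 -trPi -eq le2.
have qe : q0 i *m e = Pi0.
  by apply/eqP; rewrite -eq2 eq_le le2 eq trPi le1.
split; first by rewrite -[RHS]trmxCK adjmxM oe.1 (mq.1 i).1 qe oPi.1.
by exists W, Pi, H; split; rewrite ?qe// -(H00 pe).
Qed.

(** The ratio itself may be unbounded, but [r x k / (r x k + r x l)] lies between 0 and 1 and
    converges; its limit is 0 in the first case, and inverting it gives the second. *)
Lemma negligible_or_cvg k l : negl k l \/
  exists a, ccvg (F := F) (fun x => r x l / r x k) a.
Proof.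
have rr x : 0 < r x k + r x l by rewrite addr_gt0.
have [s0 ss] : exists s0, ccvg (F := F) (fun x => r x k / (r x k + r x l)) s0.
  apply: bounded_cvg; apply: nearW => x.
  by rewrite gtr0_norm ?divr_gt0// ler_pdivrMr// mul1r lerDl ltW.
have [s00|s00] := eqVneq s0 0; [left|right].
  have : ccvg (F := F) (fun x => r x k / (r x k + r x l) *
      (1 - r x k / (r x k + r x l))^-1) (s0 * (1 - s0)^-1).
    apply: ccvgM => //; apply: ccvgV; first by rewrite s00 subr0 oner_eq0.
    by apply: ccvgB => //; exact: ccvg_cst.
  rewrite s00 mul0r; apply: ccvg_near_eq; apply: nearW => x.
  have rl0 : r x l != 0 by rewrite gt_eqF.
  have rr0 : r x k + r x l != 0 by rewrite gt_eqF.
  by field; rewrite ?rr0 ?rl0 //= (_ : _ - _ = r x l) ?rl0//; ring.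
exists (s0^-1 - 1).
have : ccvg (F := F) (fun x => (r x k / (r x k + r x l))^-1 - 1) (s0^-1 - 1).
  by apply: ccvgB; [exact: ccvgV|exact: ccvg_cst].
apply: ccvg_near_eq; apply: nearW => x.
have rk0 : r x k != 0 by rewrite gt_eqF.
have rr0 : r x k + r x l != 0 by rewrite gt_eqF.
by field; rewrite rk0 rr0.
Qed.

Lemma negligible_antisym k l : negl k l -> ~ negl l k.
Proof.
move=> kl lk.
have h : ccvg (F := F) (fun x => r x k / r x l * (r x l / r x k)) 0.
  by rewrite -(mulr0 0); exact: ccvgM kl lk.
have h1 : ccvg (F := F) (fun=> 1 : C) 0.
  apply: ccvg_near_eq h; apply: nearW => x.
  by rewrite mulf_div [X in _ / X]mulrC mulfV// mulf_neq0 ?gt_eqF.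
have h2 : ccvg (F := F) (fun=> 1 : C) 1 by exact: ccvg_cst.
have /eqP : 1 = 0 :> C by exact: ccvg_unique h2 h1.
by rewrite oner_eq0.
Qed.

Definition comparable_rates k l := ~~ `[< negl k l >] && ~~ `[< negl l k >].

Lemma comparable_rates_sym k l : comparable_rates k l = comparable_rates l k.
Proof. exact: andbC. Qed.

Lemma comparable_rates_cvg k l : comparable_rates k l ->
  exists2 a, a != 0 & ccvg (F := F) (fun x => r x k / r x l) a.
Proof.
move=> /andP[/asboolPn nkl /asboolPn nlk].
have [//|[a ra]] := negligible_or_cvg l k; exists a => //.
by apply/eqP => a0; apply: nkl; rewrite a0 in ra.
Qed.

Lemma cvg_comparable_rates a k l : a != 0 ->
  ccvg (F := F) (fun x => r x k / r x l) a -> comparable_rates k l.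
Proof.
move=> a0 ra; apply/andP; split; apply/asboolPn => kl.
  by move: a0; rewrite (ccvg_unique ra kl) eqxx.
have ra' : ccvg (F := F) (fun x => r x l / r x k) a^-1.
  apply: (ccvg_near_eq _ (ccvgV a0 ra)); apply: nearW => x.
  by rewrite invf_div.
by move: a0; rewrite -invr_eq0 (ccvg_unique ra' kl) eqxx.
Qed.

Lemma comparable_rates_refl k : comparable_rates k k.
Proof.
apply: (@cvg_comparable_rates 1); first exact: oner_neq0.
apply: (@ccvg_near_eq _ _ F _ (fun=> 1)); last exact: ccvg_cst.
by apply: nearW => x; rewrite mulfV// gt_eqF.
Qed.

Lemma rate_mul x k l m : r x k / r x l * (r x l / r x m) = r x k / r x m.
Proof. by rewrite mulrA divfK// gt_eqF. Qed.

Lemma comparable_rates_trans k l m :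
  comparable_rates k l -> comparable_rates l m -> comparable_rates k m.
Proof.
move=> /comparable_rates_cvg[a a0 ra] /comparable_rates_cvg[b b0 rb].
apply: (@cvg_comparable_rates (a * b)); first exact: mulf_neq0.
apply: (ccvg_near_eq _ (ccvgM ra rb)); apply: nearW => x; exact: rate_mul.
Qed.

(** Each rate is compared with a representative of its class. The representative is chosen by [pick]
    from the class alone, so comparable indices share it and it cancels in quotients. *)
Lemma limit_rates : exists2 tau : 'I_n -> C, (forall k, tau k != 0) &
  forall k l, comparable_rates k l ->
    ccvg (F := F) (fun x => r x k / r x l) (tau k / tau l).
Proof.
pose rep k := odflt k [pick j | comparable_rates j k].
have repk k : comparable_rates k (rep k).
  rewrite /rep; case: pickP => [j|/(_ k)]; first by rewrite comparable_rates_sym.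
  by rewrite comparable_rates_refl.
have rep_eq k l : comparable_rates k l -> rep k = rep l.
  move=> kl; rewrite /rep; have e : comparable_rates^~ k =1 comparable_rates^~ l.
    move=> j; apply/idP/idP => [jk|jl]; first exact: comparable_rates_trans jk kl.
    by apply: comparable_rates_trans jl _; rewrite comparable_rates_sym.
  rewrite (eq_pick e); case: pickP => [//|/(_ k)].
  by rewrite kl.
have /choice[tau tauP] k : exists a, a != 0 /\
    ccvg (F := F) (fun x => r x k / r x (rep k)) a.
  by have [a a0 ra] := comparable_rates_cvg (repk k); exists a.
exists tau => [k|k l kl]; first by have [] := tauP k.
have [_ rk] := tauP k; have [l0 rl] := tauP l.
rewrite (rep_eq k l kl) in rk.
apply: (ccvg_near_eq _ (ccvgM rk (ccvgV l0 rl))); apply: nearW => x.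
by rewrite invf_div rate_mul.
Qed.

(** The indices not slower than [c], and in [fast_dominates] those strictly faster, each dominate
    their complement. By [comparable_proj] the difference of these two sets is the class of [c], so
    [dominance_split] applies to single classes. *)
Lemma slow_dominated c (k l : 'I_n) :
  ~~ ~~ `[< negl l c >] -> ~~ `[< negl k c >] -> negl l k.
Proof.
move=> /negPn/asboolP lc /asboolPn kc; have [//|[a ra]] := negligible_or_cvg k c.
have h : ccvg (F := F) (fun x => r x l / r x c * (r x c / r x k)) 0.
  by rewrite -(mul0r a); exact: ccvgM.
by apply: ccvg_near_eq h; apply: nearW => x; exact: rate_mul.
Qed.

Lemma fast_dominates c (k l : 'I_n) :
  ~~ `[< negl c l >] -> `[< negl c k >] -> negl l k.
Proof.
move=> /asboolPn cl /asboolP ck; have [//|[a ra]] := negligible_or_cvg c l.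
have h : ccvg (F := F) (fun x => r x l / r x c * (r x c / r x k)) 0.
  by rewrite -(mulr0 a); exact: ccvgM.
by apply: ccvg_near_eq h; apply: nearW => x; exact: rate_mul.
Qed.

Lemma comparable_proj c : coord_proj (comparable_rates c) =
  coord_proj (fun k => ~~ `[< negl k c >]) - coord_proj (fun k => `[< negl c k >]) :> 'M[C]_n.
Proof.
rewrite /coord_proj -raddfB; congr diag_mx; apply/rowP => k; rewrite !mxE.
rewrite /comparable_rates; have [ck|nck] := asboolP (negl c k);
  have [kc|nkc] := asboolP (negl k c); rewrite /= ?subr0 ?subrr//.
by case: (negligible_antisym ck kc).
Qed.

Lemma diagonal_limit_hom : exists2 s : 'I_n -> C, (forall k, s k != 0) &
  forall i, p0 i *m realdiag s *m q0 i = realdiag s *m q0 i.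
Proof.
have [tau tau0 tauP] := limit_rates.
exists (fun k => (tau k)^-1) => [k|i]; first by rewrite invr_eq0.
set D := realdiag _.
(* The class projection of [c] leaves column [c] unchanged, so the identity may be checked one class
   at a time. *)
suff key c : p0 i *m D *m q0 i *m coord_proj (comparable_rates c) =
             D *m q0 i *m coord_proj (comparable_rates c).
  apply/matrixP => j c; have /matrixP/(_ j c) := key c.
  by rewrite !mulmx_coord_projE comparable_rates_refl !mulr1.
set E := fun k => ~~ `[< negl k c >].
have [qE [W [Pi [H [H0 PiPi WPi]]]]] := dominance_split (@slow_dominated c) i.
have [qF _] := dominance_split (@fast_dominates c) i.
rewrite -/E in qE PiPi WPi.
set e := coord_proj E in qE PiPi WPi *.
have kE : coord_proj (comparable_rates c) = e - coord_proj (fun k => `[< negl c k >]).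
  exact: comparable_proj.
set kap := coord_proj (comparable_rates c) in kE *.
have qk : q0 i *m kap = kap *m q0 i by rewrite kE mulmxBr mulmxBl qE qF.
have ek : e *m kap = kap.
  rewrite /e /kap /coord_proj mulmx_diag; congr diag_mx; apply/rowP => k.
  rewrite !mxE /comparable_rates /E; case: (`[< negl k c >]) => /=.
    by rewrite andbF mul0r.
  by rewrite mul1r.
have PiK : mcvg (F := F) (fun x => Pi x *m kap) (q0 i *m kap).
  rewrite -{2}ek mulmxA; apply: mcvgM => //; exact: mcvg_cst.
(* On [E], row [j] of [Z x] is that of [Pi x *m kap] times [r x c / r x j]. This factor tends to
   [tau c / tau j] within the class and to 0 on faster rows; rows outside [E] are controlled by
   [H x], which tends to 0. *)
pose Z x := r x c *: (W x *m kap).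
pose Z0 := tau c *: (D *m q0 i *m kap).
have Z0E j l : Z0 j l = tau c / tau j * (q0 i *m kap) j l.
  by rewrite /Z0 /D /realdiag -mulmxA mxE mul_diag_mx !mxE mulrA.
have q0k j l : ~~ comparable_rates c j -> (q0 i *m kap) j l = 0.
  by rewrite qk /kap /coord_proj mul_diag_mx !mxE => /negPf ->; rewrite mul0r.
have eZ : mcvg (F := F) (fun x => e *m Z x) Z0.
  move=> j l; rewrite Z0E.
  have eZE : \forall x \near F, r x c / r x j * (Pi x *m kap) j l * (E j)%:R =
      (e *m Z x) j l.
    apply: filterS WPi => x [WPi _ _].
    rewrite /Z -WPi -(mulmxA (realdiag _)); move: (W x *m kap) => A.
    rewrite /e /coord_proj /realdiag !mul_diag_mx !mxE.
    have rj0 : r x j != 0 by rewrite gt_eqF.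
    by field.
  apply: ccvg_near_eq eZE _.
  have [cj|ncj] := boolP (comparable_rates c j).
    have -> : E j by move: cj => /andP[].
    under eq_fun do rewrite mulr1.
    exact: ccvgM (tauP c j cj) (PiK j l).
  rewrite q0k// mulr0; have [Ej|nEj] := boolP (E j); last first.
    by under eq_fun do rewrite mulr0; exact: ccvg_cst.
  under eq_fun do rewrite mulr1.
  have ncj0 : negl c j.
    by move: ncj Ej; rewrite /comparable_rates /E => h nj;
      move: h; rewrite nj andbT negbK => /asboolP.
  rewrite -(mul0r ((q0 i *m kap) j l)); exact: ccvgM.
have eCZ : mcvg (F := F) (fun x => (1%:M - e) *m Z x) 0.
  have h : mcvg (F := F) (fun x => H x *m (e *m Z x)) 0.
    by rewrite -(mul0mx _ Z0); exact: mcvgM.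
  apply: mcvg_near_eq h; apply: filterS WPi => x [_ _ HW].
  by rewrite /Z -!scalemxAr !mulmxA HW.
have ZZ : mcvg (F := F) Z Z0.
  have h : mcvg (F := F) (fun x => e *m Z x + (1%:M - e) *m Z x) Z0.
    rewrite -(addr0 Z0) => j l; rewrite mxE; under eq_fun do rewrite mxE.
    by apply: ccvgD; [exact: eZ|exact: eCZ].
  apply: mcvg_near_eq h; apply: nearW => x.
  by rewrite -mulmxDl addrC subrK mul1mx.
have pZ : p0 i *m Z0 = Z0.
  have h : mcvg (F := F) (fun x => p x i *m Z x) (p0 i *m Z0) by exact: mcvgM.
  apply: mcvg_unique h _; apply: mcvg_near_eq ZZ.
  apply: filterS WPi => x [_ pW _].
  by rewrite /Z -scalemxAr mulmxA pW.
move: pZ; rewrite /Z0 -scalemxAr => /(scalerI (tau0 c)).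
by rewrite !mulmxA.
Qed.

End Diagonal.

(** The unitary singular factors converge, and conjugating by them leaves the diagonal case. Its
    answer maps the ranges of [q0] onto those of [p0], opposite to [g], which is harmless since
    unitary equivalence is symmetric. *)
Lemma unitary_limit n (p q : T -> P -> 'M[C]_n) (p0 q0 : P -> 'M[C]_n)
    (g : T -> 'M[C]_n) :
  (forall x i, orth_proj (p x i)) -> (forall x i, orth_proj (q x i)) ->
  (forall x, g x \in unitmx) ->
  (forall x i, q x i *m g x *m p x i = g x *m p x i) ->
  (forall i, mcvg (F := F) (fun x => p x i) (p0 i)) ->
  (forall i, mcvg (F := F) (fun x => q x i) (q0 i)) ->
  moment_system chi0 chi p0 -> moment_system chi0 chi q0 ->
  exists2 u : 'M[C]_n, u \is unitarymx & forall i, p0 i = u *m q0 i *m u^t*.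
Proof.
move=> op oq gU qgp pp0 qq0 mp mq.
have [u [v [r [uU vU r_gt0 _ gE]]]] := svd_family gU.
have unit_cvg w : (forall x, w x \is unitarymx) -> exists w0 : 'M[C]_n, mcvg (F := F) w w0.
  move=> wU; apply: (bounded_mcvg bounded_cvg).
  by apply: nearW => x i j; exact: unitary_entry_le1.
have [u0 uu0] := unit_cvg u uU; have [v0 vv0] := unit_cvg v vU.
have u0U : u0 \is unitarymx by exact: mcvg_unitary uu0 uU.
have v0U : v0 \is unitarymx by exact: mcvg_unitary vv0 vU.
have conj_orth (w a : 'M[C]_n) : w \is unitarymx -> orth_proj a ->
    orth_proj (w *m a *m w^t*).
  move=> wU [aH aI]; split; first by rewrite !adjmxM trmxCK aH mulmxA.
  by rewrite !mulmxA -(mulmxA _ (w^t*) w) unitarymx_adj// mulmx1 -(mulmxA w) aI.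
have conj_moment (w : 'M[C]_n) (a : P -> 'M[C]_n) : w \is unitarymx ->
    moment_system chi0 chi a -> moment_system chi0 chi (fun i => w *m a i *m w^t*).
  move=> wU [oa sa]; split=> [i|]; first exact: conj_orth.
  transitivity (w *m (\sum_i (chi i)%:R *: a i) *m w^t*).
    rewrite mulmx_sumr mulmx_suml; apply: eq_bigr => i _.
    by rewrite -scalemxAr -scalemxAl.
  by rewrite sa mul_mx_scalar -scalemxAl (unitarymxP wU) scalemx1.
have uCU x : (u x)^t* \is unitarymx by rewrite trmxC_unitary.
have u0CU : u0^t* \is unitarymx by rewrite trmxC_unitary.
pose p' x i := v x *m p x i *m (v x)^t*.
pose q' x i := (u x)^t* *m q x i *m (u x)^t*^t*.
have qtp x i : q' x i *m realdiag (r x) *m p' x i = realdiag (r x) *m p' x i.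
  rewrite /q' /p' trmxCK.
  transitivity ((u x)^t* *m (q x i *m g x *m p x i) *m (v x)^t*).
    by rewrite gE !mulmxA.
  by rewrite qgp gE !mulmxA (unitarymx_adj (uU x)) mul1mx.
have [s s0 sP] := @diagonal_limit_hom n r p' q'
  (fun i => v0 *m p0 i *m v0^t*) (fun i => u0^t* *m q0 i *m u0^t*^t*) r_gt0
  (fun x i => conj_orth _ _ (vU x) (op x i)) qtp
  (fun i => mcvgM (mcvgM vv0 (@pp0 i)) (mcvg_adj vv0))
  (fun i => mcvgM (mcvgM (mcvg_adj uu0) (@qq0 i)) (mcvg_adj (mcvg_adj uu0)))
  (conj_moment _ _ v0U mp) (conj_moment _ _ u0CU mq).
pose h := v0^t* *m realdiag s *m u0^t*.
have hU : h \in unitmx.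
  have v0CU : v0^t* \in unitmx by rewrite unitarymx_unit// trmxC_unitary.
  by rewrite !unitmx_mul v0CU (realdiag_unit s0) unitarymx_unit.
have phq i : p0 i *m h *m q0 i = h *m q0 i.
  have e := sP i; rewrite trmxCK in e.
  transitivity (v0^t* *m (v0 *m p0 i *m v0^t* *m realdiag s *m
      (u0^t* *m q0 i *m u0)) *m u0^t*).
    rewrite /h !mulmxA (unitarymx_adj v0U) mul1mx.
    by rewrite -!(mulmxA _ u0 (u0^t*)) (unitarymxP u0U) !mulmx1.
  rewrite e /h !mulmxA.
  by rewrite -!(mulmxA _ u0 (u0^t*)) (unitarymxP u0U) !mulmx1.
apply: unitary_equiv_of_commute hU mq.1 mp.1 _.
exact: moment_hom_commute chi_gt0 mq.1 mp.1 mq.2 mp.2 phq.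
Qed.

End Separation.

(** * Topology of the orbit spaces *)

Lemma cvg_initial (Y : choiceType) (Z : topologicalType) (w : Y -> Z) T
    (F : set_system T) {FF : Filter F} (f : T -> initial_topology w)
    (l : initial_topology w) :
  (fun x => w (f x)) @ F --> w l -> f @ F --> l.
Proof.
move=> fl U [? /= [[W oW <-]]] /= Wl /filterS; apply.
by apply: fl; exact: open_nbhs_nbhs.
Qed.

Lemma cvg_prod_topology (I : Type) (K : I -> topologicalType) T
    (F : set_system T) {FF : Filter F} (f : T -> prod_topology K)
    (l : prod_topology K) :
  (forall i, (fun x => f x i) @ F --> l i) -> f @ F --> l.
Proof.
move=> fl; apply/cvg_sup => i.
exact: (@cvg_initial _ _ (fun g : prod_topology K => g i) _ F _ f l (fl i)).
Qed.

Section GenericLimits.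
Context {C : numClosedFieldType} {T : Type} {F : set_system T} {FF : ProperFilter F}.

Lemma frame_proj_cvg n k (f : T -> 'M[C]_(n, k)) L : \rank L = k ->
  mcvg (F := F) f L -> mcvg (F := F) (fun x => frame_proj (f x)) (frame_proj L).
Proof.
move=> rL fL.
have fL' : mcvg (F := F) (fun x => (f x)^t*) (L^t*) by exact: mcvg_adj.
apply: mcvgM => //; apply: mcvgM => //.
by have [] := mcvg_invmx (gram_unit rL) (mcvgM fL' fL).
Qed.

Lemma full_rank_near n k (f : T -> 'M[C]_(n, k)) L : \rank L = k ->
  mcvg (F := F) f L -> \forall x \near F, \rank (f x) = k.
Proof.
move=> rL fL; have fL' : mcvg (F := F) (fun x => (f x)^t*) (L^t*) by exact: mcvg_adj.
have [_] := mcvg_invmx (gram_unit rL) (mcvgM fL' fL).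
apply: filterS => x; rewrite -row_full_unit /row_full => /eqP rk.
apply/eqP; rewrite eqn_leq rank_leq_col /= -[leqLHS]rk.
exact: mxrankM_maxr.
Qed.

End GenericLimits.

Section Topology.
Context {R : realType}.
Local Notation C := R[i].

Lemma cvg_matrixP T (F : set_system T) {FF : ProperFilter F} m n
    (f : T -> 'M[C]_(m, n)) (L : 'M[C]_(m, n)) :
  (f @ F --> (L : ('M[C]_(m, n) : topologicalType))) <-> mcvg (F := F) f L.
Proof. exact: cvg_mcvgE. Qed.

Lemma Gr_space_pi k n (M : frame (R := R) k n) :
  Gr_space (\pi_(Gr k n) M) = column_space (val M).
Proof. by rewrite unlock. Qed.

Definition Gr_proj k n (g : 'M[C]_n) (W : Gr (R := R) k n) : 'M[C]_n :=
  s2val (cid2 (orth_proj_exists (mx_act g @: Gr_space W)%VS)).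

Lemma Gr_projP k n (g : 'M[C]_n) (W : Gr k n) : orth_proj (Gr_proj g W).
Proof. by rewrite /Gr_proj; case: cid2. Qed.

Lemma column_space_Gr_proj k n (g : 'M[C]_n) (W : Gr k n) :
  column_space (Gr_proj g W) = (mx_act g @: Gr_space W)%VS.
Proof. by rewrite /Gr_proj; case: cid2. Qed.

(** Continuity is tested on frames, by the quotient topology; there the projection is the explicit
    [frame_proj] of [g *m val M], by uniqueness of the projection onto a subspace. *)
Lemma Gr_proj_continuous k n (g : 'M[C]_n) : g \in unitmx ->
  continuous (Gr_proj g : Gr k n -> 'M[C]_n).
Proof.
move=> gU; apply/quotient_continuous.
have -> : Gr_proj g \o \pi_(Gr k n) = (fun M : frame k n => frame_proj (g *m val M)).
  apply/funext => M; have rM : \rank (val M) = k by exact: set_mem (valP M).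
  have rgM : \rank (g *m val M) = k by rewrite mxrank_mul_unitl.
  apply: orth_proj_inj; [exact: Gr_projP|exact: frame_proj_orth|].
  by rewrite column_space_Gr_proj column_space_frame_proj// -limg_mx_act Gr_space_pi.
move=> M; apply/(@cvg_matrixP _ (nbhs M) (nbhs_pfilter M)).
have rM : \rank (g *m val M) = k.
  by rewrite mxrank_mul_unitl//; exact: set_mem (valP M).
have valM : mcvg (F := nbhs M) (fun M : frame k n => val M) (val M).
  by apply/(@cvg_matrixP _ (nbhs M) (nbhs_pfilter M)); exact: initial_continuous.
have gM : mcvg (F := nbhs M) (fun M : frame k n => g *m val M) (g *m val M).
  by apply: mcvgM valM; exact: mcvg_cst.
exact: (@frame_proj_cvg _ _ _ (nbhs_pfilter M) _ _ _ _ rM gM).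
Qed.

End Topology.

(** * Projection systems and polystable configurations *)

Section Correspondence.
Context {R : realType} {disp : Order.disp_t} {P : finPOrderType disp}.
Local Notation C := R[i].
Variables (d0 : nat) (d : P -> nat) (chi0 : nat) (chi : P -> nat).
Hypothesis chi0_gt0 : (0 < chi0)%N.
Hypothesis chi_gt0 : forall i, (0 < chi i)%N.
Local Notation A := (projection_systems R d0 d chi0 chi).
Local Notation B := (polystable_configurations R d0 d chi0 chi).

Lemma system_moment (p : A) : moment_system chi0 chi (val p).
Proof.
have [h _ s] := set_mem (valP p); split=> // i.
by have [h1 h2 _] := h i; split; rewrite -?h1 -?h2.
Qed.

Lemma system_rank (p : A) i : \rank (val p i) = d i.
Proof. by have [h _ _] := set_mem (valP p); have [] := h i. Qed.

Lemma system_increasing (p : A) : column_increasing (val p).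
Proof.
move=> i j ij; rewrite column_space_sub_idem ?((system_moment p).1 j).2//.
by have [_ h _] := set_mem (valP p); have [_ ->] := h i j ij.
Qed.

Lemma systemP (p : P -> 'M[C]_d0) : moment_system chi0 chi p ->
  (forall i, \rank (p i) = d i) -> column_increasing p -> A p.
Proof.
move=> mp rp ip; split=> [i|i j ij|]; last exact: mp.2.
  by have [pH pI] := mp.1 i; split; rewrite ?pH ?pI.
have /eqP ji : p j *m p i == p i by rewrite -column_space_sub_idem ?(mp.1 j).2// ip.
by split=> //; exact: orth_proj_absorbC (mp.1 i) (mp.1 j) ji.
Qed.

Lemma system_dim (p : A) i : \dim (column_space (val p i)) == d i.
Proof. by rewrite dim_column_space system_rank. Qed.

Definition system_Gr (p : A) (i : P) : Gr (R := R) (d i) d0 :=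
  exist _ (column_space (val p i)) (system_dim p i).

Lemma system_configuration (p : A) :
  (fun i => system_Gr p i) \in configurations (R := R) (d0 := d0) (d := d).
Proof. by apply/mem_set => i j; exact: (@system_increasing p). Qed.

Definition system_conf (p : A) : configurations (R := R) (d0 := d0) (d := d) :=
  exist _ (fun i => system_Gr p i) (system_configuration p).

Lemma system_polystable (p : A) : system_conf p \in B.
Proof.
apply/mem_set; apply: polystable_iso; last first.
  exact: (moment_polystable chi_gt0 (@system_increasing p) (system_moment p)).
apply: (@rep_isoP _ _ _ (rep_of (system_conf p)) (proj_rep (@system_increasing p)) idfun).
  by exists id.
by [].
Qed.

Definition system_to_conf (p : A) : B := exist _ (system_conf p) (system_polystable p).

Lemma Gr_space_system (p : A) i :
  Gr_space (val (val (system_to_conf p)) i) = column_space (val p i).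
Proof. by []. Qed.

Lemma dim_Gr_space k n (W : Gr (R := R) k n) : \dim (Gr_space W) = k.
Proof. by rewrite /Gr_space; case: W => W /= /eqP. Qed.

Lemma conf_unitary (V : B) : exists (q : A) (g : 'M[C]_d0), g \in unitmx /\
  forall i, column_space (val q i) = (mx_act g @: Gr_space (val (val V) i))%VS.
Proof.
have pV : polystable chi0 chi (rep_of (val V)) by exact: set_mem (valP V).
have [n [f [p [bf mp fE]]]] := polystable_unitarizable chi0_gt0 pV.
have en : n = d0.
  have := bij_dim_img bf fullv; rewrite (bij_limg bf) !dimvf /dim /= !muln1.
  exact.
move: f p bf mp fE; rewrite en => f p bf mp fE {n en}.
have [g fg] := lfun_mx f.
have gU : g \in unitmx.
  rewrite -row_full_unit /row_full -dim_column_space /column_space -fg.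
  by rewrite (bij_limg bf) dimvf /dim /= muln1.
have qA : A p.
  apply: systemP => // [i|i j ij].
    by rewrite -dim_column_space -fE (bij_dim_img bf) dim_Gr_space.
  by rewrite -!fE limgS//; exact: (@rep_subS _ _ _ (rep_of (val V)) i j ij).
exists (exist _ p (mem_set qA)), g; split=> // i.
by rewrite /= -fE fg.
Qed.

Lemma U_orbit_of_iso (p q : A) (g : 'M[C]_d0) : g \in unitmx ->
  (forall i, column_space (val q i) = (mx_act g @: column_space (val p i))%VS) ->
  U_orbit p q.
Proof.
move=> gU gE; apply/asboolP.
have mp := system_moment p; have mq := system_moment q.
apply: (unitary_equiv_of_commute gU mp.1 mq.1).
apply: moment_hom_commute chi_gt0 mp.1 mq.1 mp.2 mq.2 _ => i.
rewrite -mulmxA; apply/eqP; rewrite -column_space_sub_idem ?(mq.1 i).2//.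
by rewrite gE limg_mx_act subvv.
Qed.

Lemma GL_orbit_of_iso (V W : B) (g : 'M[C]_d0) : g \in unitmx ->
  (forall i, Gr_space (val (val W) i) = (mx_act g @: Gr_space (val (val V) i))%VS) ->
  GL_orbit V W.
Proof. by move=> gU gE; apply/asboolP; exists g. Qed.

Lemma U_orbit_iso (p q : A) : U_orbit p q -> exists2 g : 'M[C]_d0, g \in unitmx &
  forall i, column_space (val q i) = (mx_act g @: column_space (val p i))%VS.
Proof.
move=> /asboolP[u uU uE]; exists u; first exact: unitarymx_unit.
by move=> i; rewrite uE column_space_unitary_conj//; exact: ((system_moment p).1 i).2.
Qed.

End Correspondence.

Lemma Gr_space_inj (R : realType) k n : injective (@Gr_space R k n).
Proof.
move=> [V dV] [W dW]; rewrite /Gr_space /= => VW; subst W.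
by congr exist; exact: bool_irrelevance.
Qed.

Section Continuity.
Context {R : realType} {disp : Order.disp_t} {P : finPOrderType disp}.
Local Notation C := R[i].
Variables (d0 : nat) (d : P -> nat) (chi0 : nat) (chi : P -> nat).
Hypothesis chi0_gt0 : (0 < chi0)%N.
Hypothesis chi_gt0 : forall i, (0 < chi i)%N.
Local Notation A := (projection_systems R d0 d chi0 chi).
Local Notation B := (polystable_configurations R d0 d chi0 chi).

Lemma system_entry_cvg (p : A) i :
  mcvg (F := nbhs p) (fun q : A => val q i) (val p i).
Proof.
apply/(@cvg_matrixP _ _ (nbhs p) (nbhs_pfilter p)).
exact: (continuous_comp (@initial_continuous _ _ (set_val : A -> _) p)
  (@proj_continuous P (fun=> 'M[C]_d0) i (val p))).
Qed.

Lemma system_Gr_continuous i : continuous (fun p : A => system_Gr p i).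
Proof.
move=> p U; rewrite nbhsE => -[G [oG Gp] GU].
have FF : ProperFilter (nbhs p) := nbhs_pfilter p.
(* One frame at [p] is fixed and moved by the nearby projections: [val q i *m N] depends
   continuously on [q], keeps full rank near [p], and therefore spans the range of [val q i]. *)
pose N := repr (system_Gr p i).
have NE : column_space (val N) = column_space (val p i).
  by rewrite -Gr_space_pi reprK.
have rN : \rank (val N) = d i by exact: set_mem (valP N).
have [G' oG' G'E] : open (\pi_(Gr (R := R) (d i) d0) @^-1` G) by exact: oG.
have pN : val p i *m val N = val N.
  apply/eqP; rewrite -column_space_sub_idem ?((system_moment p).1 i).2//.
  by rewrite NE subvv.
have qN : mcvg (F := nbhs p) (fun q : A => val q i *m val N) (val N).
  by rewrite -{2}pN; apply: mcvgM (@system_entry_cvg p i) _; exact: mcvg_cst.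
have nearG' : \forall q \near nbhs p, G' (val q i *m val N).
  have /(@cvg_matrixP _ _ (nbhs p) (nbhs_pfilter p)) := qN; apply.
  apply: open_nbhs_nbhs; split=> //.
  have : (\pi_(Gr (R := R) (d i) d0) @^-1` G) N by rewrite /= reprK.
  by rewrite -G'E.
have nearR : \forall q \near nbhs p, \rank (val q i *m val N) = d i.
  exact: full_rank_near rN qN.
apply: filterS2 nearG' nearR => q qG' qR.
apply: GU; pose M : frame (d i) d0 := exist _ (val q i *m val N) (mem_set qR).
have -> : system_Gr q i = \pi_(Gr (R := R) (d i) d0) M.
  apply: Gr_space_inj; rewrite Gr_space_pi /=; apply/esym/eqP.
  rewrite eqEdim !dim_column_space qR (system_rank q) leqnn andbT.
  by apply/column_space_subP; eexists.
have : (val @^-1` G') M by [].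
by rewrite G'E.
Qed.

Lemma system_to_conf_continuous :
  continuous (system_to_conf chi_gt0 : A -> B).
Proof.
apply: continuous_comp_initial; apply: continuous_comp_initial.
move=> p; apply: (@cvg_prod_topology _ _ _ (nbhs p) (nbhs_filter p)) => i.
exact: system_Gr_continuous.
Qed.

Lemma conf_proj_continuous (g : 'M[C]_d0) i : g \in unitmx ->
  continuous (fun V : B => Gr_proj g (val (val V) i)).
Proof.
move=> gU V.
pose Conf := configurations (R := R) (d0 := d0) (d := d).
have c1 : continuous (set_val : B -> Conf) by exact: initial_continuous.
have c2 : continuous (set_val : Conf ->
    prod_topology (fun i : P => Gr (R := R) (d i) d0)).
  exact: initial_continuous.
have c3 := @proj_continuous P (fun i => Gr (R := R) (d i) d0) i.
have c4 := @Gr_proj_continuous R (d i) d0 g gU.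
move=> U nU; have h4 := c4 (val (val V) i) U nU.
have h3 := c3 (val (val V)) _ h4.
have h2 := c2 (val V) _ h3.
exact: (c1 V _ h2).
Qed.

Lemma conf_proj_cvg T (F : set_system T) {FF : ProperFilter F} (f : T -> B) (V : B)
    (g : 'M[C]_d0) i : g \in unitmx -> f @ F --> V ->
  mcvg (F := F) (fun x => Gr_proj g (val (val (f x)) i)) (Gr_proj g (val (val V) i)).
Proof.
move=> gU fV; apply/cvg_matrixP.
move=> U nU; have h := @conf_proj_continuous g i gU V U nU; exact: (fV _ h).
Qed.

End Continuity.

Lemma mcvg_moment (C : numClosedFieldType) (disp : Order.disp_t) (P : finPOrderType disp)
    T (F : set_system T) {FF : ProperFilter F} chi0 (chi : P -> nat) n
    (p : T -> P -> 'M[C]_n) p0 :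
  (forall i, mcvg (F := F) (fun x => p x i) (p0 i)) ->
  (forall x, moment_system chi0 chi (p x)) -> moment_system chi0 chi p0.
Proof.
move=> pp mp; split=> [i|].
  by apply: mcvg_orth_proj (@pp i) _; apply: nearW => x; exact: (mp x).1.
have h : mcvg (F := F) (fun x => \sum_i (chi i)%:R *: p x i) (\sum_i (chi i)%:R *: p0 i).
  by apply: mcvg_sum => i; apply: mcvgZ (@pp i); exact: ccvg_cst.
apply: mcvg_unique h _; apply: (@mcvg_near_eq _ _ F _ _ _ (fun=> chi0%:R%:M)); last exact: mcvg_cst.
by apply: nearW => x; rewrite (mp x).2.
Qed.

Lemma mcvg_rank_orth_proj (C : numClosedFieldType)
    T (F : set_system T) {FF : ProperFilter F} n k
    (p : T -> 'M[C]_n) p0 : mcvg (F := F) p p0 ->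
  (forall x, orth_proj (p x)) -> (forall x, \rank (p x) = k) -> \rank p0 = k.
Proof.
move=> pp op rp; have op0 : orth_proj p0 by apply: mcvg_orth_proj pp _; exact: nearW.
apply/eqP; rewrite -(eqr_nat C) -(mxtrace_idem op0.2); apply/eqP.
apply: ccvg_unique (ccvg_mxtrace pp) _.
apply: (@ccvg_near_eq _ _ F _ (fun=> k%:R)); last exact: ccvg_cst.
by apply: nearW => x; rewrite mxtrace_idem ?rp//; exact: (op x).2.
Qed.

Lemma mcvg_mul_fix (C : numClosedFieldType)
    T (F : set_system T) {FF : ProperFilter F} m n
    (p : T -> 'M[C]_m) (q : T -> 'M[C]_(m, n)) p0 q0 :
  mcvg (F := F) p p0 -> mcvg (F := F) q q0 ->
  (forall x, p x *m q x = q x) -> p0 *m q0 = q0.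
Proof.
move=> pp qq pq; apply: mcvg_unique (mcvgM pp qq) _.
by apply: mcvg_near_eq qq; apply: nearW.
Qed.

Section Quotients.
Context {R : realType} {disp : Order.disp_t} {P : finPOrderType disp}.
Local Notation C := R[i].
Variables (d0 : nat) (d : P -> nat) (chi0 : nat) (chi : P -> nat).
Hypothesis chi0_gt0 : (0 < chi0)%N.
Hypothesis chi_gt0 : forall i, (0 < chi i)%N.
Local Notation A := (projection_systems R d0 d chi0 chi).
Local Notation B := (polystable_configurations R d0 d chi0 chi).

(** Compactness of the space of projection systems: entries are bounded by 1 and all defining
    conditions are closed, the rank being a trace. *)
Lemma ultra_system_cvg T (F : set_system T) (UF : UltraFilter F) (f : T -> A) :
  exists q : A, f @ F --> q.
Proof.
have FF : ProperFilter F := ultra_proper.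
have /choice[Q fQ] i : exists L, mcvg (F := F) (fun x => val (f x) i) L.
  apply: ultra_mcvg; apply: nearW => x k l.
  exact: orth_proj_entry_le1 ((system_moment (f x)).1 i).
have mQ : moment_system chi0 chi Q.
  by apply: mcvg_moment fQ _ => x; exact: system_moment.
have AQ : A Q.
  apply: systemP => // [i|i j ij].
    apply: mcvg_rank_orth_proj (@fQ i) _ _ => x; last exact: system_rank.
    exact: (system_moment (f x)).1.
  rewrite column_space_sub_idem ?(mQ.1 j).2//; apply/eqP.
  apply: mcvg_mul_fix (@fQ j) (@fQ i) _ => x; apply/eqP.
  rewrite -column_space_sub_idem ?((system_moment (f x)).1 j).2//.
  exact: system_increasing.
exists (exist _ Q (mem_set AQ)); apply: cvg_initial; apply: cvg_prod_topology => i.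
apply/cvg_matrixP; exact: fQ.
Qed.

Lemma cvg_system_entry T (F : set_system T) {FF : ProperFilter F} (f : T -> A) (q : A) i :
  f @ F --> q -> mcvg (F := F) (fun x => val (f x) i) (val q i).
Proof.
move=> fq j k U nU; have h := @system_entry_cvg _ _ _ _ _ _ _ q i j k U nU.
exact: (fq _ h).
Qed.

Lemma unitary_system_continuous (h : B -> A) (g : B -> 'M[C]_d0) :
  (forall V, g V \in unitmx) ->
  (forall V i, column_space (val (h V) i) = (mx_act (g V) @: Gr_space (val (val V) i))%VS) ->
  continuous (fun V => U_class (h V)).
Proof.
(* A closure point of the preimage of a closed set is the limit of an ultrafilter containing that
   preimage; along it [h] converges to some [Q], and it remains to identify the orbit of [Q]. *)
move=> gU hE; apply/continuous_closedP => K cK V0; rewrite closureEcvg /=.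
move=> [G0 PG0 [G0V G0K]]; have [G [UG G0G]] := @ultraFilterLemma _ G0 PG0.
have FG : ProperFilter G by exact: ultra_proper.
have GV : G --> V0 by apply: subset_trans G0G.
have [Q hQ] := ultra_system_cvg UG h.
have KQ : K (U_class Q).
  have GK : \forall V \near G, K (U_class (h V)) by apply: G0G; exact: G0K.
  refine (@closed_cvg _ _ G FG (fun V => U_class (h V)) K cK GK (U_class Q) _) => U nU.
  have h1 := @pi_continuous _ {eq_quot @U_equiv R disp P d0 d chi0 chi} Q U nU.
  exact: (hQ _ h1).
suff QV0 : U_orbit Q (h V0).
  suff -> : U_class (h V0) = U_class Q by [].
  by apply/esym/eqmodP.
have gV0 : g V0 \in unitmx by [].
have mQ := system_moment Q.
(* With [g V0] held fixed, the projections onto the images of [V] converge to the system [h V0]. *)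
have p0E i : Gr_proj (g V0) (val (val V0) i) = val (h V0) i.
  apply: orth_proj_inj; [exact: Gr_projP|exact: (system_moment (h V0)).1|].
  by rewrite column_space_Gr_proj hE.
have pV i : mcvg (F := G) (fun V : B => Gr_proj (g V0) (val (val V) i)) (val (h V0) i).
  by rewrite -p0E; exact: conf_proj_cvg GV.
have qV i : mcvg (F := G) (fun V : B => val (h V) i) (val Q i).
  exact: (@cvg_system_entry _ _ FG h Q i hQ).
have oV (V : B) i : orth_proj (Gr_proj (g V0) (val (val V) i)) by exact: Gr_projP.
have ohV (V : B) i : orth_proj (val (h V) i) by exact: (system_moment (h V)).1.
(* These matrices carry the images under [g V0] onto the ranges of [h V]; they may degenerate along
   the ultrafilter, the case covered by [unitary_limit]. *)
have guV (V : B) : g V *m invmx (g V0) \in unitmx.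
  by rewrite unitmx_mul unitmx_inv gU gV0.
have fixV (V : B) i : val (h V) i *m (g V *m invmx (g V0)) *m
    Gr_proj (g V0) (val (val V) i) =
    g V *m invmx (g V0) *m Gr_proj (g V0) (val (val V) i).
  apply/eqP; rewrite -mulmxA -column_space_sub_idem ?(ohV V i).2//.
  rewrite -limg_mx_act column_space_Gr_proj -limg_comp -mx_actM -mulmxA mulVmx//.
  by rewrite mulmx1 hE subvv.
have [u uU uE] := @unitary_limit C B G FG (fun f => @ultra_cvg_complex R B G f UG) disp P
    chi0 chi chi_gt0 d0 _ _ (val (h V0)) (val Q) _ oV ohV guV fixV pV qV
    (system_moment (h V0)) mQ.
by apply/asboolP; exists u.
Qed.
End Quotients.

Theorem theorem3 (R : realType) (disp : Order.disp_t) (P : finPOrderType disp)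
    (d0 : nat) (d : P -> nat) (chi0 : nat) (chi : P -> nat)
    (chi0_gt0 : (0 < chi0)%N) (chi_gt0 : forall i : P, (0 < chi i)%N)
    (chi_d : (\sum_(i : P) chi i * d i)%N = (chi0 * d0)%N) :
  exists Phi : projection_systems R d0 d chi0 chi ->
               polystable_configurations R d0 d chi0 chi,
    (forall p i, Gr_space (val (val (Phi p)) i) = column_space (val p i)) /\
    exists F : projection_orbits R d0 d chi0 chi ->
               polystable_orbits R d0 d chi0 chi,
      (forall p, F (U_class p) = GL_class (Phi p)) /\ homeomorphism F.
Proof.
exists (system_to_conf chi_gt0); split; first exact: Gr_space_system.
pose A := projection_systems R d0 d chi0 chi.
pose B := polystable_configurations R d0 d chi0 chi.
pose AU := {eq_quot @U_equiv R disp P d0 d chi0 chi}.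
pose BG := {eq_quot @GL_equiv R disp P d0 d chi0 chi}.
have /choice[h /choice[g hg]] : forall V : B, exists q : A, exists g : 'M[R[i]]_d0,
    g \in unitmx /\
    forall i, column_space (val q i) = (mx_act g @: Gr_space (val (val V) i))%VS.
  exact: conf_unitary.
have gU V : g V \in unitmx by have [] := hg V.
have hE V i : column_space (val (h V) i) = (mx_act (g V) @: Gr_space (val (val V) i))%VS.
  by have [_] := hg V; apply.
have hGL (V W : B) : GL_orbit V W -> U_orbit (h V) (h W).
  move=> /asboolP[k kU kE].
  apply: (@U_orbit_of_iso _ _ _ _ _ _ _ chi_gt0 _ _ (g W *m k *m invmx (g V))).
    by rewrite !unitmx_mul unitmx_inv !gU kU.
  move=> i; rewrite !hE kE -!limg_comp -!mx_actM -mulmxA mulVmx// mulmx1.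
  by rewrite mx_actM.
have PhiU (p q : A) : U_orbit p q -> GL_orbit (system_to_conf chi_gt0 p) (system_to_conf chi_gt0 q).
  by move=> /U_orbit_iso[k kU kE]; exact: GL_orbit_of_iso kU _.
have hPhi (p : A) : U_orbit (h (system_to_conf chi_gt0 p)) p.
  apply: U_orbit_inv.
  by apply: (@U_orbit_of_iso _ _ _ _ _ _ _ chi_gt0 _ _ (g (system_to_conf chi_gt0 p))).
have Phih (V : B) : GL_orbit V (system_to_conf chi_gt0 (h V)).
  by apply: (@GL_orbit_of_iso _ _ _ _ _ _ _ _ _ (g V)) => // i; exact: hE.
(* Both maps are defined on chosen representatives; [FE] and [GE] remove the choice, after which
   continuity is checked before passing to the quotient. *)
pose F (x : projection_orbits R d0 d chi0 chi) :=
  GL_class (system_to_conf chi_gt0 (repr (x : AU))).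
pose G (y : polystable_orbits R d0 d chi0 chi) := U_class (h (repr (y : BG))).
have FE (p : A) : F (U_class p) = GL_class (system_to_conf chi_gt0 p).
  apply/eqmodP; apply: PhiU.
  by apply/(@eqmodP _ (@U_equiv R disp P d0 d chi0 chi)); rewrite reprK.
have GE (V : B) : G (GL_class V) = U_class (h V).
  apply/eqmodP; apply: hGL.
  by apply/(@eqmodP _ (@GL_equiv R disp P d0 d chi0 chi)); rewrite reprK.
exists F; split=> //; split.
  apply/quotient_continuous.
  have -> : F \o \pi_AU = (@GL_class R disp P d0 d chi0 chi) \o (system_to_conf chi_gt0).
    by apply/funext => p; exact: FE.
  move=> p U nU.
  have h1 := @pi_continuous _ BG (system_to_conf chi_gt0 p) U nU.
  exact: (system_to_conf_continuous h1).
exists G; split.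
- apply/quotient_continuous.
  have -> : G \o \pi_BG = (fun V => U_class (h V)).
    by apply/funext => V; exact: GE.
  exact: unitary_system_continuous gU hE.
- move=> x; rewrite -[x](@reprK _ AU); move: (repr _) => p.
  rewrite -/(U_class p) FE GE; apply/eqmodP; exact: hPhi.
- move=> y; rewrite -[y](@reprK _ BG); move: (repr _) => V.
  rewrite -/(GL_class V) GE FE; apply/esym/eqmodP; exact: Phih.
Qed.
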